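(* Consider a Hawkes process with background intensity $\lambda_\infty>0$ and mark $B$ for which the first two moments $b_1:=\mathbb{E}B$ and $b_2:=\mathbb{E}B^2$ are finite, and whose excitation function is $h(u)=e^{-ru}$, $u\geqslant0$, with $r>0$. Let $\rho:=b_1\int_0^\infty h(u)\,\mathrm du=b_1/r$ and let $\Lambda$ be the stationary intensity. As $\rho\uparrow1$, $$(1-\rho)\Lambda\ \stackrel{d}{\to}\ \Gamma\left(\frac{2r\lambda_\infty}{b_2},\frac{2r}{b_2}\right).$$
   Context: Hawkes process: $B$ is a random variable with nonnegative support and $B_1,B_2,\dots$ are i.i.d. copies of $B$. $(M(t))_{t\geqslant0}$ is a counting process with arrival epochs $t_1<t_2<\cdots$ and associated filtration $\mathscr{F}(t)$ such that, as $\Delta t\downarrow0$, $\mathbb{P}(M(t+\Delta t)-M(t)=1\mid\mathscr{F}(t))=\Lambda(t)\Delta t+o(\Delta t)$, the conditional probability of more than one arrival is $o(\Delta t)$, and that of no arrival is $1-\Lambda(t)\Delta t+o(\Delta t)$, where $\Lambda(t)=\lambda_\infty+\sum_{t_i<t}B_ih(t-t_i)$. For $\rho<1$ (stability), the stationary intensity $\Lambda=\Lambda(\infty)$ is distributed as the limit of $\Lambda(t)$ as $t\to\infty$. $\Gamma(\alpha_1,\alpha_2)$ denotes the Gamma distribution with shape parameter $\alpha_1$ and rate parameter $\alpha_2$; $\stackrel{d}{\to}$ is convergence in distribution. *)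

(* Defs.v *)
From HB Require Import structures.
From mathcomp Require Import all_boot all_order all_algebra.
From mathcomp Require Import all_classical all_reals all_analysis.
From mathcomp Require Import measurable_realfun.

Set Implicit Arguments.
Unset Strict Implicit.
Unset Printing Implicit Defensive.

Import Order.TTheory GRing.Theory Num.Theory.
Import numFieldNormedType.Exports.

Local Open Scope classical_set_scope.
Local Open Scope ring_scope.

(* The family may live on a different probability space for each index; only  *)
(* laws matter.  The limit is given by its law.                               *)
Definition cvg_in_law (R : realType) (I : Type) (F : set_system I)
    (d : I -> measure_display) (T : forall i, measurableType (d i))
    (P : forall i, probability (T i) R) (X : forall i, T i -> R)
    (mu : {measure set R -> \bar R}) : Prop :=
  forall f : R -> R, continuous f -> (exists K, forall x, `|f x| <= K) ->
    ('E_(P i)[f \o X i] @[i --> F] --> \int[mu]_x (f x)%:E)%E.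

(* Z is a version of the conditional probability of the event E given the     *)
(* sub-sigma-algebra G.                                                       *)
Definition cond_prob_version (R : realType) (d : measure_display)
    (T : measurableType d) (P : probability T R)
    (G : set (set T)) (E : set T) (Z : T -> R) : Prop :=
  [/\ forall A : set R, measurable A -> G (Z @^-1` A),
      P.-integrable setT (EFin \o Z) &
      forall A, G A -> P (E `&` A) = (\int[P]_(w in A) (Z w)%:E)%E].

(* P(E t D | F t) = g t D + o(D) as D decreases to 0.  The error is measured  *)
(* in L^1(P), locally uniformly in t >= 0.  An o(D) that is only almost sure  *)
(* for each fixed t, or only pointwise in t, would not determine the process: *)
(* it tolerates, respectively, extra arrivals with a singular compensator     *)
(* (e.g. Cantor-like, started afresh at each arrival) and extra arrivals at   *)
(* deterministic times.                                                       *)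
Definition cond_prob_littleo (R : realType) (d : measure_display)
    (T : measurableType d) (P : probability T R) (F : R -> set (set T))
    (E : R -> R -> set T) (g : R -> R -> T -> R) : Prop :=
  forall K e : R, 0 < e -> exists2 delta : R, 0 < delta &
    forall t D : R, 0 <= t <= K -> 0 < D < delta ->
      exists2 Z : T -> R, cond_prob_version P (F t) (E t D) Z &
        (\int[P]_w (`|Z w - g t D w|)%:E <= (e * D)%:E)%E.

(* Arrivals are numbered from 0: tau i is t_{i+1} and Bs i is B_{i+1}.  For a *)
(* counting process M with epochs tau, the sum ranges over all i such that    *)
(* tau i < t.                                                                 *)
Definition hawkes_intensity (R : realType) (T : Type) (lambda : R) (h : R -> R)
    (M : R -> T -> nat) (tau Bs : nat -> T -> R) (t : R) (w : T) : R :=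
  lambda + \sum_(i < M t w | tau i w < t) Bs i w * h (t - tau i w).

(* The history up to time t: the path of M on [0, t], and the marks of the    *)
(* arrivals that occurred in [0, t].                                          *)
Definition hawkes_filtration (R : realType) (T : Type)
    (M : R -> T -> nat) (tau Bs : nat -> T -> R) (t : R) : set (set T) :=
  <<s [set E | (exists s k, 0 <= s <= t /\ E = [set w | M s w = k]) \/
               (exists i (A : set R), measurable A /\
                  E = [set w | tau i w <= t] `&` Bs i @^-1` A)] >>.

(* What is known just before the mark of the arrival number k is drawn.       *)
Definition pre_mark_history (R : realType) (T : Type)
    (tau Bs : nat -> T -> R) (k : nat) : set (set T) :=
  <<s [set E | exists i (A : set R), measurable A /\
         ((i <= k)%N /\ E = tau i @^-1` A \/ (i < k)%N /\ E = Bs i @^-1` A)] >>.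

(* hawkes_mark_indep implies that the marks are mutually independent.  It     *)
(* also says that a mark is drawn independently of the past of the process:   *)
(* without this, a mark could depend on the epoch at which it arrives.        *)
Record hawkes (R : realType) (d : measure_display) (T : measurableType d)
    (P : probability T R) (lambda : R) (h : R -> R) (B : {RV P >-> R})
    (M : R -> T -> nat) (tau Bs : nat -> {RV P >-> R}) : Prop := Hawkes {
  hawkes_mark_ge0 : {ae P, forall w, 0 <= B w};
  hawkes_mark_law : forall i (A : set R), measurable A ->
    distribution P (Bs i) A = distribution P B A;
  hawkes_mark_indep : forall k (A : set R) (E : set T), measurable A ->
    pre_mark_history tau Bs k E ->
    P (Bs k @^-1` A `&` E) = (P (Bs k @^-1` A) * P E)%E;
  hawkes_epoch_gt0 : forall w, 0 < tau 0%N w;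
  hawkes_epoch_lt : forall i w, tau i w < tau i.+1 w;
  hawkes_count : forall (t : R) w k, 0 <= t ->
    (k < M t w)%N = (tau k w <= t);
  hawkes_one_arrival :
    cond_prob_littleo P (hawkes_filtration M tau Bs)
      (fun t D => [set w | M (t + D) w = (M t w).+1])
      (fun t D w => hawkes_intensity lambda h M tau Bs t w * D);
  hawkes_more_arrivals :
    cond_prob_littleo P (hawkes_filtration M tau Bs)
      (fun t D => [set w | ((M t w).+1 < M (t + D)%R w)%N])
      (fun _ _ _ => 0);
  hawkes_no_arrival :
    cond_prob_littleo P (hawkes_filtration M tau Bs)
      (fun t D => [set w | M (t + D) w = M t w])
      (fun t D w => 1 - hawkes_intensity lambda h M tau Bs t w * D)
}.

Definition hawkes_load (R : realType) (b1 : R) (h : R -> R) : R :=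
  b1 * \int[lebesgue_measure]_(u in `[0, +oo[) h u.

(* Lambda is distributed as the limit in law of Lambda(t) as t tends to       *)
(* infinity; it may be defined on another probability space.                  *)
Definition stationary_intensity (R : realType) (d d' : measure_display)
    (T : measurableType d) (T' : measurableType d')
    (P : probability T R) (P' : probability T' R) (lambda : R) (h : R -> R)
    (M : R -> T -> nat) (tau Bs : nat -> T -> R) (Lambda : {RV P' >-> R}) :
    Prop :=
  cvg_in_law (+oo) (fun _ : R => P)
    (hawkes_intensity lambda h M tau Bs) (distribution P' Lambda).

Definition exp_excitation (R : realType) (r u : R) : R := expR (- r * u).

Definition gamma_fun (R : realType) (a : R) : R :=
  \int[lebesgue_measure]_(x in `]0, +oo[) (x `^ (a - 1) * expR (- x)).

Definition gamma_pdf (R : realType) (a b : R) : R -> R :=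
  (fun x => b `^ a / gamma_fun a * (x `^ (a - 1) * expR (- (b * x))))
    \_ `]0, +oo[.

(* The Gamma distribution with shape a and rate b. *)
Definition gamma_prob (R : realType) (a b : R)
    (V : set R) : \bar R :=
  (\int[lebesgue_measure]_(x in V) (gamma_pdf a b x)%:E)%E.

Section gamma_prob_is_measure.
Context {R : realType} (a b : R).

Lemma gamma_fun_ge0 : 0 <= gamma_fun a.
Proof.
apply: Rintegral_ge0 => x _.
by rewrite mulr_ge0 ?powR_ge0 ?expR_ge0.
Qed.

Lemma gamma_pdf_ge0 x : 0 <= gamma_pdf a b x.
Proof.
apply: restrict_ge0 => {}x _; apply: mulr_ge0.
  by rewrite divr_ge0 ?powR_ge0 ?gamma_fun_ge0.
by rewrite mulr_ge0 ?powR_ge0 ?expR_ge0.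
Qed.

Lemma measurable_gamma_pdf : measurable_fun [set: R] (gamma_pdf a b).
Proof.
apply/measurable_restrict => //; apply: measurable_funTS.
apply: measurable_funM => //; apply: measurable_funM.
  exact: measurable_powR.
apply: measurableT_comp; first exact: measurable_expR.
by apply: measurableT_comp => //; exact: mulrl_measurable.
Qed.

Let gamma_prob0 : gamma_prob a b set0 = 0%E.
Proof. by rewrite /gamma_prob integral_set0. Qed.

Let gamma_prob_ge0 A : (0 <= gamma_prob a b A)%E.
Proof.
by apply: integral_ge0 => x _; rewrite lee_fin gamma_pdf_ge0.
Qed.

Let gamma_prob_sigma_additive : semi_sigma_additive (gamma_prob a b).
Proof.
move=> /= F mF tF mUF; rewrite /gamma_prob; apply: cvg_toP.
  apply: ereal_nondecreasing_is_cvgn => m n mn.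
  apply: lee_sum_nneg_natr => // k _ _; apply: integral_ge0 => /= x Fkx.
  by rewrite lee_fin gamma_pdf_ge0.
rewrite ge0_integral_bigcup//=.
- apply/measurable_funTS/measurableT_comp => //.
  exact: measurable_gamma_pdf.
- by move=> x _; rewrite lee_fin gamma_pdf_ge0.
Qed.

HB.instance Definition _ := isMeasure.Build _ _ _
  (gamma_prob a b) gamma_prob0 gamma_prob_ge0 gamma_prob_sigma_additive.

End gamma_prob_is_measure.

(* Main.v *)
(* For fixed rho, let beta(s) be the Laplace transform of the mark.  Conditioning
   on the history at time t, the no-arrival and multiple-arrival estimates and the
   independence of the marks give, uniformly for t in compact sets,
     E e^(-s L(t+D)) - E e^(-s L(t)) = D * E G(L(t)) + o(D),
     G(x) = (s r - 1 + beta(s)) x e^(-s x) - s r lambda e^(-s x).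
   As t grows E G(L(t)) tends to E G(L), and a nonzero limit would make the bounded
   function E e^(-s L(t)) drift to infinity; hence E G(L) = 0.  For X = (1 - rho) L
   and u = (1 - rho) s, expanding beta(u) to second order turns this into
     (r + s (b2/2 - eta)) E[X e^(-s X)] = r lambda E e^(-s X)
   with eta small by uniform integrability.  In the limit the Laplace transform phi
   satisfies (b + s) phi' = - a phi with a = 2 r lambda / b2 and b = 2 r / b2, so
   phi(s) = (b / (b + s))^a, the transform of the Gamma law; Bernstein's
   approximation converts convergence of Laplace transforms into convergence in law. *)

Require Import Defs.
From HB Require Import structures.
From mathcomp Require Import all_boot all_order all_algebra.
From mathcomp Require Import all_classical all_reals all_analysis.
From mathcomp Require Import measurable_realfun.
From mathcomp Require Import ring lra.

Set Implicit Arguments.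
Unset Strict Implicit.
Unset Printing Implicit Defensive.

Import Order.TTheory GRing.Theory Num.Theory.
Import numFieldNormedType.Exports.

Local Open Scope classical_set_scope.
Local Open Scope ring_scope.

(** * Conditioning and independence for bounded random variables *)

(** No moment of the intensity is assumed. The functions e^(-s x) and x e^(-s x) are bounded on [0,
    +oo[, and integrability of the intensity at a fixed time comes out of the no-arrival estimate
    itself. The given intensity is a left limit whose marks are nonnegative only almost surely,
    which is awkward for one-step recursions. It is replaced by [post_intensity], which is at least
    lambda everywhere, has an exact update over a step, and agrees almost surely at each fixed time
    because no epoch has an atom. Independence of a mark is given only for a deterministic arrival
    number and the history before that draw, so the arrival event is cut according to the count at
    time t. The heavy-traffic step needs neither tightness nor subsequences: the identity itself
    yields E[X e^(-s X)] <= lambda, which makes the defect in the limiting differential equation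
    small, and the mean value theorem for (b + s)^a phi(s) turns this defect into an explicit error.
    The Gamma parameters make sense because b2 >= b1^2 = (rho r)^2 keeps the limit of b2
    positive. *)

Section bounded_integrands.
Context {R : realType} {d : measure_display} {T : measurableType d}.
Variable P : probability T R.
Implicit Types (f g h Y : T -> R) (K : R).

Lemma bounded_integrable f K : measurable_fun setT f ->
  (forall w, `|f w| <= K) -> P.-integrable setT (EFin \o f).
Proof.
move=> mf fK; apply: (@le_integrable _ _ _ _ _ _ _ (cst K%:E)) => //.
- exact/measurable_EFinP.
- by move=> w _ /=; rewrite lee_fin (le_trans (fK w))// ler_norm.
- exact: finite_measure_integrable_cst.
Qed.

Lemma integrable_mul_bounded h Y K : P.-integrable setT (EFin \o h) ->
  measurable_fun setT Y -> (forall w, `|Y w| <= K) ->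
  P.-integrable setT (EFin \o (fun w => h w * Y w)).
Proof.
move=> ih mY YK; have mh := measurable_int P ih.
apply: (@le_integrable _ _ _ _ _ _ _ (fun w => K%:E * (EFin \o h) w)%E) => //.
- by apply/measurable_EFinP/measurable_funM => //; exact/measurable_EFinP.
- move=> w _ /=; rewrite lee_fin !normrM mulrC ler_wpM2r//.
  by rewrite (le_trans (YK w))// ler_norm.
- exact: integrableZl.
Qed.

Lemma Rintegral_indicM (A : set T) f : measurable A ->
  \int[P]_w (f w * \1_A w) = \int[P]_(w in A) f w.
Proof.
move=> mA; rewrite [RHS]Rintegral_mkcond; apply: eq_Rintegral => w _.
rewrite /patch indicE; case: ifPn => wA; first by rewrite mulr1.
by rewrite mulr0.
Qed.

Lemma le_bound_Rintegral f K : measurable_fun setT f ->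
  (forall w, `|f w| <= K) -> `|\int[P]_w f w| <= K.
Proof.
move=> mf fK; have int := bounded_integrable mf fK.
apply: (le_trans (le_normr_Rintegral _ int)) => //.
have -> : K = \int[P]_w (cst K w).
  rewrite Rintegral_cst//.
  by rewrite (_ : fine _ = 1) ?mulr1//; exact: (congr1 fine (probability_setT P)).
apply: le_Rintegral => //; last exact: finite_measure_integrable_cst.
exact: (integrable_norm int).
Qed.

Lemma Rintegral_sub_le f g h : P.-integrable setT (EFin \o f) ->
  P.-integrable setT (EFin \o g) -> P.-integrable setT (EFin \o h) ->
  (forall w, `|f w - g w| <= h w) ->
  `|\int[P]_w f w - \int[P]_w g w| <= \int[P]_w h w.
Proof.
move=> If Ig Ih fgh; rewrite -RintegralB//.
have Ifg : P.-integrable setT (EFin \o (fun w => f w - g w)).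
  exact: (integrableB measurableT If Ig).
apply: (le_trans (le_normr_Rintegral _ Ifg)) => //.
by apply: le_Rintegral => //; exact: (integrable_norm Ifg).
Qed.

End bounded_integrands.

Section staircase.
Context {R : realType}.

(** On [0, 1] this is floor(n y) / n. Written as a sum of level indicators, it lets a property of
    level sets pass to functions by linearity. *)
Definition stair (n : nat) (y : R) : R :=
  \sum_(j < n) (n%:R^-1 * (j.+1%:R / n%:R <= y)%R%:R).

Lemma stair_dist n y : (0 < n)%N -> 0 <= y <= 1 ->
  `|y - stair n y| <= n%:R^-1.
Proof.
move=> n0 /andP[y0 y1]; have nR : 0 < n%:R :> R by rewrite ltr0n.
have ny0 : 0 <= n%:R * y by rewrite mulr_ge0.
set c := Num.truncn (n%:R * y).
have cn : (c <= n)%N.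
  rewrite -(ler_nat R) (@le_trans _ _ (n%:R * y)) ?truncn_le//.
  by rewrite -[leRHS]mulr1 ler_pM2l.
have -> : stair n y = c%:R / n%:R.
  rewrite /stair -mulr_sumr mulrC; congr (_ * _).
  transitivity (\sum_(j < n | (j < c)%N) (1 : R)).
    rewrite [RHS]big_mkcond/=; apply: eq_bigr => j _.
    rewrite ler_pdivrMr// (mulrC y) -truncn_ge_nat//.
    by rewrite -/c; case: ltnP.
  rewrite -(big_ord_widen n (fun=> 1) cn) big_const_ord iter_addr addr0//.
have /andP[cl cu] := truncn_itv ny0.
rewrite -/c in cl cu.
rewrite ler_norml; apply/andP; split; rewrite -(ler_pM2l nR).
  rewrite mulrN divff ?gt_eqF// mulrBr mulrCA divff ?gt_eqF// mulr1; lra.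
rewrite divff ?gt_eqF// mulrBr mulrCA divff ?gt_eqF// mulr1.
rewrite -natr1 in cu; lra.
Qed.

End staircase.

Lemma le_inv_nat_le0 (R : realType) (x C : R) :
  (forall n, (0 < n)%N -> x <= n%:R^-1 * C) -> x <= 0.
Proof.
move=> H; rewrite leNgt; apply/negP => x0.
have C0 : 0 < C.
  have := H 1%N isT; rewrite invr1 mul1r; exact: lt_le_trans.
have := H (Num.truncn (C / x)).+1 isT.
rewrite mulrC ler_pdivlMr ?ltr0n// mulrC -ler_pdivlMr// leNgt.
by rewrite truncnS_gt.
Qed.

Section orthogonality.
Context {R : realType} {d : measure_display} {T : measurableType d}.
Variable P : probability T R.

(* Y is the uniform limit of its staircase approximations, which are linear   *)
(* combinations of indicators of the level sets.                              *)
Lemma Rintegral_levels_eq0 (h Y : T -> R) :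
  P.-integrable setT (EFin \o h) -> measurable_fun setT Y ->
  (forall w, 0 <= Y w <= 1) ->
  (forall c, \int[P]_(w in [set w | c <= Y w]) h w = 0) ->
  \int[P]_w (h w * Y w) = 0.
Proof.
move=> Ih mY Y01 hY.
have mlev c : measurable [set w | c <= Y w].
  have -> : [set w | c <= Y w] = Y @^-1` `[c, +oo[%classic.
    by apply/seteqP; split => w /=; rewrite in_itv/= andbT.
  by rewrite -[_ @^-1` _]setTI; exact: mY.
have stairE n w : stair n (Y w) =
    \sum_(j < n) (n%:R^-1 * \1_[set v | j.+1%:R / n%:R <= Y v] w).
  rewrite /stair; apply: eq_bigr => j _; rewrite indicE; congr (_ * (_ : bool)%:R).
  by apply/idP/idP; rewrite inE.
have mst n : measurable_fun setT (fun w => stair n (Y w)).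
  under eq_fun do rewrite stairE.
  apply: measurable_sum => j; exact: measurable_funM.
apply/eqP; rewrite -normr_eq0 eq_le normr_ge0 andbT.
apply: (@le_inv_nat_le0 _ _ (\int[P]_w `|h w|)) => n n0.
have st1 w : `|stair n (Y w)| <= 2.
  have := stair_dist n0 (Y01 w); have /andP[y0 y1] := Y01 w.
  have : n%:R^-1 <= 1 :> R by rewrite invf_le1 ?ler1n// ltr0n.
  by move=> n1; rewrite ler_distlC ler_norml => /andP[? ?]; lra.
have Y1 w : `|Y w| <= 1 by have /andP[y0 y1] := Y01 w; rewrite ger0_norm.
have IY := integrable_mul_bounded Ih mY Y1.
have Ist := integrable_mul_bounded Ih (mst n) st1.
have st0 : \int[P]_w (h w * stair n (Y w)) = 0.
  have It (j : 'I_n) : P.-integrable setT (EFin \o (fun w =>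
     h w * (n%:R^-1 * \1_[set v | j.+1%:R / n%:R <= Y v] w))).
    apply: (@integrable_mul_bounded _ _ _ _ _ _ (n%:R^-1)) => //.
      by apply: measurable_funM => //; exact/measurable_indic/mlev.
    move=> w; rewrite normrM ger0_norm ?invr_ge0// ler_piMr ?invr_ge0//.
    by rewrite indicE; case: (_ \in _); rewrite ?normr1// normr0.
  rewrite /Rintegral.
  under eq_integral => w _.
    rewrite stairE mulr_sumr -sumEFin.
    over.
  rewrite integral_sum//=.
  rewrite big1//= => j _.
  under eq_integral => w _.
    rewrite mulrCA EFinM.
    over.
  rewrite integralZl//; last first.
    apply: (@integrable_mul_bounded _ _ _ _ _ _ 1) => //.
    by move=> w; rewrite indicE; case: (_ \in _); rewrite ?normr1// normr0.
  have := hY (j.+1%:R / n%:R); rewrite -Rintegral_indicM// /Rintegral.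
  rewrite -[X in (_ * X)%E]fineK; first by move=> /= ->; rewrite mule0.
  apply: integrable_fin_num => //.
  apply: (@integrable_mul_bounded _ _ _ _ _ _ 1) => //.
  by move=> w; rewrite indicE; case: (_ \in _); rewrite ?normr1// normr0.
rewrite -[X in `|X|]subr0 -[X in `|_ - X|]st0.
rewrite -RintegralZl//; last exact: (integrable_norm Ih).
apply: Rintegral_sub_le => //.
  have := @integrableZl _ _ _ P _ measurableT n%:R^-1 _ (integrable_norm Ih).
  by [].
move=> w; rewrite -mulrBr normrM mulrC ler_wpM2r//.
exact: stair_dist.
Qed.

End orthogonality.
Section conditioning.
Context {R : realType} {d : measure_display} {T : measurableType d}.
Variable P : probability T R.
Implicit Types (A E : set T) (X Y Z : T -> R) (G : set (set T)).

Lemma integrable_indic1 E : measurable E -> P.-integrable setT (EFin \o \1_E).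
Proof.
move=> mE; apply: (@bounded_integrable _ _ _ _ _ 1).
  exact: measurable_indic.
by move=> w; rewrite indicE; case: (_ \in _); rewrite ?normr1// normr0.
Qed.

Lemma Rintegral_indic_in E A : measurable E -> measurable A ->
  \int[P]_(w in A) \1_E w = fine (P (E `&` A)).
Proof. by move=> mE mA; rewrite /Rintegral integral_indic. Qed.

Lemma Rintegral_indic E : measurable E -> \int[P]_w \1_E w = fine (P E).
Proof. by move=> mE; rewrite Rintegral_indic_in// setIT. Qed.

Lemma probability_fin_num E : measurable E -> P E \is a fin_num.
Proof. exact: fin_num_measure. Qed.

Lemma fine_probability_setT : fine (P setT) = 1.
Proof. exact: (congr1 fine (probability_setT P)). Qed.

Lemma Rintegral_cst1 (c : R) : \int[P]_w c = c.
Proof. by rewrite Rintegral_cst// fine_probability_setT mulr1. Qed.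

Lemma integrable_cst1 (c : R) : P.-integrable setT (EFin \o (fun=> c)).
Proof. exact: finite_measure_integrable_cst. Qed.

Lemma integrable_subr X Y : P.-integrable setT (EFin \o X) ->
  P.-integrable setT (EFin \o Y) ->
  P.-integrable setT (EFin \o (fun w => X w - Y w)).
Proof. by move=> IX IY; exact: (integrableB measurableT IX IY). Qed.

Lemma integrable_addr X Y : P.-integrable setT (EFin \o X) ->
  P.-integrable setT (EFin \o Y) ->
  P.-integrable setT (EFin \o (fun w => X w + Y w)).
Proof. by move=> IX IY; exact: (integrableD measurableT IX IY). Qed.

Lemma integrable_mulr (c : R) X : P.-integrable setT (EFin \o X) ->
  P.-integrable setT (EFin \o (fun w => c * X w)).
Proof. by move=> IX; exact: (@integrableZl _ _ _ P _ measurableT c _ IX). Qed.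

Lemma norm_unit_interval Y : (forall w, 0 <= Y w <= 1) -> forall w, `|Y w| <= 1.
Proof. by move=> Y01 w; have /andP[y0 y1] := Y01 w; rewrite ger0_norm. Qed.

Lemma measurable_levels Y c : measurable_fun setT Y ->
  measurable [set w | c <= Y w].
Proof.
move=> mY; have -> : [set w | c <= Y w] = Y @^-1` `[c, +oo[%classic.
  by apply/seteqP; split => w /=; rewrite in_itv/= andbT.
by rewrite -[_ @^-1` _]setTI; exact: mY.
Qed.

(** The defining property of a conditional probability says that [\1_E - Z] integrates to 0 over
    every level set of [Y], which is the hypothesis of [Rintegral_levels_eq0]. *)
Lemma cond_prob_version_bounded G E Z Y :
  (forall A, G A -> measurable A) -> measurable E ->
  cond_prob_version P G E Z ->
  measurable_fun setT Y -> (forall w, 0 <= Y w <= 1) ->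
  (forall c, G [set w | c <= Y w]) ->
  \int[P]_w (\1_E w * Y w) = \int[P]_w (Z w * Y w).
Proof.
move=> Gm mE [_ IZ ZE] mY Y01 GY.
have I1 := integrable_indic1 mE.
have Y1 := norm_unit_interval Y01.
apply/eqP; rewrite -subr_eq0 -RintegralB//; [|exact: integrable_mul_bounded..].
rewrite (@eq_Rintegral _ _ _ _ _ (fun w => (\1_E w - Z w) * Y w)); last first.
  by move=> w _; rewrite mulrBl.
apply/eqP/Rintegral_levels_eq0 => //; first exact: integrable_subr.
move=> c; have mc := Gm _ (GY c).
rewrite RintegralB//; [|exact: integrableS (I1)|exact: integrableS (IZ)].
rewrite Rintegral_indic_in// /Rintegral -ZE ?subrr//.
Qed.

Lemma indep_event_bounded A Y : measurable A -> measurable_fun setT Y ->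
  (forall w, 0 <= Y w <= 1) ->
  (forall c, P ([set w | c <= Y w] `&` A) = (P [set w | (c <= Y w)%R] * P A)%E) ->
  \int[P]_w (\1_A w * Y w) = fine (P A) * \int[P]_w Y w.
Proof.
move=> mA mY Y01 indep.
have I1 := integrable_indic1 mA.
have Y1 := norm_unit_interval Y01.
have IY := bounded_integrable P mY Y1.
apply/eqP; rewrite -subr_eq0 -RintegralZl// -RintegralB//; last 2 first.
- exact: integrable_mul_bounded.
- exact: integrable_mulr.
rewrite (@eq_Rintegral _ _ _ _ _ (fun w => (\1_A w - fine (P A)) * Y w)).
  apply/eqP/Rintegral_levels_eq0 => //.
    by apply: integrable_subr => //; exact: integrable_cst1.
  move=> c; have mc := measurable_levels c mY.
  rewrite RintegralB//; [|exact: integrableS (I1)|].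
    rewrite Rintegral_indic_in// Rintegral_cst// setIC indep fineM ?probability_fin_num//.
    by rewrite mulrC subrr.
  exact: finite_measure_integrable_cst.
by move=> w _; rewrite mulrBl.
Qed.

(** The staircase argument is used twice: [indep_event_bounded] treats [X] against each level set of
    [Y], then [Rintegral_levels_eq0] treats the centred [X] against [Y]. *)
Lemma indep_sigma_bounded G X Y :
  (forall A, G A -> measurable A) ->
  measurable_fun setT X -> (forall w, 0 <= X w <= 1) ->
  measurable_fun setT Y -> (forall w, 0 <= Y w <= 1) ->
  (forall c, G [set w | c <= Y w]) ->
  (forall c A, G A ->
     P ([set w | c <= X w] `&` A) = (P [set w | (c <= X w)%R] * P A)%E) ->
  \int[P]_w (X w * Y w) = \int[P]_w X w * \int[P]_w Y w.
Proof.
move=> Gm mX X01 mY Y01 GY indep.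
have X1 := norm_unit_interval X01; have Y1 := norm_unit_interval Y01.
have IX := bounded_integrable P mX X1; have IY := bounded_integrable P mY Y1.
apply/eqP; rewrite -subr_eq0 -RintegralZl// -RintegralB//; last 2 first.
- exact: integrable_mul_bounded.
- exact: integrable_mulr.
rewrite (@eq_Rintegral _ _ _ _ _ (fun w => (X w - \int[P]_w X w) * Y w)).
  apply/eqP/Rintegral_levels_eq0 => //.
    by apply: integrable_subr => //; exact: integrable_cst1.
  move=> c; have mc := Gm _ (GY c).
  rewrite RintegralB//; [|exact: integrableS (IX)|].
    rewrite Rintegral_cst// -Rintegral_indicM//.
    rewrite (@eq_Rintegral _ _ _ _ _ (fun w => \1_[set w | c <= Y w] w * X w)).
      rewrite indep_event_bounded//; first by rewrite mulrC subrr.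
      by move=> c'; exact: indep.
    by move=> w _; rewrite mulrC.
  exact: finite_measure_integrable_cst.
by move=> w _; rewrite mulrBl.
Qed.

(** An L^1 error survives multiplication by a test function with values in [0, 1]. Integrability of
    [g t D] is a by-product: it differs from the integrable version [Z] by a function of finite L^1
    norm. *)
Lemma cond_prob_littleo_bounded (F : R -> set (set T)) (E : R -> R -> set T)
    (g : R -> R -> T -> R) : cond_prob_littleo P F E g ->
  (forall t A, 0 <= t -> F t A -> measurable A) ->
  (forall t D, 0 <= t -> 0 < D -> measurable (E t D)) ->
  (forall t D, 0 <= t -> measurable_fun setT (g t D)) ->
  forall K e : R, 0 < e -> exists2 delta : R, 0 < delta &
    forall t D : R, 0 <= t <= K -> 0 < D < delta ->
      P.-integrable setT (EFin \o g t D) /\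
      forall Y, measurable_fun setT Y -> (forall w, 0 <= Y w <= 1) ->
        (forall c, F t [set w | c <= Y w]) ->
        `|\int[P]_w (\1_(E t D) w * Y w) - \int[P]_w (g t D w * Y w)| <= e * D.
Proof.
move=> lo Fm mE mg K e e0; have [delta delta0 H] := lo K e e0.
exists delta => // t D tK Dd; have [Z vZ Ze] := H t D tK Dd.
have t0 : 0 <= t by case/andP: tK.
have D0 : 0 < D by case/andP: Dd.
have [_ IZ _] := vZ.
have mZ : measurable_fun setT Z by apply/measurable_EFinP/(measurable_int P).
have mZg : measurable_fun setT (fun w => Z w - g t D w).
  by apply: measurable_funB => //; exact: mg.
have IZg : P.-integrable setT (EFin \o (fun w => Z w - g t D w)).
  apply/integrableP; split; first exact/measurable_EFinP.
  by rewrite (le_lt_trans Ze)// ltry.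
have Ig : P.-integrable setT (EFin \o g t D).
  have := integrable_subr IZ IZg; congr (_ .-integrable _ _).
  by apply/funext => w /=; congr EFin; lra.
split=> // Y mY Y01 FY; have Y1 := norm_unit_interval Y01.
rewrite (cond_prob_version_bounded (fun A => Fm t A t0) (mE t D t0 D0) vZ)//.
apply: (@le_trans _ _ (\int[P]_w `|Z w - g t D w|)).
  apply: Rintegral_sub_le => //.
  - exact: integrable_mul_bounded.
  - exact: integrable_mul_bounded.
  - exact: (integrable_norm IZg).
  - by move=> w; rewrite -mulrBl normrM ler_piMr.
rewrite -lee_fin /Rintegral fineK//.
apply: integrable_fin_num => //; exact: (integrable_norm IZg).
Qed.

End conditioning.
(** * Paths of the Hawkes process *)

Lemma measurable_fun_glue (R : realType) (d : measure_display)
    (T : measurableType d) (N : T -> nat) (f : T -> R) :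
  (forall k, measurable [set w | N w = k]) ->
  (forall k, measurable_fun [set w | N w = k] f) -> measurable_fun setT f.
Proof.
move=> mN mf; have -> : [set: T] = \bigcup_k [set w | N w = k].
  by apply/seteqP; split=> // w _; exists (N w).
exact/measurable_fun_bigcup.
Qed.

Section path.
Context {R : realType} {T : Type}.
Variables (lambda r : R) (M : R -> T -> nat) (tau Bs : nat -> T -> R).

(* The intensity right after the arrivals at time t; the absolute values only *)
(* matter on the null set where some mark is negative.                        *)
Definition post_intensity (t : R) (w : T) : R :=
  lambda + \sum_(i < M t w) `|Bs i w| * expR (- r * (t - tau i w)).

(** Freezing the count at [k] removes [M]: only epochs and marks numbered below [k] remain, all
    known before mark [k] is drawn. *)
Definition post_intensity_upto (k : nat) (t : R) (w : T) : R :=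
  lambda + \sum_(i < k) `|Bs i w| * expR (- r * (t - tau i w)).

Hypothesis tau_gt0 : forall w, 0 < tau 0%N w.
Hypothesis tau_lt : forall i w, tau i w < tau i.+1 w.
Hypothesis count : forall (t : R) w k, 0 <= t -> (k < M t w)%N = (tau k w <= t).

Lemma count_mono s t w : 0 <= s <= t -> (M s w <= M t w)%N.
Proof.
case/andP=> s0 st; have t0 := le_trans s0 st.
case E : (M s w) => [//|k]; rewrite count// (le_trans _ st)// -count// E//.
Qed.

Lemma tau_mono i j w : (i <= j)%N -> tau i w <= tau j w.
Proof.
move=> ij; have /(_ (fun i => ltW (tau_lt i w))) h :=
  @homo_leq _ (tau^~ w) <=%O (@lexx _ R) (@le_trans _ R).
exact: h.
Qed.

Lemma tau_pos i w : 0 < tau i w.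
Proof. by rewrite (lt_le_trans (tau_gt0 w))// tau_mono. Qed.

Lemma post_intensity_ge t w : lambda <= post_intensity t w.
Proof. by rewrite lerDl sumr_ge0// => i _; rewrite mulr_ge0// expR_ge0. Qed.

(** The exponential shape of the excitation enters here: all past contributions decay by one common
    factor, so the next value of the intensity depends on the past only through its current
    value. *)
Lemma discount t D (x : R) :
  expR (- r * (t + D - x)) = expR (- r * (t - x)) * expR (- r * D).
Proof. by rewrite -expRD; congr expR; ring. Qed.

Lemma post_intensity_no t D w : M (t + D) w = M t w ->
  post_intensity (t + D) w = lambda + (post_intensity t w - lambda) * expR (- r * D).
Proof.
move=> E; rewrite /post_intensity E addrAC subrr add0r mulr_suml.
by congr (_ + _); apply: eq_bigr => i _; rewrite discount mulrA.
Qed.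

Lemma post_intensity_one t D w : M (t + D) w = (M t w).+1 ->
  post_intensity (t + D) w = lambda + (post_intensity t w - lambda) * expR (- r * D)
    + `|Bs (M t w) w| * expR (- r * (t + D - tau (M t w) w)).
Proof.
move=> E; rewrite /post_intensity E big_ord_recr/= addrA; congr (_ + _).
rewrite addrAC subrr add0r mulr_suml; congr (_ + _).
by apply: eq_bigr => i _; rewrite discount mulrA.
Qed.

Lemma post_intensity_uptoE k t w : M t w = k ->
  post_intensity t w = post_intensity_upto k t w.
Proof. by rewrite /post_intensity => ->. Qed.

(** Two consecutive epochs decide the event, so it lies in every sigma-algebra that contains the
    events [tau i <= t], in particular in the history before mark [k]. *)
Lemma count_eqE k t : 0 <= t -> [set w | M t w = k] =
  (if k is k'.+1 then [set w | tau k' w <= t] else setT) `\`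
  [set w | tau k w <= t].
Proof.
move=> t0; apply/seteqP; split=> w /=.
  move=> <-; split.
    by case E : (M t w) => [//|k'] /=; rewrite -count// E.
  by rewrite -count// ltnn.
rewrite -count// => -[h /negP]; rewrite -leqNgt => kM.
case: k h kM => [|k'] /=; first by rewrite leqn0 => _ /eqP.
by rewrite -count// => h1 h2; apply/eqP; rewrite eqn_leq h2.
Qed.

End path.

Section path_measurability.
Context {R : realType} {d : measure_display} {T : measurableType d}.
Variables (lambda r : R) (M : R -> T -> nat) (tau Bs : nat -> T -> R).
Hypothesis count : forall (t : R) w k, 0 <= t -> (k < M t w)%N = (tau k w <= t).

Lemma measurable_post_intensity_upto (D : set T) k t : measurable D ->
  (forall i, (i < k)%N -> measurable_fun D (tau i)) ->
  (forall i, (i < k)%N -> measurable_fun D (Bs i)) ->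
  measurable_fun D (post_intensity_upto lambda r tau Bs k t).
Proof.
move=> mD mtau mBs; apply: measurable_funD => //; apply: measurable_sum => i.
apply: measurable_funM.
  apply: measurableT_comp; first exact: normr_measurable.
  exact: mBs.
apply: measurableT_comp; first exact: measurable_expR.
apply: measurable_funM => //; apply: measurable_funB => //; exact: mtau.
Qed.

Lemma measurable_count t k : 0 <= t ->
  (forall i, measurable [set w | tau i w <= t]) ->
  measurable [set w | M t w = k].
Proof.
move=> t0 mt; rewrite (count_eqE count)//; apply: measurableD => //.
by case: k.
Qed.

(** Epochs and marks are assumed measurable only where the arrival has occurred by time [t]. The
    history at time [t] reveals no more, and the lemma is applied to that history as well as to the
    ambient sigma-algebra. *)
Lemma measurable_post_intensity t : 0 <= t ->
  (forall i, measurable [set w | tau i w <= t]) ->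
  (forall i, measurable_fun [set w | tau i w <= t] (tau i)) ->
  (forall i, measurable_fun [set w | tau i w <= t] (Bs i)) ->
  measurable_fun setT (post_intensity lambda r M tau Bs t).
Proof.
move=> t0 mt mtau mBs.
have mc k := measurable_count k t0 mt.
have sub i k : (i < k)%N -> [set w | M t w = k] `<=` [set w | tau i w <= t].
  by move=> ik w /= Mk; rewrite -count// Mk.
apply: (measurable_fun_glue mc) => k.
apply: (@eq_measurable_fun _ _ _ _ _ (post_intensity_upto lambda r tau Bs k t)).
  by move=> w; rewrite inE => Mk; rewrite (post_intensity_uptoE _ _ _ _ Mk).
apply: measurable_post_intensity_upto => // i ik.
  by apply: (measurable_funS _ (sub i k ik)).
by apply: (measurable_funS _ (sub i k ik)).
Qed.

End path_measurability.

(** * Measurability with respect to the histories *)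

Section hawkes_process.
Context {R : realType} {d : measure_display} {T : measurableType d}.
Variables (P : probability T R) (lambda r : R) (B : {RV P >-> R}).
Variables (M : R -> T -> nat) (tau Bs : nat -> {RV P >-> R}).
Hypothesis hw : hawkes lambda (exp_excitation r) B M tau Bs.

Let count := hawkes_count hw.
Let tau_gt0 := hawkes_epoch_gt0 hw.
Let tau_lt := hawkes_epoch_lt hw.

Local Notation F := (hawkes_filtration M tau Bs).
Local Notation H := (pre_mark_history tau Bs).
Local Notation V := (post_intensity lambda r M tau Bs).
Local Notation Vk := (post_intensity_upto lambda r tau Bs).
Local Notation L := (hawkes_intensity lambda (exp_excitation r) M tau Bs).

Lemma measurable_epoch_le i t : measurable [set w | tau i w <= t].
Proof.
have -> : [set w | tau i w <= t] = tau i @^-1` `]-oo, t]%classic.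
  by apply/seteqP; split => w /=; rewrite in_itv.
exact: measurable_funPTI.
Qed.

Lemma measurable_count_eq t k : 0 <= t -> measurable [set w | M t w = k].
Proof. by move=> t0; apply: (measurable_count count) => // i; exact: measurable_epoch_le. Qed.

Lemma hawkes_filtration_measurable t A : F t A -> measurable A.
Proof.
apply: (smallest_sub (@sigma_algebra_measurable _ T)).
move=> E [[s [k [/andP[s0 _] ->]]]|[i [A' [mA' ->]]]].
  exact: measurable_count_eq.
by apply: measurableI; [exact: measurable_epoch_le|exact: measurable_funPTI].
Qed.

Lemma pre_mark_history_measurable k A : H k A -> measurable A.
Proof.
apply: (smallest_sub (@sigma_algebra_measurable _ T)).
by move=> E [i [A' [mA' [[_ ->]|[_ ->]]]]]; exact: measurable_funPTI.
Qed.

Lemma measurable_post t : 0 <= t -> measurable_fun setT (V t).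
Proof.
move=> t0; apply: (measurable_post_intensity _ _ count) => // i.
- exact: measurable_epoch_le.
- exact: measurable_funTS.
- exact: measurable_funTS.
Qed.

Lemma hawkes_filtration_post t A : 0 <= t -> measurable A -> F t (V t @^-1` A).
Proof.
move=> t0 mA; rewrite /hawkes_filtration; set G := (X in <<s X >>).
have GM s k : 0 <= s <= t -> <<s G >> [set w | M s w = k].
  by move=> st; apply: sub_sigma_algebra; left; exists s, k.
have Gle i s : 0 <= s <= t -> <<s G >> [set w | tau i w <= s].
  move=> st; have /andP[s0 _] := st.
  have -> : [set w | tau i w <= s] =
      \bigcup_(k in [set k | (i < k)%N]) [set w | M s w = k].
    apply/seteqP; split => w /=; first by rewrite -count// => iM; exists (M s w).
    by move=> [k /= ik Mk]; rewrite -count// Mk.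
  apply: (@bigcup_measurable _ (g_sigma_algebraType G)) => k _; exact: GM.
have tt : 0 <= t <= t by rewrite t0 lexx.
suff /(_ measurableT A mA) : measurable_fun setT (V t : g_sigma_algebraType G -> R).
  by rewrite setTI.
apply: (@measurable_post_intensity R _ (g_sigma_algebraType G) lambda r M tau Bs count) => // i.
- exact: Gle.
- apply: (measurability _ (RGenCInfty.measurableE R)) => //.
  move=> _ [_ [x ->] <-].
  have -> : [set w | tau i w <= t] `&` tau i @^-1` `[x, +oo[%classic =
    [set w | tau i w <= t] `\` [set w | tau i w < x].
    apply/seteqP; split => w /=; rewrite in_itv/= andbT.
      by case=> -> h; split=> //; apply/negP; rewrite -leNgt.
    by case=> -> /negP; rewrite -leNgt.
  have [tx|xt] := ltP t x.
    rewrite (_ : _ `\` _ = set0)//.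
    apply/seteqP; split => w //= [h]; apply; exact: le_lt_trans tx.
  apply: (@measurableD _ (g_sigma_algebraType G)); first exact: Gle.
  (* The history contains [tau i <= s] only for 0 <= s <= t, so the strict inequality is reached
     from below; a negative level gives the empty set because epochs are positive. *)
  have -> : [set w | tau i w < x] =
     \bigcup_n [set w | tau i w <= x - n.+1%:R^-1].
    apply/seteqP; split => w /=.
      move=> lx; have x0 : 0 < x - tau i w by rewrite subr_gt0.
      exists (Num.truncn (x - tau i w)^-1) => //=.
      rewrite lerBrDr -lerBrDl -[leRHS]invrK lef_pV2 ?posrE ?invr_gt0//.
      exact/ltW/truncnS_gt.
    by move=> [n _ /= h]; rewrite (le_lt_trans h)// ltrBlDr ltrDl invr_gt0.
  apply: (@bigcup_measurable _ (g_sigma_algebraType G)) => n _.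
  have [s0|s0] := leP 0 (x - n.+1%:R^-1).
    apply: Gle; rewrite s0/= (le_trans _ xt)// gerBl//.
  rewrite (_ : mkset _ = set0)//.
  apply/seteqP; split => w //= h.
  by have := lt_le_trans (tau_pos tau_gt0 tau_lt i w) h; rewrite ltNge (ltW s0).
- move=> _ A' mA'; apply: sub_sigma_algebra; right; exists i, A'; split => //.
Qed.

Lemma pre_mark_history_event k t u : 0 <= t ->
  H k ([set w | M t w = k] `&` [set w | tau k w <= u]).
Proof.
move=> t0; rewrite /pre_mark_history; set G := (X in <<s X >>).
have Gle i s : (i <= k)%N -> <<s G >> [set w | tau i w <= s].
  move=> ik; apply: sub_sigma_algebra; exists i, `]-oo, s]%classic; split=> //.
  by left; split=> //; apply/seteqP; split => w /=; rewrite in_itv.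
apply: (@measurableI _ (g_sigma_algebraType G)); last exact: Gle.
rewrite (count_eqE count)//; apply: (@measurableD _ (g_sigma_algebraType G)); last exact: Gle.
case: k @G Gle => [|k] G Gle; first exact: (@measurableT _ (g_sigma_algebraType G)).
by apply: Gle; exact: leqnSn.
Qed.

Lemma pre_mark_history_upto k t : let G := [set E | exists i (A : set R), measurable A /\
         ((i <= k)%N /\ E = tau i @^-1` A \/ (i < k)%N /\ E = Bs i @^-1` A)] in
  measurable_fun setT (Vk k t : g_sigma_algebraType G -> R).
Proof.
move=> G; apply: measurable_post_intensity_upto => // i ik _ A mA; rewrite setTI.
  apply: sub_sigma_algebra; exists i, A; split => //; left; split => //; exact: ltnW.
by apply: sub_sigma_algebra; exists i, A; split => //; right.
Qed.

Lemma mark_ge0 i : {ae P, forall w, 0 <= Bs i w}.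
Proof.
have m0 : measurable `]-oo, (0 : R)[%classic by exact: measurable_itv.
have law := hawkes_mark_law hw i m0.
exists (Bs i @^-1` `]-oo, 0[%classic); split; first exact: measurable_funPTI.
  rewrite -[LHS]/(distribution P (Bs i) `]-oo, 0[%classic) law.
  have [N [mN PN0 sN]] := hawkes_mark_ge0 hw.
  apply/eqP; rewrite eq_le measure_ge0 andbT -PN0 /distribution/=.
  rewrite /pushforward.
  have mBneg : measurable (B @^-1` `]-oo, 0[%classic) by exact: measurable_funPTI.
  apply: (le_measure P); rewrite ?inE//.
  move=> w /=; rewrite in_itv/= => Bw; apply: sN => /=; rewrite leNgt Bw//.
by move=> w /= /negP; rewrite -ltNge in_itv.
Qed.

Lemma measurable_hawkes_intensity t : 0 <= t -> measurable_fun setT (L t).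
Proof.
move=> t0; have mc k := measurable_count_eq k t0.
apply: (measurable_fun_glue mc) => k.
apply: (@eq_measurable_fun _ _ _ _ _ (fun w => lambda + \sum_(i < k)
  (Bs i w * expR (- r * (t - tau i w))) * \1_[set v | tau i v < t] w)).
  move=> w; rewrite inE /= => Mk; rewrite /hawkes_intensity Mk; congr (_ + _).
  rewrite [RHS]big_mkcond/=; apply: eq_bigr => i _; rewrite indicE.
  have -> : (w \in [set v | tau i v < t]) = (tau i w < t) by apply/idP/idP; rewrite inE.
  by case: ifP; rewrite ?mulr1// mulr0.
apply: measurable_funTS; apply: measurable_funD => //; apply: measurable_sum => i.
apply: measurable_funM.
  apply: measurable_funM => //.
  apply: measurableT_comp; first exact: measurable_expR.
  by apply: measurable_funM => //; exact: measurable_funB.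
apply: measurable_indic.
have -> : [set v | tau i v < t] = tau i @^-1` `]-oo, t[%classic.
  by apply/seteqP; split => w /=; rewrite in_itv.
exact: measurable_funPTI.
Qed.

End hawkes_process.

(** * Arrival probabilities over short intervals *)

Lemma dist_onem_le (R : realType) (p I x : R) : 0 <= p ->
  `|p - (1 - I * x)| <= x -> I * x <= 1 + x.
Proof. by move=> p0; rewrite ler_norml => /andP[]; lra. Qed.

Lemma dist_onem_compl (R : realType) (p I x C : R) :
  `|p - (1 - I * x)| <= x -> I * x <= (C - 1) * x -> 1 - p <= C * x.
Proof. by rewrite ler_norml mulrBl mul1r => /andP[]; lra. Qed.

Section hawkes_arrivals.
Context {R : realType} {d : measure_display} {T : measurableType d}.
Variables (P : probability T R) (lambda r : R) (B : {RV P >-> R}).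
Variables (M : R -> T -> nat) (tau Bs : nat -> {RV P >-> R}).
Hypothesis hw : hawkes lambda (exp_excitation r) B M tau Bs.

Let count := hawkes_count hw.
Let tau_gt0 := hawkes_epoch_gt0 hw.
Let tau_lt := hawkes_epoch_lt hw.

Local Notation F := (hawkes_filtration M tau Bs).
Local Notation V := (post_intensity lambda r M tau Bs).
Local Notation L := (hawkes_intensity lambda (exp_excitation r) M tau Bs).

Lemma filtration_cst_levels t c (y : R) : F t [set _ : T | c <= y].
Proof.
rewrite /hawkes_filtration; set G := (X in <<s X >>).
have [cy|cy] := boolP (c <= y).
  rewrite (_ : mkset _ = setT).
    exact: (@measurableT _ (g_sigma_algebraType G)).
  by apply/seteqP; split.
rewrite (_ : mkset _ = set0).
  exact: (@measurable0 _ (g_sigma_algebraType G)).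
by apply/seteqP; split => // w /= cy'; rewrite cy' in cy.
Qed.

Lemma measurable_no_arrival t D : 0 <= t -> 0 < D ->
  measurable [set w | M (t + D) w = M t w].
Proof.
move=> t0 D0; have tD0 : 0 <= t + D by rewrite addr_ge0// ltW.
rewrite (_ : mkset _ =
  \bigcup_k ([set w | M (t + D) w = k] `&` [set w | M t w = k])).
  by apply: bigcupT_measurable => k; apply: measurableI; exact: (measurable_count_eq hw).
apply/seteqP; split => w /=; first by move=> E; exists (M t w) => //; split.
by move=> [k _ [-> ->]].
Qed.

Lemma measurable_more_arrivals t D : 0 <= t -> 0 < D ->
  measurable [set w | ((M t w).+1 < M (t + D)%R w)%N].
Proof.
move=> t0 D0; have tD0 : 0 <= t + D by rewrite addr_ge0// ltW.
rewrite (_ : mkset _ =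
  \bigcup_k ([set w | tau k.+1 w <= t + D] `&` [set w | M t w = k])).
  apply: bigcupT_measurable => k; apply: measurableI.
    exact: measurable_epoch_le.
  exact: (measurable_count_eq hw).
apply/seteqP; split => w /=; first by rewrite count// => h; exists (M t w).
by move=> [k _ [h ->]]; rewrite count.
Qed.

Lemma more_arrivals_le (K e : R) : 0 < e -> exists2 delta : R, 0 < delta &
  forall t D : R, 0 <= t <= K -> 0 < D < delta ->
    fine (P [set w | ((M t w).+1 < M (t + D)%R w)%N]) <= e * D.
Proof.
move=> e0.
have m0 (t D : R) : 0 <= t -> measurable_fun [set: T] (fun=> 0 : R) by [].
have m1 : measurable_fun [set: T] (fun=> 1 : R) by [].
have b1 (w : T) : 0 <= (1 : R) <= 1 by rewrite ler01 lexx.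
have [delta delta0 Hd] := cond_prob_littleo_bounded (hawkes_more_arrivals hw)
  (fun t A _ => hawkes_filtration_measurable hw (A:=A))
  measurable_more_arrivals m0 K e0.
exists delta => // t D tK Dd; have [_ /(_ (fun=> 1))] := Hd t D tK Dd.
have /andP[t0 _] := tK; have /andP[D0 _] := Dd.
have mE := measurable_more_arrivals t0 D0.
move=> /(_ m1 b1).
move=> /(_ (fun c => ltac:(exact: filtration_cst_levels))).
under eq_Rintegral do rewrite mulr1.
under [X in _ - X]eq_Rintegral do rewrite mulr1.
rewrite Rintegral_indic// Rintegral_cst1 subr0; apply: le_trans; exact: ler_norm.
Qed.

Lemma no_arrival_bounded (K e : R) : 0 < e -> exists2 delta : R, 0 < delta &
  forall t D : R, 0 <= t <= K -> 0 < D < delta ->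
    P.-integrable setT (EFin \o L t) /\
    forall Y : T -> R, measurable_fun setT Y -> (forall w, 0 <= Y w <= 1) ->
      (forall c, F t [set w | c <= Y w]) ->
      `|\int[P]_w (\1_[set w | M (t + D) w = M t w] w * Y w) -
        \int[P]_w ((1 - L t w * D) * Y w)| <= e * D.
Proof.
move=> e0.
have mg t D : 0 <= t -> measurable_fun setT (fun w => 1 - L t w * D).
  move=> t0; apply: measurable_funB => //; apply: measurable_funM => //.
  exact: (measurable_hawkes_intensity hw).
have [delta delta0 Hd] := cond_prob_littleo_bounded (hawkes_no_arrival hw)
  (fun t A _ => hawkes_filtration_measurable hw (A:=A)) measurable_no_arrival mg K e0.
exists delta => // t D tK Dd; have [Ig HY] := Hd t D tK Dd; split=> //.
have /andP[D0 _] := Dd.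
(* The intensity is recovered as (1 - (1 - L D)) / D, whose inner bracket is known to be
   integrable. *)
have := integrable_mulr D^-1 (integrable_subr (integrable_cst1 P 1) Ig).
congr (_ .-integrable _ _); apply/funext => w /=; congr EFin.
by rewrite opprB addrCA subrr addr0 mulrCA mulVf ?mulr1// gt_eqF.
Qed.

(** The no-arrival estimate feeds on itself. At one fixed step [D0], a probability being nonnegative
    forces E L(t) <= (1 + D0) / D0 for all t in [0, K]; with this bound the same estimate at any
    admissible step [D] makes the probability of an arrival at most [C * D]. *)
Lemma arrival_bound (K : R) : exists C delta : R, [/\ 0 <= C, 0 < delta &
  forall t : R, 0 <= t <= K -> P.-integrable setT (EFin \o L t) /\
    forall D, 0 < D < delta ->
      fine (P (~` [set w | M (t + D) w = M t w])) <= C * D].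
Proof.
have [delta delta0 Hd] := no_arrival_bounded K ltr01.
pose D0 := delta / 2; have D00 : 0 < D0 by rewrite divr_gt0.
have D0d : 0 < D0 < delta by rewrite D00 ltr_pdivrMr// ltr_pMr// ltr1n.
have m1 : measurable_fun [set: T] (fun=> 1 : R) by [].
have b1 (w : T) : 0 <= (1 : R) <= 1 by rewrite ler01 lexx.
have one (t D : R) : 0 <= t <= K -> 0 < D < delta ->
    P.-integrable setT (EFin \o L t) /\
    `|fine (P [set w | M (t + D) w = M t w]) - (1 - (\int[P]_w L t w) * D)| <= D.
  move=> tK Dd; have [IL /(_ (fun=> 1)) h] := Hd t D tK Dd; split=> //; move: h.
  have /andP[t0 _] := tK; have /andP[D1 _] := Dd.
  have mE := measurable_no_arrival t0 D1.
  move=> /(_ m1 b1).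
  move=> /(_ (fun c => ltac:(exact: filtration_cst_levels))).
  under eq_Rintegral do rewrite mulr1.
  under [X in _ - X]eq_Rintegral do rewrite mulr1.
  rewrite Rintegral_indic// RintegralB//; [|exact: integrable_cst1|].
    by rewrite Rintegral_cst1 RintegralZr// mul1r.
  have := integrable_mulr D IL; congr (_ .-integrable _ _).
  by apply/funext => w /=; rewrite mulrC.
pose C := (1 + D0) / D0 + 1.
have C0 : 0 <= C by rewrite addr_ge0// divr_ge0// ?addr_ge0// ltW.
exists C, delta; split=> // t tK; have [IL bL] := one t D0 tK D0d; split=> // D Dd.
have /andP[t0 _] := tK; have /andP[D1 _] := Dd.
have mE := measurable_no_arrival t0 D1.
have [_ bD] := one t D tK Dd.
have EL : \int[P]_w L t w <= C - 1.
  rewrite addrK ler_pdivlMr//.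
  exact: (@dist_onem_le _ _ _ _ (fine_ge0 (measure_ge0 P _)) bL).
rewrite probability_setC// fineB ?probability_fin_num//=.
exact: (@dist_onem_compl _ _ _ _ _ bD (ler_wpM2r (ltW D1) EL)).
Qed.

(** An epoch at [t] is an arrival in ]t - D, t], an event of probability at most C D for arbitrarily
    small D. *)
Lemma epoch_neq t i : 0 <= t -> {ae P, forall w, tau i w <> t}.
Proof.
move=> t0; have mE : measurable (tau i @^-1` [set t]) by exact: measurable_funPTI.
exists (tau i @^-1` [set t]); split=> //; last by move=> w /= /contrapT.
rewrite -(@fineK _ (P _)) ?probability_fin_num//; congr EFin.
have [C [delta [C0 delta0 Hd]]] := arrival_bound t.
move: t0; rewrite le_eqVlt => /predU1P[t0|t0].
  rewrite (_ : tau i @^-1` _ = set0) ?measure0// -t0.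
  apply/seteqP; split => w //= ti.
  by have := tau_pos tau_gt0 tau_lt i w; rewrite ti ltxx.
apply/eqP; rewrite eq_le fine_ge0 ?measure_ge0// andbT.
apply/ler_addgt0Pl => e e0; rewrite addr0.
(* The three terms keep [D] below [delta], keep [t - D] nonnegative, and make [C * D] at most [e];
   [C + 1] avoids a division by zero. *)
pose D := Num.min (delta / 2) (Num.min t (e / (C + 1))).
have C1 : 0 < C + 1 by rewrite ltr_wpDl.
have D0 : 0 < D by rewrite !lt_min !divr_gt0// t0.
have Dd : D < delta.
  by rewrite gt_min ltr_pdivrMr// ltr_pMr// ltr1n.
have Dt : D <= t by rewrite !ge_min lexx orbT.
have De : D <= e / (C + 1) by rewrite !ge_min lexx !orbT.
have s0 : 0 <= t - D by rewrite subr_ge0.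
have sK : 0 <= t - D <= t by rewrite s0 gerBl ltW.
have [_ /(_ D)] := Hd _ sK; rewrite D0 Dd subrK => /(_ isT) h.
apply: (@le_trans _ _ (C * D)); last first.
  move: De; rewrite ler_pdivlMr// mulrDr mulr1 mulrC => De.
  by rewrite (le_trans _ De)// lerDl ltW.
apply: le_trans h; rewrite fine_le ?probability_fin_num//.
  by apply: measurableC; have := measurable_no_arrival s0 D0; rewrite subrK.
have mN : measurable (~` [set w | M t w = M (t - D) w]).
  by apply: measurableC; have := measurable_no_arrival s0 D0; rewrite subrK.
apply: (le_measure P); rewrite ?inE//.
move=> w /= ti E.
have : (i < M t w)%N by rewrite count ?ti// ltW.
by rewrite E count// ti leNgt ltrBlDr ltrDl D0.
Qed.

(** The two differ only in an arrival exactly at [t] and in the sign of a mark, and both exceptions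
    are null events. *)
Lemma hawkes_intensity_ae t : 0 <= t -> {ae P, forall w, L t w = V t w}.
Proof.
move=> t0.
have h1 : {ae P, forall w, forall i, 0 <= Bs i w}.
  by apply: ae_foralln => i; exact: (mark_ge0 hw).
have h2 : {ae P, forall w, forall i, tau i w <> t}.
  by apply: ae_foralln => i; exact: epoch_neq.
near=> w.
have Bw : forall i, 0 <= Bs i w by near: w.
have tw : forall i, tau i w <> t by near: w.
rewrite /hawkes_intensity /post_intensity; congr (_ + _).
rewrite big_mkcond/=; apply: eq_bigr => i _.
rewrite ger0_norm// lt_neqAle; have /eqP -> /= := tw i.
by rewrite -count// ltn_ord.
Unshelve. all: by end_near. Qed.

End hawkes_arrivals.
(** * The infinitesimal generator on exponentials *)

Section exponential_bounds.
Context {R : realType}.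
Implicit Types (x y z s q c b l : R).

Lemma expRN_le1 x : 0 <= x -> expR (- x) <= 1.
Proof. by move=> x0; rewrite expR_le1 oppr_le0. Qed.

Lemma onem_expRN_le x : 1 - expR (- x) <= x.
Proof. have := expR_ge1Dx (- x); lra. Qed.

Lemma mul_expRN_le1 x : x * expR (- x) <= 1.
Proof.
rewrite expRN ler_pdivrMr ?expR_gt0// mul1r.
have := expR_ge1Dx x; lra.
Qed.

Lemma sqr_expRN_le4 x : 0 <= x -> x ^+ 2 * expR (- x) <= 4.
Proof.
move=> x0; have -> : expR (- x) = expR (- (x / 2)) ^+ 2.
  by rewrite -expRM_natl; congr expR; field.
rewrite -exprMn.
have h := mul_expRN_le1 (x / 2).
have : x * expR (- (x / 2)) <= 2 by move: h; set e := expR _; lra.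
have : 0 <= x * expR (- (x / 2)) by rewrite mulr_ge0// expR_ge0.
by move: (x * _) => y y0 y2; rewrite expr2; nra.
Qed.

Lemma expR_sub1_bounds z : 0 <= z -> 0 <= expR z - 1 <= z * expR z.
Proof.
move=> z0; apply/andP; split; first by rewrite subr_ge0 -expR0 ler_expR.
have := onem_expRN_le z; rewrite -(ler_pM2r (expR_gt0 z)) mulrBl mul1r.
by rewrite -expRD addNr expR0.
Qed.

Lemma expRN_taylor1 x : 0 <= x -> 0 <= expR (- x) - 1 + x <= x ^+ 2.
Proof.
move=> x0; have h := onem_expRN_le x; have := expR_ge1Dx x.
rewrite -(ler_pM2r (expR_gt0 (- x))) -expRD subrr expR0 mulrDl mul1r.
move: h; set e := expR _ => h1 h2; apply/andP; split; first lra.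
by have := ler_wpM2l x0 h1; rewrite expr2 mulrBr mulr1; lra.
Qed.

(** Here [c] is the decay of a mark between its arrival and the end of the step. With x = s b the
    difference is at most e^(-x c) x (1 - c), and x c e^(-x c) <= 1 removes the dependence on the
    size of the mark. *)
Lemma discount_mark s b q c : 0 < q -> q <= c <= 1 -> 0 <= s -> 0 <= b ->
  `|expR (- (s * b)) - expR (- (s * (b * c)))| <= q^-1 - 1.
Proof.
move=> q0 /andP[qc c1] s0 b0; have c0 : 0 < c by exact: lt_le_trans qc.
have x0 : 0 <= s * b by rewrite mulr_ge0.
rewrite (mulrA s b) ; move: (s * b) x0 => x x0.
have -> : expR (- x) = expR (- (x * c)) * expR (- (x * (1 - c))).
  by rewrite -expRD; congr expR; ring.
have xc0 : 0 <= x * c by rewrite mulr_ge0// ltW.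
have xc1 : 0 <= x * (1 - c) by rewrite mulr_ge0// subr_ge0.
have h1 := onem_expRN_le (x * (1 - c)).
have h1' := expRN_le1 xc1.
have h2 := mul_expRN_le1 (x * c).
have e0 := expR_gt0 (- (x * c)).
rewrite distrC ger0_norm; last by rewrite subr_ge0 ler_piMr// ltW.
apply: (@le_trans _ _ (c^-1 - 1)); last by rewrite lerB// lef_pV2.
rewrite -(ler_pM2r c0) [leRHS]mulrBl mulVf ?gt_eqF// mul1r.
move: h1 h1' h2 e0; set g := expR _; set e := expR _ => h1 h1' h2 e0.
have : e * (1 - g) * c <= e * (x * (1 - c)) * c.
  by rewrite ler_pM2r// ler_pM2l.
have -> : e * (x * (1 - c)) * c = x * c * e * (1 - c) by ring.
have : x * c * e * (1 - c) <= 1 * (1 - c) by rewrite ler_wpM2r// subr_ge0.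
rewrite mul1r (_ : e - e * g = e * (1 - g)); last by ring.
lra.
Qed.

(** The remainder must be uniform in the unbounded state [y]. With a = s y and z = a (1 - e^(-x)),
    and up to the factor e^(-s l) <= 1, it equals e^(-a) (e^z - 1 - z) - a e^(-a) (e^(-x) - 1 + x).
    The first term is at most 4 (e^x - 1)^2 by [sqr_expRN_le4], the second at most x^2 <= (e^x -
    1)^2. *)
Lemma discount_drift s l y x : 0 <= s -> 0 <= l -> 0 <= y -> 0 <= x ->
  `|expR (- (s * (l + y * expR (- x)))) - expR (- (s * (l + y)))
    - s * x * y * expR (- (s * (l + y)))| <= 5 * (expR x - 1) ^+ 2.
Proof.
move=> s0 l0 y0 x0.
have sl0 : 0 <= s * l by rewrite mulr_ge0.
have -> : expR (- (s * (l + y * expR (- x)))) =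
    expR (- (s * l)) * expR (- (s * y * expR (- x))).
  by rewrite -expRD; congr expR; ring.
have -> : expR (- (s * (l + y))) = expR (- (s * l)) * expR (- (s * y)).
  by rewrite -expRD; congr expR; ring.
have a0 : 0 <= s * y by rewrite mulr_ge0.
rewrite (_ : _ - _ = expR (- (s * l)) * (expR (- (s * y * expR (- x)))
   - expR (- (s * y)) - x * (s * y) * expR (- (s * y)))); last by ring.
rewrite normrM ger0_norm ?expR_ge0//.
apply: (@le_trans _ _ (1 * `|expR (- (s * y * expR (- x))) - expR (- (s * y))
    - x * (s * y) * expR (- (s * y))|)); first by rewrite ler_wpM2r// expRN_le1.
rewrite mul1r; move: (s * y) a0 => a a0 {s0 l0 y0 sl0 l y s}.
have q0 := expR_gt0 (- x).
have qE : expR x = (expR (- x))^-1 by rewrite expRN invrK.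
have q1 : expR (- x) <= 1 by exact: expRN_le1.
have /andP[t1 t2] := expRN_taylor1 x0.
have ex : x <= expR x - 1 by have := expR_ge1Dx x; lra.
have aeE : expR (- (a * expR (- x))) = expR (- a) * expR (a * (1 - expR (- x))).
  by rewrite -expRD; congr expR; ring.
have h4 : (a * expR (- x)) ^+ 2 * expR (- (a * expR (- x))) <= 4.
  by apply: sqr_expRN_le4; rewrite mulr_ge0// ltW.
have az0 : 0 <= a * (1 - expR (- x)) by rewrite mulr_ge0// subr_ge0.
have /andP[g1 g2] := expR_sub1_bounds az0.
have f0 := expR_gt0 (- a).
have f1 := mul_expRN_le1 a.
rewrite aeE in h4 *.
have g3 : expR (a * (1 - expR (- x))) - 1 - a * (1 - expR (- x))
    <= (a * (1 - expR (- x))) ^+ 2 * expR (a * (1 - expR (- x))).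
  by move: az0 g1 g2; set z := a * _; set w := expR _; nra.
have g4 : 0 <= expR (a * (1 - expR (- x))) - 1 - a * (1 - expR (- x)).
  by have := expR_ge1Dx (a * (1 - expR (- x))); lra.
have hx : x ^+ 2 <= (expR x - 1) ^+ 2 by rewrite lerXn2r// nnegrE; lra.
have e1 : expR (- a) * ((a * (1 - expR (- x))) ^+ 2 * expR (a * (1 - expR (- x))))
    <= 4 * (expR x - 1) ^+ 2.
  have -> : expR (- a) * ((a * (1 - expR (- x))) ^+ 2 * expR (a * (1 - expR (- x)))) =
     (expR x - 1) ^+ 2 *
     ((a * expR (- x)) ^+ 2 * (expR (- a) * expR (a * (1 - expR (- x))))).
    by rewrite qE; field; rewrite gt_eqF.
  by rewrite mulrC ler_wpM2r// sqr_ge0.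
rewrite (_ : _ - _ =
  expR (- a) * (expR (a * (1 - expR (- x))) - 1 - a * (1 - expR (- x))) -
  a * expR (- a) * (expR (- x) - 1 + x)); last by ring.
have A0 : 0 <= expR (- a) * (expR (a * (1 - expR (- x))) - 1 - a * (1 - expR (- x))).
  by rewrite mulr_ge0// ltW.
have A1 : expR (- a) * (expR (a * (1 - expR (- x))) - 1 - a * (1 - expR (- x)))
   <= 4 * (expR x - 1) ^+ 2.
  by rewrite (le_trans _ e1)// ler_pM2l.
have ae0 : 0 <= a * expR (- a) by rewrite mulr_ge0// ltW.
have B0 : 0 <= a * expR (- a) * (expR (- x) - 1 + x) by rewrite mulr_ge0.
have B1 : a * expR (- a) * (expR (- x) - 1 + x) <= (expR x - 1) ^+ 2.
  apply: le_trans hx; apply: le_trans t2.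
  by rewrite -[leRHS]mul1r ler_wpM2r.
move: A0 A1 B0 B1; set A := expR (- a) * _; set A' := a * _ * _; set p := _ ^+ 2.
by move=> *; rewrite ler_norml; apply/andP; split; lra.
Qed.

(** The unbounded factor [v] is absorbed by the exponential: the increment costs one more factor of
    order s v, and (s v e^(-x))^2 e^(-s v e^(-x)) <= 4. *)
Lemma discount_rate s v l x : 0 < s -> 0 <= l -> l <= v -> 0 <= x ->
  `|v * expR (- (s * (l + (v - l) * expR (- x)))) - v * expR (- (s * v))|
  <= 4 * (expR x - 1) * expR x / s.
Proof.
move=> s0 l0 lv x0; have v0 : 0 <= v := le_trans l0 lv.
have q0 := expR_gt0 (- x); have q1 := expRN_le1 x0.
have qE : expR x = (expR (- x))^-1 by rewrite expRN invrK.
set z := s * (v - l) * (1 - expR (- x)).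
have sv : 0 <= s * (v - l) by rewrite mulr_ge0 ?subr_ge0// ltW.
have z0 : 0 <= z by rewrite mulr_ge0 ?subr_ge0.
have E : expR (- (s * (l + (v - l) * expR (- x)))) = expR (- (s * v)) * expR z.
  by rewrite -expRD; congr expR; rewrite /z; ring.
have /andP[g1 g2] := expR_sub1_bounds z0.
rewrite E (_ : _ - _ = v * expR (- (s * v)) * (expR z - 1)); last by ring.
rewrite ger0_norm; last by rewrite !mulr_ge0// expR_ge0.
apply: (@le_trans _ _ (v * expR (- (s * v)) * (z * expR z))).
  by rewrite ler_wpM2l// mulr_ge0// expR_ge0.
rewrite (_ : _ * _ = v * z * (expR (- (s * v)) * expR z)); last by ring.
rewrite -E.
apply: (@le_trans _ _ (v * (s * v * (1 - expR (- x))) * expR (- (s * v * expR (- x))))).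
  have vz0 : 0 <= v * z by exact: mulr_ge0.
  apply: ler_pM => //.
    rewrite ler_wpM2l// /z ler_wpM2r ?subr_ge0// ler_pM2l// gerBl//.
  rewrite ler_expR lerN2 -mulrA ler_pM2l// mulrBl.
  have : l * expR (- x) <= l by rewrite ler_piMr.
  by lra.
rewrite ler_pdivlMr//.
have -> : v * (s * v * (1 - expR (- x))) * expR (- (s * v * expR (- x))) * s =
   (s * v * expR (- x)) ^+ 2 * expR (- (s * v * expR (- x))) * ((expR x - 1) * expR x).
  by rewrite qE; field; rewrite gt_eqF.
rewrite -(mulrA 4) ler_wpM2r//.
  rewrite mulr_ge0 ?expR_ge0// subr_ge0 -expR0 ler_expR//.
by apply: sqr_expRN_le4; rewrite !mulr_ge0// ltW.
Qed.

Lemma expR_sub1_le2 x : 0 <= x -> x <= 2^-1 -> expR x - 1 <= 2 * x.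
Proof.
move=> x0 x2; have := onem_expRN_le x; have := expR_gt0 x.
rewrite expRN; set e := expR x => e0 h.
have := ler_wpM2r (ltW e0) h; rewrite mulrBl mulVf ?gt_eqF// mul1r => h2.
nra.
Qed.

End exponential_bounds.

(* Here U1 and u0 are the means of exp (-s Lambda) at times t + D and t, y is  *)
(* the mean of the value that exp (-s Lambda) would have at t + D without     *)
(* arrivals, N the part of y carried by the event of no arrival, l and v the  *)
(* means of Lambda(t) times these exponentials, and b the transform of a mark. *)
Lemma generator_split (R : realType)
    (U1 N y l u0 v b D s r lambda e1 e2 e3 e4 : R) :
  0 <= b <= 1 -> 0 <= D ->
  `|U1 - (N + b * (y - N))| <= e1 -> `|N - (y - D * l)| <= e2 ->
  `|y - u0 - s * (r * D) * (v - lambda * u0)| <= e3 -> `|l - v| <= e4 ->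
  `|U1 - u0 - D * ((s * r - (1 - b)) * v - s * r * lambda * u0)|
  <= e1 + e2 + e3 + D * e4.
Proof.
move=> /andP[b0 b1] D0 h1 h2 h3 h4.
rewrite (_ : _ - _ = (U1 - (N + b * (y - N))) + (1 - b) * (N - (y - D * l)) +
  (y - u0 - s * (r * D) * (v - lambda * u0)) - (1 - b) * (D * (l - v))); last by ring.
have c0 : 0 <= 1 - b by rewrite subr_ge0.
have c1 : 1 - b <= 1 by rewrite gerBl.
apply: (le_trans (ler_normB _ _)); apply: lerD.
  apply: (le_trans (ler_normD _ _)); apply: lerD => //.
  apply: (le_trans (ler_normD _ _)); apply: lerD => //.
  by rewrite normrM ger0_norm// (le_trans _ h2)// ler_piMl.
rewrite !normrM ger0_norm// (ger0_norm D0).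
apply: (@le_trans _ _ (D * `|l - v|)); last by rewrite ler_wpM2l.
by rewrite ler_piMl// mulr_ge0.
Qed.

(** * One time step of the exponential functional *)

Section hawkes_generator.
Context {R : realType} {d : measure_display} {T : measurableType d}.
Variables (P : probability T R) (lambda r : R) (B : {RV P >-> R}).
Variables (M : R -> T -> nat) (tau Bs : nat -> {RV P >-> R}).
Hypothesis hw : hawkes lambda (exp_excitation r) B M tau Bs.
Hypotheses (lambda_gt0 : 0 < lambda) (r_gt0 : 0 < r).
Variable s : R.
Hypothesis s_gt0 : 0 < s.

Let count := hawkes_count hw.
Let tau_gt0 := hawkes_epoch_gt0 hw.
Let tau_lt := hawkes_epoch_lt hw.

Local Notation F := (hawkes_filtration M tau Bs).
Local Notation H := (pre_mark_history tau Bs).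
Local Notation V := (post_intensity lambda r M tau Bs).
Local Notation Vk := (post_intensity_upto lambda r tau Bs).
Local Notation L := (hawkes_intensity lambda (exp_excitation r) M tau Bs).

(** The Laplace transform of the mark; the absolute value bounds the integrand by 1 everywhere and
    changes it on a null set only. *)
Definition mark_transform : R := \int[P]_w expR (- (s * `|B w|)).
Local Notation beta := mark_transform.

Let e_ (b : R) : R := expR (- (s * `|b|)).

Let me_ : measurable_fun [set: R] e_.
Proof.
apply: measurableT_comp; first exact: measurable_expR.
by apply: measurable_funN; apply: measurable_funM.
Qed.

Let e_01 b : 0 <= e_ b <= 1.
Proof. by rewrite expR_ge0 expRN_le1// mulr_ge0// ltW. Qed.

Lemma mark_transform_mark k : \int[P]_w e_ (Bs k w) = beta.
Proof.
have mE : measurable_fun [set: R] (fun b => (e_ b)%:E) by exact/measurable_EFinP.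
have e0 b : (0 <= (e_ b)%:E)%E by rewrite lee_fin; have /andP[] := e_01 b.
rewrite /mark_transform /Rintegral; congr fine.
rewrite -(ge0_integral_distribution (Bs k) mE e0).
rewrite -(ge0_integral_distribution B mE e0).
by apply: eq_measure_integral => A mA _; exact: (hawkes_mark_law hw).
Qed.

Lemma mark_transform_itv : 0 <= beta <= 1.
Proof.
apply/andP; split; first by apply: Rintegral_ge0 => w _; exact: expR_ge0.
have mf : measurable_fun setT (fun w => e_ (B w)) by exact: measurableT_comp.
have := le_bound_Rintegral P mf (norm_unit_interval (fun w => e_01 (B w))).
by rewrite ler_norml => /andP[].
Qed.

Section step.
Variables t D : R.
Hypotheses (t0 : 0 <= t) (D0 : 0 < D).

(* phi (V t) is the value exp (-s V) takes at time t + D if there is no        *)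
(* arrival in ]t, t + D].                                                      *)
Let phi (x : R) : R :=
  expR (- (s * (lambda + (x - lambda) * expR (- (r * D))))).

Let mphi : measurable_fun [set: R] phi.
Proof.
apply: measurableT_comp; first exact: measurable_expR.
apply: measurable_funN; apply: measurable_funM => //; apply: measurable_funD => //.
by apply: measurable_funM => //; exact: measurable_funB.
Qed.

Let phi01 x : lambda <= x -> 0 <= phi x <= 1.
Proof.
move=> lx; rewrite expR_ge0 expRN_le1// mulr_ge0 ?(ltW s_gt0)//.
by rewrite addr_ge0 ?(ltW lambda_gt0)// mulr_ge0 ?subr_ge0// expR_ge0.
Qed.

Let nA := [set w | M (t + D) w = M t w].
Let A k := [set w | M t w = k] `&` [set w | tau k w <= t + D].

(** The first new arrival carries the random number [M t]; fixing its value makes the independence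
    hypothesis, stated for a given [k], applicable. *)
Lemma arrival_decomposition : ~` nA = \bigcup_k A k.
Proof.
have tD0 : 0 <= t + D by rewrite addr_ge0// ltW.
apply/seteqP; split => w /=.
  move/eqP => h; exists (M t w) => //; split=> //=.
  rewrite -count// ltn_neqAle eq_sym h (count_mono count)// t0 lerDl ltW//.
by move=> [k _ [/= Mk]]; rewrite -count// => h E; rewrite E Mk ltnn in h.
Qed.

Let mA k : measurable (A k).
Proof.
by apply: measurableI; [exact: (measurable_count_eq hw)|exact: measurable_epoch_le].
Qed.

(* M t = k and tau k <= t + D is known before the mark of arrival k is drawn. *)
Lemma one_arrival_at k :
  \int[P]_(w in A k) (phi (V t w) * e_ (Bs k w)) =
  beta * \int[P]_(w in A k) phi (V t w).
Proof.
pose G := [set E | exists i (A : set R), measurable A /\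
         ((i <= k)%N /\ E = tau i @^-1` A \/ (i < k)%N /\ E = Bs i @^-1` A)].
pose Y w := phi (Vk k t w) * \1_(A k) w.
have HA : <<s G >> (A k) by exact: (pre_mark_history_event hw).
have mGV : measurable_fun setT (Vk k t : g_sigma_algebraType G -> R).
  exact: pre_mark_history_upto.
have mGY : measurable_fun setT (Y : g_sigma_algebraType G -> R).
  apply: measurable_funM; first exact: measurableT_comp.
  exact: measurable_indic.
have Glev c : <<s G >> [set w | c <= Y w].
  exact: (@measurable_levels _ _ (g_sigma_algebraType G)).
have Gm E : <<s G >> E -> measurable E.
  exact: pre_mark_history_measurable.
have mY : measurable_fun setT Y.
  by move=> _ S mS; rewrite setTI; apply: Gm; rewrite -[_ @^-1` _]setTI; exact: mGY.
have lV w : lambda <= Vk k t w.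
  by rewrite lerDl sumr_ge0// => i _; rewrite mulr_ge0// expR_ge0.
have Y01 w : 0 <= Y w <= 1.
  have /andP[a b] := phi01 (lV w); rewrite /Y indicE.
  by case: (_ \in _); rewrite ?mulr1 ?mulr0 ?a// lexx ler01.
have mX : measurable_fun setT (fun w => e_ (Bs k w)) by exact: measurableT_comp.
have indep := indep_sigma_bounded Gm mX (fun w => e_01 (Bs k w)) mY Y01 Glev.
have AE w : w \in A k -> Y w = phi (V t w).
  move=> wA; rewrite /Y indicE wA mulr1.
  by move: wA; rewrite inE => -[/= Mk _]; rewrite (post_intensity_uptoE _ _ _ _ Mk).
have AN w : w \notin A k -> Y w = 0 by rewrite /Y indicE => /negbTE ->; rewrite mulr0.
rewrite [in RHS]Rintegral_mkcond [LHS]Rintegral_mkcond.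
rewrite -(mark_transform_mark k).
rewrite [in RHS](_ : _ \_ _ = Y); last first.
  by apply/funext => w; rewrite /patch; case: ifPn => [/AE|/AN].
rewrite -indep.
  apply: eq_Rintegral => w _; rewrite /patch; case: ifPn => [/AE ->|/AN ->].
    by rewrite mulrC.
  by rewrite mulr0.
move=> c E GE.
have -> : [set w | c <= e_ (Bs k w)] = Bs k @^-1` [set b | c <= e_ b] by [].
by apply: (hawkes_mark_indep hw) => //; exact: measurable_levels.
Qed.

Let mmark : measurable_fun setT (fun w => e_ (Bs (M t w) w)).
Proof.
have mc k := measurable_count_eq hw k t0.
apply: (measurable_fun_glue mc) => k.
apply: (@eq_measurable_fun _ _ _ _ _ (fun w => e_ (Bs k w))).
  by move=> w; rewrite inE /= => ->.
by apply: measurable_funTS; exact: measurableT_comp.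
Qed.

Let mphiV : measurable_fun setT (fun w => phi (V t w)).
Proof. by apply: measurableT_comp => //; exact: (measurable_post hw). Qed.

(** Summing [one_arrival_at] over the disjoint events [A k]. Further arrivals in the same step are
    still included here; only the mark of the first one is averaged. *)
Lemma one_arrival :
  \int[P]_(w in ~` nA) (phi (V t w) * e_ (Bs (M t w) w)) =
  beta * \int[P]_(w in ~` nA) phi (V t w).
Proof.
have lV w : lambda <= V t w by exact: post_intensity_ge.
have p0 w : 0 <= phi (V t w) by have /andP[] := phi01 (lV w).
have p1 w : phi (V t w) <= 1 by have /andP[] := phi01 (lV w).
have tA : trivIset setT A.
  apply/trivIsetP => i j _ _ ij; apply/seteqP; split => // w [[/= Mi _] [/= Mj _]].
  by rewrite -Mi -Mj eqxx in ij.
have Ip : P.-integrable setT (EFin \o (fun w => phi (V t w))).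
  by apply: (@bounded_integrable _ _ _ _ _ 1) => // w; rewrite ger0_norm.
have mpe : measurable_fun setT (fun w => phi (V t w) * e_ (Bs (M t w) w)).
  exact: measurable_funM.
have Ipe : P.-integrable setT (EFin \o (fun w => phi (V t w) * e_ (Bs (M t w) w))).
  apply: (@integrable_mul_bounded _ _ _ _ _ _ 1) => // w.
  by have /andP[a b] := e_01 (Bs (M t w) w); rewrite ger0_norm.
have mN : measurable (~` nA) by apply: measurableC; exact: (measurable_no_arrival hw).
rewrite /Rintegral -[beta]/(fine beta%:E) -fineM//; last first.
  by apply: integrable_fin_num => //; exact: integrableS Ip.
congr fine; rewrite arrival_decomposition.
rewrite ge0_integral_bigcup//; last 2 first.
- by apply: measurable_funTS; exact/measurable_EFinP.
- by move=> w _; rewrite lee_fin mulr_ge0//; have /andP[] := e_01 (Bs (M t w) w).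
rewrite ge0_integral_bigcup//; last 2 first.
- by apply: measurable_funTS; exact/measurable_EFinP.
- by move=> w _; rewrite lee_fin.
rewrite -nneseriesZl; last by move=> k _; apply: integral_ge0 => w _; rewrite lee_fin.
apply: eq_eseriesr => k _.
have : (\int[P]_(w in A k) (phi (V t w) * e_ (Bs k w))%:E =
        beta%:E * \int[P]_(w in A k) (phi (V t w))%:E)%E.
  move: (one_arrival_at k); move: (beta) => b0 h.
  have := congr1 EFin h; rewrite EFinM /Rintegral fineK; last first.
    apply: integrable_fin_num => //; apply: integrableS (measurableT) _ _ _ => //.
    apply: (@integrable_mul_bounded _ _ _ _ _ _ 1) => //; first exact: measurableT_comp.
    by move=> w; have /andP[a b] := e_01 (Bs k w); rewrite ger0_norm.
  by rewrite fineK//; apply: integrable_fin_num => //; exact: integrableS Ip.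
move=> <-; apply: eq_integral => w; rewrite inE => -[/= Mk _].
by rewrite Mk.
Qed.

Let f (x : R) : R := expR (- (s * x)).

Let mf : measurable_fun [set: R] f.
Proof.
apply: measurableT_comp; first exact: measurable_expR.
by apply: measurable_funN; apply: measurable_funM.
Qed.

Let f01 x : lambda <= x -> 0 <= f x <= 1.
Proof.
move=> lx; rewrite expR_ge0 expRN_le1// mulr_ge0 ?(ltW s_gt0)//.
exact: le_trans (ltW lambda_gt0) lx.
Qed.

Let more := [set w | ((M t w).+1 < M (t + D)%R w)%N].
Let p := expR (r * D) - 1.

Let mnA : measurable nA. Proof. exact: (measurable_no_arrival hw). Qed.
Let mmore : measurable more. Proof. exact: (measurable_more_arrivals hw). Qed.
Let tD0 : 0 <= t + D. Proof. by rewrite addr_ge0// ltW. Qed.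
Let mV : measurable_fun setT (V t). Proof. exact: (measurable_post hw). Qed.
Let lV u w : lambda <= V u w. Proof. exact: post_intensity_ge. Qed.
Let rD0 : 0 <= r * D. Proof. by rewrite mulr_ge0// ltW. Qed.
Let p0 : 0 <= p. Proof. by rewrite subr_ge0 -expR0 ler_expR. Qed.

(** Without arrival the comparison is exact. With one arrival the only error is the decay of the new
    mark inside the step, bounded by [discount_mark] with q = e^(-r D), for which 1/q - 1 = [p].
    With more arrivals both values lie in [0, 1]. *)
Lemma post_intensity_step w :
  `|f (V (t + D) w) -
    (\1_nA w * phi (V t w) + phi (V t w) * e_ (Bs (M t w) w) * \1_(~` nA) w)|
  <= \1_more w + p * \1_(~` nA) w.
Proof.
have /andP[y0 y1] := phi01 (lV t w).
have /andP[b0 b1] := e_01 (Bs (M t w) w).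
have /andP[g0 g1] := f01 (lV (t + D) w).
have [E|NE] := eqVneq (M (t + D) w) (M t w).
  have iA : \1_nA w = 1 :> R by rewrite indicE mem_set.
  have iN : \1_(~` nA) w = 0 :> R by rewrite indicE memNset//=; apply.
  have im : \1_more w = 0 :> R.
    by rewrite indicE memNset// /more /= E ltnNge leqnSn.
  rewrite iA iN im !mulr0 !addr0 mul1r (post_intensity_no _ _ _ _ E) mulNr.
  by rewrite /f /phi subrr normr0.
have iA : \1_nA w = 0 :> R by rewrite indicE memNset// /nA /=; apply/eqP.
have iN : \1_(~` nA) w = 1 :> R by rewrite indicE mem_set//=; exact/eqP.
rewrite iA iN mul0r add0r !mulr1.
have lt : (M t w < M (t + D) w)%N.
  by rewrite ltn_neqAle eq_sym NE (count_mono count)// t0 lerDl ltW.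
have [E1|N1] := eqVneq (M (t + D) w) (M t w).+1.
  have im : \1_more w = 0 :> R by rewrite indicE memNset// /more /= E1 ltnn.
  rewrite im add0r (post_intensity_one _ _ _ _ E1) mulNr /f mulrDr opprD expRD.
  rewrite -/(phi (V t w)) -mulrBr normrM (ger0_norm y0) -[leRHS]mul1r.
  apply: ler_pM => //.
  rewrite distrC.
  have tk : tau (M t w) w <= t + D by rewrite -count// E1.
  have kt : t < tau (M t w) w by rewrite ltNge -count// ltnn.
  have q0 := expR_gt0 (- (r * D)).
  rewrite /p -[expR (r * D)]invrK -expRN; apply: discount_mark => //.
  - apply/andP; split.
      by rewrite ler_expR mulNr lerN2 ler_pM2l// lerBlDl lerD2r ltW.
    by rewrite mulNr expRN_le1// mulr_ge0 ?(ltW r_gt0)// subr_ge0.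
  - exact: ltW.
have mw : more w by rewrite /more /= ltn_neqAle eq_sym N1.
have im : \1_more w = 1 :> R by rewrite indicE mem_set.
rewrite im ler_wpDr//.
have z0 := mulr_ge0 y0 b0; have z1 := mulr_ile1 y0 b0 y1 b1.
move: g0 g1 z0 z1; set g := f _; set z := _ * _ => *.
by rewrite ler_norml; apply/andP; split; lra.
Qed.

Let phi_V01 w : 0 <= phi (V t w) <= 1. Proof. exact: phi01. Qed.

Let Iphi : P.-integrable setT (EFin \o (fun w => phi (V t w))).
Proof.
by apply: (@bounded_integrable _ _ _ _ _ 1) => //; exact: norm_unit_interval phi_V01.
Qed.

Let If u : 0 <= u -> P.-integrable setT (EFin \o (fun w => f (V u w))).
Proof.
move=> u0; apply: (@bounded_integrable _ _ _ _ _ 1).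
  by apply: measurableT_comp => //; exact: (measurable_post hw).
by apply: norm_unit_interval => w; exact: f01.
Qed.

Let IVf : P.-integrable setT (EFin \o (fun w => V t w * f (V t w))).
Proof.
apply: (@bounded_integrable _ _ _ _ _ s^-1).
  by apply: measurable_funM => //; exact: measurableT_comp.
move=> w; have v0 : 0 <= V t w by exact: le_trans (ltW lambda_gt0) (lV t w).
rewrite ger0_norm; last by rewrite mulr_ge0// expR_ge0.
rewrite -(ler_pM2l s_gt0) divff ?gt_eqF// mulrA; exact: mul_expRN_le1.
Qed.

Let IVphi : P.-integrable setT (EFin \o (fun w => V t w * phi (V t w))).
Proof.
apply: (@bounded_integrable _ _ _ _ _ (4 * p * expR (r * D) / s + s^-1)).
  by apply: measurable_funM.
move=> w; have v0 : 0 <= V t w by exact: le_trans (ltW lambda_gt0) (lV t w).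
have h1 := discount_rate s_gt0 (ltW lambda_gt0) (lV t w) rD0.
have h2 : V t w * f (V t w) <= s^-1.
  by rewrite -(ler_pM2l s_gt0) divff ?gt_eqF// mulrA; exact: mul_expRN_le1.
rewrite -[X in `|X|](subrK (V t w * f (V t w))).
apply: (le_trans (ler_normD _ _)); apply: lerD => //.
by rewrite ger0_norm// mulr_ge0// expR_ge0.
Qed.

Let Inphi : P.-integrable setT (EFin \o (fun w => \1_nA w * phi (V t w))).
Proof.
apply: (@integrable_mul_bounded _ _ _ _ _ _ 1) => //; first exact: integrable_indic1.
exact: norm_unit_interval phi_V01.
Qed.

Let Ipe : P.-integrable setT (EFin \o (fun w => phi (V t w) * e_ (Bs (M t w) w))).
Proof.
apply: (@integrable_mul_bounded _ _ _ _ _ _ 1) => //.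
by apply: norm_unit_interval => w; exact: e_01.
Qed.

Let mN : measurable (~` nA). Proof. exact: measurableC. Qed.

Let norm_indic1 (E : set T) (w : T) : `|\1_E w : R| <= 1.
Proof. by rewrite indicE; case: (_ \in _); rewrite ?normr1// normr0. Qed.

Let mindic (E : set T) : measurable E -> measurable_fun setT (\1_E : T -> R).
Proof. exact: measurable_indic. Qed.

Lemma arrivals_integral :
  `|\int[P]_w f (V (t + D) w) -
    (\int[P]_w (\1_nA w * phi (V t w)) +
     beta * (\int[P]_w phi (V t w) - \int[P]_w (\1_nA w * phi (V t w))))|
  <= fine (P more) + p * fine (P (~` nA)).
Proof.
have IpN : P.-integrable setT (EFin \o (fun w => phi (V t w) * \1_(~` nA) w)).
  by apply: (@integrable_mul_bounded _ _ _ _ _ _ 1) => //; exact: mindic.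
have IpeN : P.-integrable setT
    (EFin \o (fun w => phi (V t w) * e_ (Bs (M t w) w) * \1_(~` nA) w)).
  by apply: (@integrable_mul_bounded _ _ _ _ _ _ 1) => //; exact: mindic.
have -> : \int[P]_w phi (V t w) - \int[P]_w (\1_nA w * phi (V t w)) =
    \int[P]_(w in ~` nA) phi (V t w).
  rewrite -RintegralB// -[RHS]Rintegral_indicM//; apply: eq_Rintegral => w _.
  rewrite !indicE in_setC; case: (_ \in _) => /=; first by rewrite mul1r subrr mulr0.
  by rewrite mul0r subr0 mulr1.
rewrite -one_arrival -(Rintegral_indicM P (fun w => phi (V t w) * e_ (Bs (M t w) w)))//.
rewrite -RintegralD//.
have -> : fine (P more) + p * fine (P (~` nA)) =
    \int[P]_w (\1_more w + p * \1_(~` nA) w).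
  rewrite RintegralD//; last 2 first.
  - exact: integrable_indic1.
  - by apply: integrable_mulr; exact: integrable_indic1.
  by rewrite RintegralZl//; [rewrite !Rintegral_indic|exact: integrable_indic1].
apply: Rintegral_sub_le => //.
- exact: If.
- exact: integrable_addr.
- apply: integrable_addr; first exact: integrable_indic1.
  by apply: integrable_mulr; exact: integrable_indic1.
- exact: post_intensity_step.
Qed.

(** The decay of a new mark costs [p] on an event of probability O(D), and [p] is itself O(D), so
    this error is of second order. *)
Lemma generator_step (C e : R) :
  fine (P more) <= e * D -> fine (P (~` nA)) <= C * D ->
  P.-integrable setT (EFin \o L t) ->
  (forall Y : T -> R, measurable_fun setT Y -> (forall w, 0 <= Y w <= 1) ->
      (forall c, F t [set w | c <= Y w]) ->
      `|\int[P]_w (\1_nA w * Y w) - \int[P]_w ((1 - L t w * D) * Y w)| <= e * D) ->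
  `|\int[P]_w f (V (t + D) w) - \int[P]_w f (V t w) -
    D * ((s * r - (1 - beta)) * (\int[P]_w (V t w * f (V t w))) -
         s * r * lambda * (\int[P]_w f (V t w)))|
  <= (e * D + p * (C * D)) + e * D + 5 * p ^+ 2 + D * (4 * p * expR (r * D) / s).
Proof.
move=> hmore hno IL hY.
have ILphi : P.-integrable setT (EFin \o (fun w => L t w * phi (V t w))).
  apply: (@integrable_mul_bounded _ _ _ _ _ _ 1) => //.
  exact: norm_unit_interval phi_V01.
apply: (@generator_split _ _ (\int[P]_w (\1_nA w * phi (V t w)))
  (\int[P]_w phi (V t w)) (\int[P]_w (V t w * phi (V t w)))).
- exact: mark_transform_itv.
- exact: ltW.
- apply: (le_trans arrivals_integral); apply: lerD => //.
  by rewrite ler_wpM2l.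
(* The arrival rate is stated with [L], the recursion with [V]; they are almost surely equal at the
   fixed time [t]. *)
- have -> : \int[P]_w (V t w * phi (V t w)) = \int[P]_w (L t w * phi (V t w)).
    rewrite /Rintegral; congr fine; apply: ae_eq_integral => //.
    + exact: (measurable_int P IVphi).
    + exact: (measurable_int P ILphi).
    + near=> w; move=> _ /=; congr (_ * _)%:E; apply/esym.
      by near: w; exact: (hawkes_intensity_ae hw).
  have -> : \int[P]_w phi (V t w) - D * \int[P]_w (L t w * phi (V t w)) =
      \int[P]_w ((1 - L t w * D) * phi (V t w)).
    rewrite -RintegralZl// -RintegralB//; last exact: integrable_mulr.
    by apply: eq_Rintegral => w _; ring.
  apply: hY => //.
  move=> c; have -> : [set w | c <= phi (V t w)] = V t @^-1` [set x | c <= phi x] by [].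
  by apply: (hawkes_filtration_post hw) => //; exact: measurable_levels.
- rewrite -[X in `|X|]/(\int[P]_w phi (V t w) - \int[P]_w f (V t w) - _).
  have -> : s * (r * D) * (\int[P]_w (V t w * f (V t w)) - lambda * \int[P]_w f (V t w))
     = \int[P]_w (s * (r * D) * (V t w * f (V t w) - lambda * f (V t w))).
    have I2 := integrable_mulr lambda (If t0).
    rewrite RintegralZl//; last exact: integrable_subr.
    by rewrite RintegralB// RintegralZl//; exact: If.
  rewrite -RintegralB//; last exact: If.
  have I1 : P.-integrable setT (EFin \o (fun w => phi (V t w) - f (V t w))).
    by apply: integrable_subr => //; exact: If.
  rewrite -(Rintegral_cst1 P (5 * p ^+ 2)).
  apply: Rintegral_sub_le => //.
  + apply: integrable_mulr; apply: integrable_subr => //.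
    by apply: integrable_mulr; exact: If.
  + exact: integrable_cst1.
  + move=> w; have y0 : 0 <= V t w - lambda by rewrite subr_ge0.
    rewrite -mulrBl [_ * (_ * f _)]mulrA.
    have := discount_drift (ltW s_gt0) (ltW lambda_gt0) y0 rD0.
    by rewrite (addrC lambda (V t w - lambda)) subrK.
- rewrite -(Rintegral_cst1 P (4 * p * expR (r * D) / s)).
  apply: Rintegral_sub_le => //; first exact: integrable_cst1.
  by move=> w; apply: discount_rate => //; exact: ltW.
Unshelve. all: by end_near. Qed.

End step.
End hawkes_generator.
Lemma drift_step_le (R : realType) (a x c D l g : R) :
  a + x * (l / 4) <= c -> l / 2 <= g -> 0 <= D ->
  a + (x + D) * (l / 4) <= c + D * g - l / 4 * D.
Proof.
move=> h1 h2 D0; have := ler_wpM2l D0 h2.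
have -> : D * (l / 2) = D * (l / 4) + D * (l / 4) by field.
by rewrite mulrDl (mulrC (l / 4)); lra.
Qed.

(** * The stationary intensity *)

Section long_run_average.
Context {R : realType}.
Implicit Types u g : R -> R.

(* If g stayed away from 0, then u, whose increments are those of the integral *)
(* of g, would be unbounded.                                                  *)
Lemma drift_limit_le0 u g (l : R) :
  (forall t : R, 0 <= t -> 0 <= u t <= 1) ->
  (forall K e : R, 0 < e -> exists2 delta : R, 0 < delta &
    forall t D : R, 0 <= t <= K -> 0 < D < delta ->
      u t + D * g t - e * D <= u (t + D)) ->
  g t @[t --> +oo] --> l -> l <= 0.
Proof.
move=> ub step gl; rewrite leNgt; apply/negP => l0.
have [t0 [_ ht0]] : \forall t \near +oo, l / 2 < g t.
  have l2 : l / 2 < l by rewrite ltr_pdivrMr// ltr_pMr// ltr1n.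
  exact: (cvgr_gt l).
pose t1 : R := `|t0| + 1.
have t10 : 0 < t1 by rewrite ltr_wpDl.
have t01 : t0 < t1 by rewrite (le_lt_trans (ler_norm _))// ltrDl.
have gt1 (t : R) : t1 <= t -> l / 2 < g t by move=> ?; apply: ht0; exact: lt_le_trans t01 _.
(* A slope of [l / 2] less an error of [l / 4] still leaves [l / 4], so over length 5 / l the
   function would rise by 5/4, more than [0, 1] allows. *)
pose A : R := 5 / l.
have A0 : 0 < A by rewrite divr_gt0.
have l4 : 0 < l / 4 by rewrite divr_gt0.
have [delta delta0 hd] := step (t1 + A) _ l4.
pose n := (Num.truncn (A / delta)).+1.
pose D : R := A / n%:R.
have n0 : 0 < n%:R :> R by rewrite ltr0n.
have D0 : 0 < D by rewrite divr_gt0.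
have Dd : D < delta by rewrite ltr_pdivrMr// mulrC -ltr_pdivrMr// truncnS_gt.
have ind k : (k <= n)%N -> u t1 + k%:R * D * (l / 4) <= u (t1 + k%:R * D).
  elim: k => [_|k ih kn]; first by rewrite !mul0r !addr0.
  have kD0 : 0 <= k%:R * D by rewrite mulr_ge0// ltW.
  have tk : 0 <= t1 + k%:R * D <= t1 + A.
    rewrite addr_ge0 ?(ltW t10)//= lerD2l /D mulrCA ler_piMr ?(ltW A0)//.
    by rewrite ler_pdivrMr// mul1r ler_nat ltnW.
  have := hd _ D tk; rewrite D0 Dd => /(_ isT) h.
  have -> : k.+1%:R * D = k%:R * D + D by rewrite -natr1 mulrDl mul1r.
  rewrite addrA; apply: le_trans h; apply: drift_step_le (ltW D0).
    exact: ih (ltnW kn).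
  by apply/ltW/gt1; rewrite lerDl.
have := ind n (leqnn n).
have -> : n%:R * D = A by rewrite /D mulrC divfK ?gt_eqF.
have -> : A * (l / 4) = 5 / 4 by rewrite /A; field; rewrite gt_eqF.
have /andP[a _] := ub _ (ltW t10).
have /andP[_ b] := ub (t1 + A) (addr_ge0 (ltW t10) (ltW A0)).
move: a b; move: (u _) (u _) => x y; clear; lra.
Qed.

End long_run_average.
Lemma generator_error (R : realType) (r s C e : R) : 0 < r -> 0 < s -> 0 <= C ->
  0 < e -> exists2 delta : R, 0 < delta & forall D : R, 0 < D < delta ->
    (e / 4 * D + (expR (r * D) - 1) * (C * D)) + e / 4 * D +
    5 * (expR (r * D) - 1) ^+ 2 +
    D * (4 * (expR (r * D) - 1) * expR (r * D) / s) <= e * D.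
Proof.
move=> r0 s0 C0 e0.
(* For r D <= 1/2 one has e^(r D) - 1 <= 2 r D and e^(r D) <= 2; the three summands are then the D^2
   coefficients of the three second-order errors. *)
pose Q := 2 * r * C + 20 * r ^+ 2 + 16 * r / s.
have Q0 : 0 < Q.
  rewrite ltr_wpDl ?divr_gt0 ?mulr_gt0//.
  by rewrite addr_ge0// mulr_ge0 ?sqr_ge0// mulr_ge0// ltW.
exists (Num.min (2 * r)^-1 (e / (2 * Q))).
  by rewrite lt_min invr_gt0 mulr_gt0//= divr_gt0// mulr_gt0.
move=> D /andP[D0]; rewrite lt_min => /andP[D1 D2].
have rD0 : 0 <= r * D by rewrite mulr_ge0// ltW.
have rD2 : r * D <= 2^-1.
  move: D1; rewrite -[X in _ < X]mul1r ltr_pdivlMr ?mulr_gt0// => h.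
  move: h; have -> : D * (2 * r) = 2 * (r * D) by ring.
  by move: (r * D) => x; clear; lra.
have p0 : 0 <= expR (r * D) - 1 by rewrite subr_ge0 -expR0 ler_expR.
have p1 := expR_sub1_le2 rD0 rD2.
have p2 : expR (r * D) <= 2 by move: p1 rD2; clear; lra.
set p := expR (r * D) - 1 in p0 p1 *.
have a1 : p * (C * D) <= 2 * (r * D) * (C * D).
  by rewrite ler_wpM2r// mulr_ge0// ltW.
have a2 : p ^+ 2 <= (2 * (r * D)) ^+ 2 by rewrite lerXn2r// nnegrE// mulr_ge0.
have a3 : D * (4 * p * expR (r * D) / s) <= D * (4 * (2 * (r * D)) * 2 / s).
  rewrite ler_pM2l// ler_pM2r ?invr_gt0//; apply: ler_pM => //.
  - by rewrite mulr_ge0.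
  - by rewrite ler_pM2l.
apply: (@le_trans _ _ (e / 2 * D + D * (D * Q))).
  have -> : D * (D * Q) = 2 * (r * D) * (C * D) + 5 * (2 * (r * D)) ^+ 2 +
      D * (4 * (2 * (r * D)) * 2 / s) by rewrite /Q; field; rewrite gt_eqF.
  have -> : e / 2 * D = e / 4 * D + e / 4 * D by field.
  move: a1 a2 a3; move: (p * _) (p ^+ 2) (D * _) => x y z.
  move: (2 * _ * _) (_ ^+ 2) (D * _) (e / 4 * D) => x' y' z' u; clear; lra.
have : D * Q <= e / 2.
  move: D2; rewrite ltr_pdivlMr ?mulr_gt0// => /ltW; rewrite mulrCA mulrC.
  by rewrite -ler_pdivlMr.
move=> /(ler_wpM2l (ltW D0)); rewrite (mulrC D (e / 2)); move: (D * _) => z.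
have -> : e * D = e / 2 * D + e / 2 * D by field.
by move: (e / 2 * D) => y; clear; lra.
Qed.

Lemma increment_bounds (R : realType) (a b c e : R) : `|a - b - c| <= e ->
  b + c - e <= a /\ 1 - b + - c - e <= 1 - a.
Proof. by rewrite ler_norml => /andP[h1 h2]; split; lra. Qed.

Lemma cvg_expR_comp (R : realType) (T : Type) (F : set_system T) {FF : Filter F}
    (f : T -> R) (a : R) :
  f x @[x --> F] --> a -> expR (f x) @[x --> F] --> expR a.
Proof. by move=> fa; apply: continuous_cvg => //; exact: continuous_expR. Qed.

Section stationarity.
Context {R : realType} {d : measure_display} {T : measurableType d}.
Variables (P : probability T R) (lambda r : R) (B : {RV P >-> R}).
Variables (M : R -> T -> nat) (tau Bs : nat -> {RV P >-> R}).
Hypothesis hw : hawkes lambda (exp_excitation r) B M tau Bs.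
Hypotheses (lambda_gt0 : 0 < lambda) (r_gt0 : 0 < r).
Context {d' : measure_display} {T' : measurableType d'}.
Variables (P' : probability T' R) (Lambda : {RV P' >-> R}).
Hypothesis hstat : stationary_intensity P lambda (exp_excitation r) M tau Bs Lambda.

Local Notation V := (post_intensity lambda r M tau Bs).
Local Notation L := (hawkes_intensity lambda (exp_excitation r) M tau Bs).
Local Notation beta := (mark_transform B).

Section generator.
Variable s : R.
Hypothesis s_gt0 : 0 < s.

Let u t := \int[P]_w expR (- (s * V t w)).
Let g t := (s * r - (1 - beta s)) * (\int[P]_w (V t w * expR (- (s * V t w)))) -
         s * r * lambda * u t.

Lemma generator_uniform (K e : R) : 0 < e -> exists2 delta : R, 0 < delta &
  forall t D : R, 0 <= t <= K -> 0 < D < delta ->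
    `|u (t + D) - u t - D * g t| <= e * D.
Proof.
move=> e0; have e4 : 0 < e / 4 by rewrite divr_gt0.
have [d1 d10 h1] := more_arrivals_le hw K e4.
have [d2 d20 h2] := no_arrival_bounded hw K e4.
have [C [d3 [C0 d30 h3]]] := arrival_bound hw K.
have [d4 d40 h4] := generator_error r_gt0 s_gt0 C0 e0.
exists (Num.min d1 (Num.min d2 (Num.min d3 d4))); first by rewrite !lt_min d10 d20 d30.
move=> t D tK /andP[D0]; rewrite !lt_min => /and4P[D1 D2 D3 D4].
have D0' x : D < x -> 0 < D < x by move=> ->; rewrite D0.
have /andP[t0 _] := tK.
have [IL hY] := h2 t D tK (D0' _ D2); have [_ h3'] := h3 t tK.
apply: le_trans (h4 D (D0' _ D4)).
apply: (generator_step hw lambda_gt0 r_gt0 s_gt0 t0 D0) => //.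
  exact: h1 (D0' _ D1).
exact: h3' (D0' _ D3).
Qed.

End generator.

Lemma stationary_limit (F : R -> R) (K : R) : continuous F ->
  (forall x, `|F x| <= K) ->
  \int[P]_w F (V t w) @[t --> +oo] --> \int[P']_w F (Lambda w).
Proof.
move=> cF FK; have mF := continuous_measurable_fun cF.
have := hstat cF (ex_intro _ K FK).
have mFE : measurable_fun [set: R] (fun x => (F x)%:E) by exact/measurable_EFinP.
have bI (dd : measure_display) (X : measurableType dd) (Q : probability X R)
    (Y : X -> R) : measurable_fun setT Y -> Q.-integrable setT (EFin \o (F \o Y)).
  move=> mY; apply: (@bounded_integrable _ _ _ _ _ K).
    exact: measurableT_comp.
  by move=> w /=; exact: FK.
have IL := bI _ _ P' Lambda (@measurable_funPT _ _ _ _ Lambda).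
rewrite (integral_distribution mFE IL).
have -> : (\int[P']_x ((fun x0 => (F x0)%:E) \o Lambda) x)%E =
    (\int[P']_w F (Lambda w))%:E.
  by rewrite /Rintegral fineK//; exact: integrable_fin_num.
move=> h; apply/fine_cvg; apply: cvg_trans h; apply: near_eq_cvg.
near=> t; have t0 : 0 <= t by near: t; exact: nbhs_pinfty_ge.
have mV := measurable_post hw t0.
rewrite unlock /= ; apply: ae_eq_integral => //.
- exact: (measurable_int P (bI _ _ P _ (measurable_hawkes_intensity hw t0))).
- exact: (measurable_int P (bI _ _ P _ mV)).
- near=> w; move=> _ /=; congr (F _)%:E.
  by near: w; exact: (hawkes_intensity_ae hw).
Unshelve. all: by end_near. Qed.

(** The test function 1 - e^(-(|x| - x)) is bounded, continuous, and zero exactly on [0, +oo[. Its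
    mean vanishes along [V], hence in the limit. *)
Lemma stationary_ge0 : {ae P', forall w, 0 <= Lambda w}.
Proof.
pose F (x : R) : R := 1 - expR (- (`|x| - x)).
have cF : continuous F.
  move=> x; apply: cvgB; first exact: cvg_cst.
  apply: cvg_expR_comp; apply: cvgN; apply: cvgB; last exact: cvg_id.
  by apply: cvg_norm; exact: cvg_id.
have F01 x : 0 <= F x <= 1.
  have h : 0 <= `|x| - x by rewrite subr_ge0 ler_norm.
  by rewrite /F subr_ge0 expRN_le1//= gerBl expR_ge0.
have F1 := norm_unit_interval F01.
have h := stationary_limit cF F1.
have h0 : \int[P']_w F (Lambda w) = 0.
  rewrite -(cvg_lim (@Rhausdorff R) h).
  rewrite (_ : (fun t => \int[P]_w F (V t w)) = fun=> 0); first exact: lim_cst.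
  apply/funext => t; rewrite -[RHS](Rintegral_cst1 P 0); apply: eq_Rintegral => w _.
  have v0 : 0 <= V t w.
    exact: le_trans (ltW lambda_gt0) (post_intensity_ge lambda r M tau Bs t w).
  by rewrite /F ger0_norm// subrr oppr0 expR0 subrr.
have mF : measurable_fun setT (fun w => (F (Lambda w))%:E).
  by apply/measurable_EFinP/measurableT_comp => //; exact: continuous_measurable_fun.
have IF : P'.-integrable setT (fun w => (F (Lambda w))%:E).
  apply: (@bounded_integrable _ _ _ _ (F \o Lambda) 1); first exact/measurable_EFinP.
  by move=> w; exact: F1.
have abs0 : (\int[P']_w `|(F (Lambda w))%:E| = 0)%E.
  rewrite (eq_integral (fun w => (F (Lambda w))%:E)); last first.
    by move=> w _; rewrite gee0_abs// lee_fin; have /andP[] := F01 (Lambda w).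
  by move: (congr1 EFin h0); rewrite /Rintegral fineK//; exact: integrable_fin_num.
have /(_ measurableT _ mF) [/(_ abs0) h1 _] := @ae_eq_integral_abs _ _ _ P' setT.
near=> w; have Fw : (F (Lambda w))%:E = 0%E by near: w; apply: filterS h1 => w; exact.
apply/normr_idP/eqP; rewrite eq_le ler_norm andbT -subr_le0.
move: Fw => /eqP; rewrite eqe subr_eq0 eq_sym => /eqP Fw.
have := expR_ge1Dx (- - (`|Lambda w| - Lambda w)).
by rewrite expRN Fw invr1 opprK gerDl.
Unshelve. all: by end_near. Qed.

(** The test function [F] is the generator applied to e^(-s x), extended to the line through |x|. It
    is bounded since |x| e^(-s |x|) <= 1/s, so convergence in law alone passes to the limit. *)
Lemma stationary_identity (s : R) : 0 < s ->
  (s * r - (1 - beta s)) * \int[P']_w (`|Lambda w| * expR (- (s * `|Lambda w|))) =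
  s * r * lambda * \int[P']_w expR (- (s * `|Lambda w|)).
Proof.
move=> s0.
pose c := s * r - (1 - beta s).
pose F (x : R) : R := c * (`|x| * expR (- (s * `|x|))) - s * r * lambda * expR (- (s * `|x|)).
have ce : continuous (fun x : R => expR (- (s * `|x|))).
  by move=> x; apply: cvg_expR_comp; apply: cvgN; apply: cvgMr; apply: cvg_norm; exact: cvg_id.
have cxe : continuous (fun x : R => `|x| * expR (- (s * `|x|))).
  by move=> x; apply: cvgM; [by apply: cvg_norm; exact: cvg_id|exact: ce].
have cF : continuous F.
  by move=> x; apply: cvgB; apply: cvgMr; [exact: cxe|exact: ce].
have e1 (x : R) : `|expR (- (s * `|x|))| <= 1.
  by rewrite ger0_norm ?expR_ge0// expRN_le1// mulr_ge0// ltW.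
have xe1 (x : R) : `| `|x| * expR (- (s * `|x|))| <= s^-1.
  rewrite ger0_norm; last by rewrite mulr_ge0// expR_ge0.
  rewrite -(ler_pM2l s0) divff ?gt_eqF// mulrA; exact: mul_expRN_le1.
have srl : 0 <= s * r * lambda by rewrite !mulr_ge0// ltW.
have FK x : `|F x| <= `|c| * s^-1 + s * r * lambda.
  rewrite /F (le_trans (ler_normB _ _))// (normrM c) (normrM (s * r * lambda)).
  by apply: lerD; [rewrite ler_wpM2l|rewrite (ger0_norm srl) ler_piMr].
have h := stationary_limit cF FK.
have split (dd : measure_display) (X : measurableType dd) (Q : probability X R) (Y : X -> R) :
    measurable_fun setT Y -> \int[Q]_w F (Y w) =
    c * \int[Q]_w (`|Y w| * expR (- (s * `|Y w|))) -
    s * r * lambda * \int[Q]_w expR (- (s * `|Y w|)).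
  move=> mY.
  have I1 : Q.-integrable setT (EFin \o (fun w => `|Y w| * expR (- (s * `|Y w|)))).
    apply: (@bounded_integrable _ _ _ _ _ (s^-1)) => //.
    by apply: (measurableT_comp (f := fun x : R => `|x| * expR (- (s * `|x|)))) => //;
      exact: continuous_measurable_fun.
  have I2 : Q.-integrable setT (EFin \o (fun w => expR (- (s * `|Y w|)))).
    apply: (@bounded_integrable _ _ _ _ _ 1) => //.
    by apply: (measurableT_comp (f := fun x : R => expR (- (s * `|x|)))) => //;
      exact: continuous_measurable_fun.
  rewrite /F RintegralB//; [|exact: integrable_mulr..].
  by rewrite !RintegralZl.
apply/eqP; rewrite -subr_eq0 -/c -split//; apply/eqP.
pose g t := \int[P]_w F (V t w).
pose u t := \int[P]_w expR (- (s * V t w)).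
have V0 t w : 0 <= V t w.
  exact: le_trans (ltW lambda_gt0) (post_intensity_ge lambda r M tau Bs t w).
have gE t : 0 <= t -> g t = c * \int[P]_w (V t w * expR (- (s * V t w))) -
    s * r * lambda * u t.
  move=> t0; rewrite /g split; last exact: (measurable_post hw).
  by congr (_ * _ - _ * _); apply: eq_Rintegral => w _; rewrite ger0_norm.
have u01 (t : R) : 0 <= t -> 0 <= u t <= 1.
  move=> t0; rewrite Rintegral_ge0 => [|w _]; last exact: expR_ge0.
  have := @le_bound_Rintegral _ _ _ P (fun w => expR (- (s * V t w))) 1.
  rewrite ler_norml => H; suff /andP[] : -1 <= u t <= 1 by [].
  apply: H => [|w].
    apply: (measurableT_comp (f := fun x : R => expR (- (s * x)))).
      apply: measurableT_comp; first exact: measurable_expR.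
      by apply: measurable_funN; exact: measurable_funM.
    exact: (measurable_post hw).
  by rewrite ger0_norm ?expR_ge0// expRN_le1// mulr_ge0// ltW.
have step (K e : R) : 0 < e -> exists2 delta : R, 0 < delta &
    forall t D : R, 0 <= t <= K -> 0 < D < delta -> `|u (t + D) - u t - D * g t| <= e * D.
  move=> e0; have [delta delta0 hd] := generator_uniform s0 K e0.
  exists delta => // t D tK Dd; rewrite gE; first exact: hd.
  by case/andP: tK.
apply/eqP; rewrite eq_le; apply/andP; split.
  apply: (drift_limit_le0 u01 _ h) => K e e0; have [delta delta0 hd] := step K e e0.
  by exists delta => // t D tK Dd; have [] := increment_bounds (hd t D tK Dd).
(* The opposite sign comes from 1 - u, which also stays in [0, 1] and has drift - g. *)
rewrite -oppr_le0.
have h' : (- g t) @[t --> +oo] --> - \int[P']_w F (Lambda w) by apply: cvgN.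
apply: (@drift_limit_le0 _ (fun t => 1 - u t) _ _ _ _ h').
  by move=> t t0; have /andP[a b] := u01 t t0; rewrite subr_ge0 b/= gerBl.
move=> K e e0; have [delta delta0 hd] := step K e e0.
by exists delta => // t D tK Dd; rewrite mulrN; have [] := increment_bounds (hd t D tK Dd).
Qed.

End stationarity.
(** * Laplace transforms and convergence in law *)

Section bernstein.
Context {R : realType}.
Implicit Types (f g : nat -> R) (x : R).

(* De Casteljau's recursion for the Bernstein polynomials. *)
Fixpoint bernstein (n : nat) f : {poly R} :=
  if n is m.+1 then 'X * bernstein m (fun k => f k.+1) + (1 - 'X) * bernstein m f
  else (f 0%N)%:P.

Lemma bernsteinS n f x : (bernstein n.+1 f).[x] =
  x * (bernstein n (fun k => f k.+1)).[x] + (1 - x) * (bernstein n f).[x].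
Proof. by rewrite /= !hornerE. Qed.

Lemma bernstein_le n f g x : 0 <= x <= 1 -> (forall k, (k <= n)%N -> f k <= g k) ->
  (bernstein n f).[x] <= (bernstein n g).[x].
Proof.
move=> /andP[x0 x1]; elim: n f g => [|n ih] f g fg.
  by rewrite /= !hornerE; exact: fg.
rewrite !bernsteinS; apply: lerD; rewrite ler_wpM2l ?subr_ge0// ih// => k kn.
  exact: fg.
by apply: fg; exact: leqW.
Qed.

Lemma bernsteinD n f g x : (bernstein n (fun k => f k + g k)).[x] =
  (bernstein n f).[x] + (bernstein n g).[x].
Proof.
elim: n f g => [|n ih] f g; first by rewrite /= !hornerE.
by rewrite !bernsteinS !ih; ring.
Qed.

Lemma bernsteinZ n c f x :
  (bernstein n (fun k => c * f k)).[x] = c * (bernstein n f).[x].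
Proof.
elim: n f => [|n ih] f; first by rewrite /= !hornerE.
by rewrite !bernsteinS !ih; ring.
Qed.

Lemma bernstein_cst n c x : (bernstein n (fun=> c)).[x] = c.
Proof.
elim: n => [|n ih]; first by rewrite /= hornerE.
by rewrite bernsteinS ih; ring.
Qed.

(** The second moment of a shifted binomial variable; c = - n x gives its variance. The free shift
    [c] carries the induction, since passing from k to k + 1 replaces c by c + 1. *)
Lemma bernstein_sqr n c x : (bernstein n (fun k => (k%:R + c) ^+ 2)).[x] =
  n%:R * x * (1 - x) + (n%:R * x + c) ^+ 2.
Proof.
elim: n c => [|n ih] c; first by rewrite /= hornerE; ring.
rewrite bernsteinS ih.
have -> : (bernstein n (fun k => (k.+1%:R + c) ^+ 2)).[x] =
    (bernstein n (fun k => (k%:R + (c + 1)) ^+ 2)).[x].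
  by congr (bernstein n _).[x]; apply/funext => k; rewrite -natr1; congr (_ ^+ 2); ring.
by rewrite ih -natr1; ring.
Qed.

Lemma heine01 (h : R -> R) (e : R) : continuous h -> 0 < e ->
  exists2 delta : R, 0 < delta & forall x y : R, 0 <= x <= 1 ->
    `|x - y| < delta -> `|h x - h y| < e.
Proof.
move=> ch e0.
pose P (delta x : R) := forall y : R, `|x - y| < delta -> `|h x - h y| < e.
have nc : \forall delta \near (0 : R)^'+, `[0, 1]%classic `<=` P delta.
  apply: (compact_near_coveringP _).1 (@segment_compact R 0 1) _ _ _ _ _ => x _.
  have e2 : 0 < e / 2 by rewrite divr_gt0.
  have /cvgrPdist_lt /(_ _ e2) := ch x.
  move=> /nbhs_ballP[rho /= rho0 hr].
  have r2 : 0 < rho / 2 by rewrite divr_gt0.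
  (* One half of the radius is spent on the move within the compact set, the other on the distance
     to [y], which may leave [0, 1]. *)
  exists (ball x (rho / 2), [set delta : R | delta < rho / 2]).
    by split; [exact: nbhsx_ballx|exact: nbhs_right_lt].
  move=> [x' delta] [/= xx' dr] y xy.
  have h1 : `|h x - h x'| < e / 2.
    apply: hr; apply: lt_trans xx' _; rewrite ltr_pdivrMr// ltr_pMr// ltr1n//.
  have h2 : `|h x - h y| < e / 2.
    apply: hr; rewrite /ball/= (splitr rho).
    rewrite -(subrKA x') (le_lt_trans (ler_normD _ _))// ltrD//.
    exact: lt_trans dr.
  rewrite -(subrKA (h x)) (splitr e) (le_lt_trans (ler_normD _ _))// ltrD//.
  by rewrite distrC.
have [delta [delta0 hd]] := filter_ex (filterI (@nbhs_right_gt R 0) nc).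
by exists delta => // x y x01 xy; apply: (hd x).
Qed.

(** Chebyshev's argument in deterministic form: the error at each node is dominated by a constant
    plus a multiple of the squared distance, and [bernstein_le] carries this bound through the
    Bernstein operator, where the square becomes a variance of order 1/n. *)
Lemma weierstrass01 (h : R -> R) (K e : R) : continuous h ->
  (forall x : R, 0 <= x <= 1 -> `|h x| <= K) -> 0 < e ->
  exists p : {poly R}, forall x : R, 0 <= x <= 1 -> `|h x - p.[x]| <= e.
Proof.
move=> ch hK e0.
have e2 : 0 < e / 2 by rewrite divr_gt0.
have [delta delta0 hd] := heine01 ch e2.
have K0 : 0 <= K by rewrite (le_trans _ (hK 0 _))// lexx ler01.
(* At nodes farther than [delta] from x, C times the squared distance exceeds 2 K, the trivial bound
   on the difference. *)
pose C := 2 * K / delta ^+ 2.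
have C0 : 0 <= C by rewrite divr_ge0 ?sqr_ge0// mulr_ge0.
pose n := (Num.truncn (C / (e / 2))).+1.
have n0 : 0 < n%:R :> R by rewrite ltr0n.
have Cn : C / n%:R <= e / 2.
  by rewrite ler_pdivrMr// mulrC -ler_pdivrMr// ltW// truncnS_gt.
exists (bernstein n (fun k => h (k%:R / n%:R))) => x x01.
have /andP[x0 x1] := x01.
have key k : (k <= n)%N -> `|h x - h (k%:R / n%:R)| <=
    e / 2 + C / n%:R ^+ 2 * (k%:R + (- (n%:R * x))) ^+ 2.
  move=> kn; have k01 : 0 <= (k%:R / n%:R : R) <= 1.
    by apply/andP; split; [exact: divr_ge0|rewrite ler_pdivrMr// mul1r ler_nat].
  have -> : C / n%:R ^+ 2 * (k%:R - n%:R * x) ^+ 2 = C * (k%:R / n%:R - x) ^+ 2.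
    by field; rewrite gt_eqF.
  have [close|far] := ltP `|x - k%:R / n%:R| delta.
    by apply: ler_wpDr; [rewrite mulr_ge0 ?sqr_ge0|exact/ltW/hd].
  apply: ler_wpDl; first exact: ltW.
  apply: (@le_trans _ _ (2 * K)).
    apply: (le_trans (ler_normB _ _)); have -> : 2 * K = K + K by ring.
    by apply: lerD; exact: hK.
  rewrite /C -mulrA ler_peMr ?mulr_ge0// mulrC ler_pdivlMr ?exprn_gt0// mul1r.
  by rewrite -[leRHS]real_normK ?num_real// distrC lerXn2r// nnegrE// ltW.
pose g (k : nat) : R := e / 2 + C / n%:R ^+ 2 * (k%:R + (- (n%:R * x))) ^+ 2.
have bound : (bernstein n g).[x] <= e.
  rewrite /g bernsteinD bernstein_cst bernsteinZ bernstein_sqr subrr expr0n/= addr0.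
  rewrite [leRHS](splitr e) lerD2l.
  apply: le_trans Cn.
  have -> : C / n%:R ^+ 2 * (n%:R * x * (1 - x)) = C / n%:R * (x * (1 - x)).
    by field; rewrite gt_eqF.
  have n1x : 0 <= 1 - x <= 1 by rewrite subr_ge0 x1 gerBl.
  have /andP[a b] := n1x; apply: ler_piMr; last exact: mulr_ile1.
  by rewrite divr_ge0// ltW.
have up : (bernstein n (fun k => h (k%:R / n%:R))).[x] <= h x + (bernstein n g).[x].
  rewrite -[X in X + _](bernstein_cst n _ x) -bernsteinD.
  apply: bernstein_le => // k kn; have := key k kn.
  by rewrite distrC => /(le_trans (ler_norm _)); rewrite lerBlDl.
have low : h x <= (bernstein n (fun k => h (k%:R / n%:R))).[x] + (bernstein n g).[x].
  rewrite -[leLHS](bernstein_cst n _ x) -bernsteinD.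
  apply: bernstein_le => // k kn; have := key k kn.
  by move=> /(le_trans (ler_norm _)); rewrite lerBlDl.
rewrite ler_distlC; apply/andP; split.
  by rewrite lerBlDr (le_trans low)// lerD2l.
by rewrite (le_trans up)// lerD2l.
Qed.

End bernstein.
(** Here [a], [b] are the means of f under two laws, [p], [q] those of the polynomial and [u], [v]
    those of e^(-c x). Only [u] is known to be near 1; [v] inherits this at the cost of another [n],
    whence the factor 3. *)
Lemma approximation_split (R : realType) (a b p q u v K n : R) : 0 <= K ->
  `|a - p| <= K * (1 - u) + n -> `|b - q| <= K * (1 - v) + n -> 1 - u <= n ->
  `|p - q| <= n -> `|u - v| <= n -> `|a - b| <= 3 * (K + 1) * n.
Proof.
move=> K0 h1 h2 h3 h4 h5.
have h6 : K * (1 - u) <= K * n by rewrite ler_wpM2l.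
have h7 : 1 - v <= n + n by move: h5 h3; rewrite ler_norml => /andP[_]; clear; lra.
have h8 : K * (1 - v) <= K * (n + n) by rewrite ler_wpM2l.
rewrite (_ : a - b = (a - p) + (p - q) + (q - b)); last by ring.
apply: (le_trans (ler_normD _ _)); rewrite (distrC q).
have := ler_normD (a - p) (p - q).
rewrite [X in _ <= X]mulrDr in h8; rewrite (_ : 3 * (K + 1) * n = 3 * (K * n) + 3 * n); last by ring.
by move: h1 h2 h6 h8; move: (K * n) (K * (1 - u)) (K * (1 - v)) => *; lra.
Qed.

Section laplace_transform.
Context {R : realType}.

Section one_law.
Context {d : measure_display} {T : measurableType d} (P : probability T R).
Variable X : T -> R.
Hypotheses (mX : measurable_fun setT X) (X0 : forall w, 0 <= X w).

Lemma expRN_itv (s : R) w : 0 <= s -> 0 <= expR (- (s * X w)) <= 1.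
Proof. by move=> s0; rewrite expR_ge0 expRN_le1// mulr_ge0. Qed.

Lemma measurable_expRN (s : R) : measurable_fun setT (fun w => expR (- (s * X w))).
Proof.
apply: measurableT_comp; first exact: measurable_expR.
by apply: measurable_funN; exact: measurable_funM.
Qed.

Lemma integrable_expRN (s : R) : 0 <= s ->
  P.-integrable setT (EFin \o (fun w => expR (- (s * X w)))).
Proof.
move=> s0; apply: (bounded_integrable P (measurable_expRN s) (K := 1)).
by apply: norm_unit_interval => w; exact: expRN_itv.
Qed.

Lemma laplace_itv (s : R) : 0 <= s -> 0 <= \int[P]_w expR (- (s * X w)) <= 1.
Proof.
move=> s0; rewrite Rintegral_ge0 => [|w _]; last exact: expR_ge0.
have := le_bound_Rintegral P (measurable_expRN s) (norm_unit_interval (fun w => expRN_itv w s0)).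
by rewrite ler_norml => /andP[].
Qed.

Lemma laplace_cvg0 (u : nat -> R) : (forall n, 0 <= u n) -> u n @[n --> \oo] --> 0 ->
  \int[P]_w expR (- (u n * X w)) @[n --> \oo] --> (1 : R).
Proof.
move=> u0 ucv.
have mf n : measurable_fun setT (fun w => (expR (- (u n * X w)))%:E).
  by apply/measurable_EFinP; exact: measurable_expRN.
have [//||||_ _] := @dominated_convergence _ _ _ P setT measurableT
  (fun n w => (expR (- (u n * X w)))%:E) (cst 1%:E) (cst 1%:E) mf.
- apply: aeW => w _; apply: cvg_EFin; first exact: nearW.
  rewrite -[X in _ --> X](expR0); apply: cvg_expR_comp.
  by rewrite -oppr0; apply: cvgN; rewrite -(mul0r (X w)); apply: cvgMl.
- exact: (integrable_cst1 P 1).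
- apply: aeW => w n _; rewrite lee_fin.
  by have /andP[a b] := expRN_itv w (u0 n); rewrite ger0_norm.
have -> : (\int[P]_w (cst 1%:E) w = 1%:E)%E.
  by rewrite integral_cst// mul1e; exact: probability_setT.
exact: fine_cvg.
Qed.

Lemma laplace_near0 (e : R) : 0 < e -> exists2 c : R, 0 < c &
  1 - \int[P]_w expR (- (c * X w)) <= e.
Proof.
move=> e0.
have u0 (n : nat) : 0 <= harmonic n :> R by rewrite /= invr_ge0.
have /cvgrPdist_le/(_ e e0) [N _ /(_ N (leqnn N))] := laplace_cvg0 u0 cvg_harmonic.
move=> /= h; exists N.+1%:R^-1; first by rewrite invr_gt0.
by rewrite (le_trans (ler_norm _)).
Qed.

Lemma laplace_poly (p : {poly R}) (c : R) : 0 <= c ->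
  \int[P]_w p.[expR (- (c * X w))] =
  \sum_(i < size p) p`_i * \int[P]_w expR (- ((c *+ i) * X w)).
Proof.
move=> c0.
have I (i : nat) := integrable_mulr p`_i (integrable_expRN (mulrn_wge0 i c0)).
rewrite /Rintegral.
under eq_integral => w _.
  rewrite horner_coef -sumEFin.
  under eq_bigr => i _.
    rewrite (_ : expR _ ^+ i = expR (- ((c *+ i) * X w))); last first.
      by rewrite -expRM_natl; congr expR; rewrite -[c *+ i]mulr_natr; ring.
    over.
  over.
rewrite integral_sum//=; last by move=> i; exact: I.
have E (i : nat) : (\int[P]_w (p`_i * expR (- ((c *+ i) * X w)))%:E =
    (p`_i * \int[P]_w expR (- ((c *+ i) * X w)))%:E)%E.
  rewrite -RintegralZl//; last exact: (integrable_expRN (mulrn_wge0 i c0)).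
  by rewrite /Rintegral fineK//; apply: integrable_fin_num => //; exact: I.
by under eq_bigr => i _ do rewrite E; rewrite sumEFin.
Qed.

(** Split f = f (1 - e^(-c x)) + f e^(-c x): the first part costs at most K (1 - e^(-c x)), and the
    polynomial approximates the second. *)
Lemma damped_approx (f : R -> R) (K e c : R) (p : {poly R}) :
  measurable_fun setT f -> (forall x, `|f x| <= K) -> 0 < c -> 0 <= e ->
  (forall x, 0 <= x -> `|f x * expR (- (c * x)) - p.[expR (- (c * x))]| <= e) ->
  `|\int[P]_w f (X w) - \int[P]_w p.[expR (- (c * X w))]|
  <= K * (1 - \int[P]_w expR (- (c * X w))) + e.
Proof.
move=> mf fK c0 e0 fp; have c0' := ltW c0.
have K0 : 0 <= K by exact: le_trans (fK 0).
have IfX : P.-integrable setT (EFin \o (fun w => f (X w))).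
  apply: (@bounded_integrable _ _ _ _ _ K) => //.
  exact: measurableT_comp.
have Ie := integrable_expRN c0'.
have Ip : P.-integrable setT (EFin \o (fun w => p.[expR (- (c * X w))])).
  apply: (@bounded_integrable _ _ _ _ _ (K + e)).
    apply: (@measurableT_comp _ _ _ _ _ _ (fun x => p.[x])).
      by apply: continuous_measurable_fun; exact: continuous_horner.
    exact: measurable_expRN.
  move=> w; have /andP[a b] := expRN_itv w c0'.
  have := fp (X w) (X0 w); rewrite distrC => h.
  rewrite -[X in `|X|](subrK (f (X w) * expR (- (c * X w)))).
  rewrite (le_trans (ler_normD _ _))// addrC lerD// normrM (ger0_norm a).
  by rewrite (le_trans _ (fK (X w)))// ler_piMr.
have I1 : P.-integrable setT (EFin \o (fun w => 1 - expR (- (c * X w)))).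
  by apply: integrable_subr => //; exact: integrable_cst1.
have -> : K * (1 - \int[P]_w expR (- (c * X w))) + e =
    \int[P]_w (K * (1 - expR (- (c * X w))) + e).
  rewrite RintegralD//; [|exact: integrable_mulr|exact: integrable_cst1].
  rewrite Rintegral_cst1 RintegralZl// RintegralB//; last exact: integrable_cst1.
  by rewrite Rintegral_cst1.
apply: Rintegral_sub_le => //.
  by apply: integrable_addr; [exact: integrable_mulr|exact: integrable_cst1].
move=> w; have /andP[a b] := expRN_itv w c0'.
rewrite (_ : f (X w) - _ = f (X w) * (1 - expR (- (c * X w))) +
  (f (X w) * expR (- (c * X w)) - p.[expR (- (c * X w))])); last by ring.
rewrite (le_trans (ler_normD _ _))// lerD ?fp//.
by rewrite normrM (@ger0_norm _ (1 - _)) ?subr_ge0// ler_wpM2r ?subr_ge0.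
Qed.

End one_law.
(* At y = 0 the conventional value ln 0 = 0 is harmless: f is bounded and the  *)
(* factor |y| vanishes.                                                       *)
Lemma damped_continuous (f : R -> R) (K c : R) : continuous f ->
  (forall x, `|f x| <= K) -> continuous (fun y : R => f (- ln `|y| / c) * `|y|).
Proof.
move=> cf fK y; have K0 : 0 <= K by exact: le_trans (fK 0).
have nc : `|z| @[z --> y] --> `|y| by apply: cvg_norm; exact: cvg_id.
have [->|y0] := eqVneq y 0.
  apply/cvgrPdist_lt => e e0; rewrite normr0 mulr0.
  have K1 : 0 < K + 1 by rewrite ltr_wpDl.
  have e1 : \forall z \near (0 : R), `|z| < e / (K + 1).
    by apply: nbhs0_lt; rewrite divr_gt0.
  near=> z; rewrite sub0r normrN normrM normr_id.
  apply: (@le_lt_trans _ _ ((K + 1) * `|z|)).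
    by rewrite ler_wpM2r// (le_trans (fK _))// lerDl.
  rewrite mulrC -ltr_pdivlMr//.
  by near: z.
apply: cvgM => //; apply: continuous_cvg; first exact: cf.
apply: cvgMl; apply: cvgN; apply: continuous_cvg => //.
by apply: continuous_ln; rewrite normr_gt0.
Unshelve. all: by end_near. Qed.

(* With y = exp (-c x), f(x) exp (-c x) is a continuous function of y in [0, 1],*)
(* hence uniformly close to a polynomial in y, whose mean is a combination of *)
(* values of the Laplace transform; exp (-c x) is close to 1 in mean when c is *)
(* small.                                                                     *)
Lemma laplace_continuity (I : Type) (F : set_system I) {FF : Filter F}
    (d : I -> measure_display) (T : forall i, measurableType (d i))
    (P : forall i, probability (T i) R) (X : forall i, T i -> R)
    (d' : measure_display) (T' : measurableType d') (Q : probability T' R)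
    (Y : T' -> R) (f : R -> R) (K : R) :
  (forall i, measurable_fun setT (X i)) ->
  (\forall i \near F, forall w, 0 <= X i w) ->
  measurable_fun setT Y -> (forall w, 0 <= Y w) ->
  (forall s : R, 0 < s -> \int[P i]_w expR (- (s * X i w)) @[i --> F] -->
    \int[Q]_w expR (- (s * Y w))) ->
  continuous f -> (forall x, `|f x| <= K) ->
  \int[P i]_w f (X i w) @[i --> F] --> \int[Q]_w f (Y w).
Proof.
move=> mX X0 mY Y0 lap cf fK.
have K0 : 0 <= K by exact: le_trans (fK 0).
have mf := continuous_measurable_fun cf.
apply/cvgrPdist_le => e e0.
pose n : R := e / (3 * (K + 1)).
have K1 : 0 < K + 1 by rewrite ltr_wpDl.
have n0 : 0 < n by rewrite divr_gt0// mulr_gt0.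
have [c c0 hc] := laplace_near0 Q mY Y0 n0.
have hK (y : R) : 0 <= y <= 1 -> `|f (- ln `|y| / c) * `|y| | <= K.
  move=> /andP[y0 y1]; rewrite normrM normr_id (le_trans _ (fK (- ln `|y| / c)))//.
  by rewrite ler_piMr// ger0_norm.
have [p hp] := weierstrass01 (damped_continuous (c := c) cf fK) hK n0.
have fp (x : R) : 0 <= x -> `|f x * expR (- (c * x)) - p.[expR (- (c * x))]| <= n.
  move=> x0; have := hp (expR (- (c * x))).
  rewrite expR_ge0 expRN_le1 ?mulr_ge0 ?(ltW c0)// => /(_ isT).
  rewrite (ger0_norm (expR_ge0 _)) expRK opprK.
  by rewrite mulrAC divff ?gt_eqF// mul1r.
have hY := damped_approx Q mY Y0 mf fK c0 (ltW n0) fp.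
have polcv : \int[P i]_w p.[expR (- (c * X i w))] @[i --> F] -->
    \int[Q]_w p.[expR (- (c * Y w))].
  rewrite (laplace_poly Q mY Y0 p (ltW c0)).
  apply: (@cvg_trans _ ((fun i => \sum_(k < size p)
      p`_k * \int[P i]_w expR (- ((c *+ k) * X i w))) @ F)).
    apply: near_eq_cvg; near=> i; apply/esym; apply: laplace_poly => //; last exact: ltW.
    by near: i.
  apply: cvg_big => [|k _]; first exact: add_continuous.
  apply: cvgMr.
  (* The constant coefficient involves the transform at 0, which the hypothesis on s > 0 does not
     cover; it equals 1 for every law. *)
  case: k => -[|k] kp /=.
    have Z (dd : measure_display) (S : measurableType dd) (Q' : probability S R)
        (W : S -> R) : \int[Q']_w expR (- ((c *+ 0) * W w)) = 1.
      rewrite -[RHS](Rintegral_cst1 Q' 1).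
      by apply: eq_Rintegral => w _; rewrite mulr0n mul0r oppr0 expR0.
    by rewrite Z; under eq_cvg do rewrite Z; exact: cvg_cst.
  by apply: lap; rewrite pmulrn_rgt0.
move/cvgrPdist_le/(_ n n0) : polcv => polcv.
have /cvgrPdist_le/(_ n n0) lapc := lap c c0.
near=> i.
have Xi0 : forall w, 0 <= X i w by near: i.
have hX := damped_approx (P i) (mX i) Xi0 mf fK c0 (ltW n0) fp.
have h1 : `|\int[Q]_w p.[expR (- (c * Y w))] - \int[P i]_w p.[expR (- (c * X i w))]| <= n.
  by near: i.
have h2 : `|\int[Q]_w expR (- (c * Y w)) - \int[P i]_w expR (- (c * X i w))| <= n.
  by near: i.
have -> : e = 3 * (K + 1) * n by rewrite /n mulrC divfK// gt_eqF// mulr_gt0.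
exact: (approximation_split K0 hY hX hc h1 h2).
Unshelve. all: by end_near. Qed.

End laplace_transform.
(** * The Gamma law *)

(** The function [g] has the same integrals over measurable sets as the Radon-Nikodym derivative,
    hence equals it almost everywhere. *)
Lemma integral_density (R : realType) (d : measure_display) (T : measurableType d)
    (mu : {sigma_finite_measure set T -> \bar R}) (nu : probability T R)
    (g : T -> R) (f : T -> \bar R) :
  mu.-integrable setT (EFin \o g) ->
  (forall A, measurable A -> nu A = \int[mu]_(x in A) (g x)%:E)%E ->
  nu.-integrable setT f ->
  (\int[nu]_x f x = \int[mu]_x (f x * (g x)%:E))%E.
Proof.
move=> Ig nuE If.
have dom : nu `<< mu.
  apply/null_content_dominatesP => A mA muA0; rewrite nuE// null_set_integral//.
  exact/measurable_funTS/(measurable_int mu Ig).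
rewrite -(Radon_Nikodym_change_of_variables dom)//.
have mf := measurable_int nu If.
have mg := measurable_int mu Ig.
apply: ae_eq_integral => //; [|exact: emeasurable_funM|].
  exact: emeasurable_funM.
apply: ae_eqe_mul2l; apply: integral_ae_eq => //.
  exact: Radon_Nikodym_integrable.
by move=> E _ mE; rewrite -Radon_Nikodym_integral//= nuE.
Qed.

Section scaling.
Context {R : realType}.
Local Notation mu := (@lebesgue_measure R).

Let scale (c : R) (x : measurableTypeR R) : measurableTypeR R := c * x.

Let mscale_fun c : measurable_fun [set: measurableTypeR R] (scale c).
Proof. exact: mulrl_measurable. Qed.

(** Lebesgue measure is c times its image under x -> c x, because the two agree on the intervals ]a,
    b]. *)
Lemma ge0_integral_scale (c : R) (f : R -> \bar R) : 0 < c ->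
  measurable_fun [set: R] f -> (forall x, 0 <= f x)%E ->
  (\int[mu]_x f x = c%:E * \int[mu]_x f (c * x)%R)%E.
Proof.
move=> c0 mf f0.
have [m mE] : exists m : {measure set (measurableTypeR R) -> \bar R},
    m = pushforward mu (scale c) :> (set _ -> _).
  unshelve (eexists; reflexivity); exact: mscale_fun.
have lebE A : measurable A -> mu A = mscale (NngNum (ltW c0)) m A.
  move=> mA; apply: lebesgue_measure_unique => //= _ [[a b]] _ <-.
  rewrite /mscale mE /pushforward /=.
  have -> : scale c @^-1` `]a, b] = `]a / c, b / c]%classic.
    by apply/seteqP; split => x /=; rewrite !in_itv/= /scale ltr_pdivrMr// ler_pdivlMr// mulrC.
  rewrite !lebesgue_measure_itv/= !lte_fin ltr_pM2r ?invr_gt0//.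
  case: ifPn => _; last by rewrite mule0.
  by rewrite -!EFinB -EFinM -mulrBl mulrC divfK// gt_eqF.
rewrite (@eq_measure_integral _ _ _ setT (mscale (NngNum (ltW c0)) m)); last first.
  by move=> A mA _; exact: lebE.
rewrite ge0_integral_mscale//; congr (_ * _)%E.
by rewrite mE ge0_integral_pushforward.
Qed.

End scaling.

Lemma exponent_le (R : realType) (A B x q : R) : A <= B -> B <= x / 2 + q ->
  A + - x <= q + - (x / 2).
Proof. by move=> *; lra. Qed.

Section gamma_function.
Context {R : realType}.
Local Notation mu := (@lebesgue_measure R).
Variable a : R.
Hypothesis a0 : 0 < a.

Let k (x : R) : R := (x `^ (a - 1) * expR (- x)).

Let mk : measurable_fun [set: R] k.
Proof.
apply: measurable_funM; first exact: measurable_powR.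
by apply: measurableT_comp; [exact: measurable_expR|exact: measurable_funN].
Qed.

Let k0 x : 0 <= k x. Proof. by rewrite mulr_ge0 ?powR_ge0 ?expR_ge0. Qed.

Lemma integral_powR_le (e : R) : 0 < e -> e < 1 ->
  (\int[mu]_(x in `[e, 1%R]) (x `^ (a - 1))%:E <= (a^-1)%:E)%E.
Proof.
move=> e0 e1.
have cp (b x : R) : 0 < x -> {for x, continuous (fun y => y `^ b)}.
  move=> x0; apply: differentiable_continuous; apply/derivable1_diffP.
  by apply: derivable_powR; rewrite in_itv/= x0.
rewrite (@continuous_FTC2 _ _ (fun x => a^-1 * x `^ a))//.
- rewrite powR1 mulr1 -EFinB lee_fin gerBl.
  by rewrite mulr_ge0 ?powR_ge0// invr_ge0 ltW.
- apply: continuous_in_subspaceT => x; rewrite inE/= in_itv/= => /andP[ex _].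
  by apply: cp; exact: lt_le_trans ex.
- split.
  + move=> x; rewrite in_itv/= => /andP[ex _]; apply: derivableM => //.
    by apply: derivable_powR; rewrite in_itv/= andbT (lt_trans e0).
  + by apply: cvgMr; apply: cvg_at_right_filter; exact: cp.
  + by apply: cvgMr; apply: cvg_at_left_filter; exact: cp.
- move=> x; rewrite in_itv/= => /andP[ex _]; have x0 := lt_trans e0 ex.
  rewrite derive1E deriveZ /=; last by apply: derivable_powR; rewrite in_itv/= x0.
  by have [_ ->] := is_derive1_powR a x0; rewrite /GRing.scale/= mulKf ?gt_eqF.
Qed.

Lemma integral_gamma01 : (\int[mu]_(x in `]0%R, 1%R]) (k x)%:E <= (a^-1)%:E)%E.
Proof.
(* The kernel may be singular at 0, so ]0, 1] is exhausted from the right; starting at 1/2 meets the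
   condition e < 1 of [integral_powR_le], whose bound is uniform in e. *)
pose D (n : nat) : set R := `[n.+2%:R^-1, 1]%classic.
have -> : `]0%R, 1%R]%classic = \bigcup_n D n.
  apply/seteqP; split => x /=; rewrite in_itv/=.
    move=> /andP[x0 x1]; exists (Num.truncn x^-1) => //=; rewrite /D/= in_itv/= x1 andbT.
    rewrite -[leRHS]invrK lef_pV2 ?posrE ?invr_gt0//.
    by rewrite ltW// (lt_trans (truncnS_gt _))// ltr_nat.
  move=> [n _]; rewrite /D/= in_itv/= => /andP[nx ->]; rewrite andbT.
  by rewrite (lt_le_trans _ nx)// invr_gt0.
have mD n : measurable (D n) by exact: measurable_itv.
have mkD (A : set R) : measurable_fun A (fun x => (k x)%:E).
  by apply: measurable_funTS; exact/measurable_EFinP.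
have kE0 (A : set R) (x : R) : A x -> (0 <= (k x)%:E)%E by rewrite lee_fin k0.
have ndD : nondecreasing_seq (D : (set (measurableTypeR R))^nat).
  apply/nondecreasing_seqP => n; rewrite subsetEset => x /=.
  rewrite /D/= !in_itv/= => /andP[nx ->]; rewrite andbT (le_trans _ nx)//.
  by rewrite lef_pV2 ?posrE// ler_nat.
have cvgD := @ge0_nondecreasing_set_cvg_integral _ (measurableTypeR R) R D
  (fun x => (k x)%:E) mu ndD mD (fun n => mkD (D n)) (fun n => @kE0 (D n)).
apply: (cvge_to_le cvgD); apply: nearW => n.
have n1 : n.+2%:R^-1 < (1 : R) by rewrite invf_lt1// ltr1n.
have n0 : 0 < n.+2%:R^-1 :> R by rewrite invr_gt0.
apply: le_trans (integral_powR_le n0 n1).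
apply: ge0_le_integral; [exact: mD|exact: kE0|exact: mkD| |].
- by apply: measurable_funTS; apply/measurable_EFinP; exact: measurable_powR.
- move=> x; rewrite /D/= in_itv/= => /andP[nx _]; rewrite lee_fin /k.
  by rewrite ler_piMr ?powR_ge0// expRN_le1// (le_trans _ nx)// ltW.
Qed.

Lemma gamma_kernel_tail : exists C : R, forall x : R, 1 <= x ->
  k x <= C * expR (- (x / 2)).
Proof.
(* From ln x <= x / m + ln m, this [m] makes |a| / m at most 1/2, so half of the exponential decay
   absorbs the power. *)
pose m : R := 2 * `|a| + 1; have m0 : 0 < m by rewrite ltr_wpDl// mulr_ge0.
exists (expR (`|a| * ln m)) => x x1; have x0 : 0 < x by exact: lt_le_trans x1.
rewrite /k /powR gt_eqF// -!expRD ler_expR.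
have lx : 0 <= ln x by rewrite ln_ge0.
have h1 : (a - 1) * ln x <= `|a| * ln x.
  by rewrite ler_wpM2r// (le_trans _ (ler_norm a))// gerBl.
have h2 : ln x <= x / m + ln m.
  rewrite -(divfK (lt0r_neq0 m0) x) lnM ?posrE ?divr_gt0// lerD2r.
  by rewrite divfK ?gt_eqF// ltW// ln_sublinear// divr_gt0.
have h3 : `|a| * ln x <= `|a| * (x / m) + `|a| * ln m.
  by rewrite -mulrDr ler_wpM2l.
have h4 : `|a| * (x / m) <= x / 2.
  rewrite mulrCA ler_pM2l// ler_pdivrMr// /m.
  by rewrite mulrDr mulKf// lerDl.
exact: (exponent_le h1 (le_trans h3 (lerD h4 (lexx _)))).
Qed.

Let mkD (A : set R) : measurable_fun A (fun x => (k x)%:E).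
Proof. by apply: measurable_funTS; exact/measurable_EFinP. Qed.

Lemma integral_gamma_lty : (\int[mu]_(x in `]0%R, +oo[) (k x)%:E < +oo)%E.
Proof.
have -> : `]0%R, +oo[%classic = `]0%R, 1%R] `|` `]1%R, +oo[%classic :> set R.
  by rewrite -itv_bndbnd_setU ?bnd_simp.
rewrite ge0_integral_setU//=; last 3 first.
- exact: mkD.
- by move=> x _; rewrite lee_fin.
- apply/disj_setPS => x [] /=; rewrite !in_itv/= andbT => /andP[_ x1] h.
  by move: h; rewrite ltNge x1.
rewrite lte_add_pinfty ?(le_lt_trans integral_gamma01) ?ltry//.
have [C hC] := gamma_kernel_tail.
(* The factor 2 cancels the rate 1/2 in front of the exponential density. *)
apply: (@le_lt_trans _ _ (\int[mu]_(x in `]1%R, +oo[)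
    ((2 * `|C|)%:E * (exponential_pdf 2^-1 x)%:E))%E).
  apply: ge0_le_integral => //.
  - by move=> x _; rewrite lee_fin.
  - exact: mkD.
  - apply: measurable_funTS; apply: emeasurable_funM => //.
    by apply/measurable_EFinP; exact: measurable_exponential_pdf.
  - move=> x; rewrite /= in_itv/= andbT => x1; rewrite -EFinM lee_fin.
    have x0 : 0 <= x by rewrite ltW// (lt_trans _ x1).
    rewrite exponential_pdfE// (le_trans (hC x (ltW x1)))//.
    rewrite (_ : 2 * `|C| * _ = `|C| * expR (- (x / 2))); last first.
      by rewrite mulNr (mulrC _ x); field.
    by rewrite ler_wpM2r ?expR_ge0// ler_norm.
rewrite ge0_integralZl//; last 2 first.
- by apply: measurable_funTS; apply/measurable_EFinP; exact: measurable_exponential_pdf.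
- by move=> x _; rewrite lee_fin exponential_pdf_ge0.
rewrite lte_mul_pinfty ?lee_fin//.
apply: (@le_lt_trans _ _ (\int[mu]_x (exponential_pdf 2^-1 x)%:E)%E).
  apply: ge0_subset_integral => //.
  - by apply/measurable_EFinP; exact: measurable_exponential_pdf.
  - by move=> x _; rewrite lee_fin exponential_pdf_ge0.
by rewrite integral_exponential_pdf// ltry.
Qed.

(** The real-valued integral sends an infinite value to 0, so finiteness is what identifies
    [gamma_fun] with the actual integral. *)
Lemma gamma_funE : (\int[mu]_(x in `]0%R, +oo[) (k x)%:E = (gamma_fun a)%:E)%E.
Proof.
rewrite /gamma_fun /Rintegral fineK// ge0_fin_numE ?integral_gamma_lty//.
by apply: integral_ge0 => x _; rewrite lee_fin; exact: k0.
Qed.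

(** A zero integral would make the kernel vanish almost everywhere, yet it is positive on ]0, 1], a
    set of measure 1. *)
Lemma gamma_fun_gt0 : 0 < gamma_fun a.
Proof.
rewrite lt_neqAle gamma_fun_ge0 andbT eq_sym; apply/eqP => G0.
have := gamma_funE; rewrite G0 => I0.
have abs0 : (\int[mu]_(x in `]0%R, +oo[) `|(k x)%:E| = 0)%E.
  apply: etrans I0; apply: eq_integral => x _.
  by rewrite gee0_abs// lee_fin; exact: k0.
have mI : measurable (`]0%R, +oo[%classic : set (measurableTypeR R)) by exact: measurable_itv.
have [h _] := @ae_eq_integral_abs _ (measurableTypeR R) R mu _ mI _ (@mkD _).
have [N [mN N0 sN]] := h abs0.
have : (mu `]0%R, 1%R] <= mu N)%E.
  apply: le_measure; rewrite ?inE//.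
  move=> x; rewrite /= in_itv/= => /andP[x0 x1]; apply: sN => /= /(_ _).
  rewrite in_itv/= x0 => /(_ isT) /eqP.
  by rewrite eqe gt_eqF// mulr_gt0 ?powR_gt0 ?expR_gt0.
rewrite N0 lebesgue_measure_itv/= lte_fin ltr01 sube0.
by rewrite lee_fin ler10.
Qed.

Lemma gamma_kernel_integral (c : R) : 0 < c ->
  (\int[mu]_(x in `]0%R, +oo[) (x `^ (a - 1) * expR (- (c * x)))%:E =
   (gamma_fun a / c `^ a)%:E)%E.
Proof.
move=> c0; have ca0 : 0 < c `^ a by exact: powR_gt0.
pose f := (fun x => (k x)%:E) \_ (`]0%R, +oo[%classic : set R).
have mf : measurable_fun [set: R] f.
  by rewrite /f -measurable_restrictT//; exact: mkD.
have f0 x : (0 <= f x)%E.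
  by rewrite /f /patch; case: ifPn => // _; rewrite lee_fin.
have := ge0_integral_scale c0 mf f0.
rewrite -[X in X = _]integral_mkcond gamma_funE.
set J := (X in _ -> X = _).
have -> : (\int[mu]_x f (c * x)%R = (c `^ (a - 1))%:E * J)%E.
  rewrite /J [in RHS]integral_mkcond -ge0_integralZl//; last 3 first.
  - rewrite -measurable_restrictT//; apply: measurable_funTS; apply/measurable_EFinP.
    apply: measurable_funM; first exact: measurable_powR.
    apply: measurableT_comp; first exact: measurable_expR.
    by apply: measurable_funN; exact: measurable_funM.
  - move=> x _; apply: erestrict_ge0 => y _.
    by rewrite lee_fin mulr_ge0 ?powR_ge0 ?expR_ge0.
  - by rewrite lee_fin powR_ge0.
  apply: eq_integral => x _; rewrite /f /patch.
  have -> : (c * x \in (`]0%R, +oo[%classic : set R)) = (x \in (`]0%R, +oo[%classic : set R)).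
    by apply/idP/idP; rewrite !inE/= !in_itv/= !andbT pmulr_rgt0.
  case: ifPn => [|_]; last by rewrite mule0.
  rewrite inE/= in_itv/= andbT => x0; rewrite -EFinM /k powRM ?ltW// mulrA//.
rewrite muleA -EFinM mulr_powRB1 ?(ltW c0)// => E.
have : ((c `^ a)^-1%:E * (gamma_fun a)%:E = J)%E.
  by rewrite E muleA -EFinM mulVf ?gt_eqF// mul1e.
by rewrite -EFinM mulrC => <-.
Qed.

End gamma_function.
Section gamma_law.
Context {R : realType}.
Local Notation mu := (@lebesgue_measure R).
Variables a b : R.
Hypotheses (a0 : 0 < a) (b0 : 0 < b).

(** Exponential tilting turns rate b into rate b + s, leaving only the ratio of normalising
    constants. The case s = 0 also yields total mass 1. *)
Lemma integral_expRN_gamma_pdf (s : R) : 0 <= s ->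
  (\int[mu]_x (expR (- (s * `|x|)) * gamma_pdf a b x)%:E =
   (b `^ a / (b + s) `^ a)%:E)%E.
Proof.
move=> s0; have bs0 : 0 < b + s by rewrite ltr_wpDr.
have G0 := gamma_fun_gt0 a0.
pose C := b `^ a / gamma_fun a.
have C0 : 0 <= C by rewrite divr_ge0 ?powR_ge0// ltW.
have mI : measurable (`]0%R, +oo[%classic : set (measurableTypeR R)) by exact: measurable_itv.
transitivity (\int[mu]_(x in `]0%R, +oo[) (C%:E * (x `^ (a - 1) * expR (- ((b + s) * x)))%:E))%E.
  rewrite [RHS]integral_mkcond; apply: eq_integral => x _.
  rewrite /gamma_pdf /patch; case: ifPn => [|_]; last by rewrite mulr0.
  rewrite inE/= in_itv/= andbT => x0; rewrite -EFinM; congr EFin.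
  rewrite gtr0_norm// mulrDl opprD expRD /C; ring.
rewrite ge0_integralZl//; last 2 first.
- apply: measurable_funTS; apply/measurable_EFinP.
  apply: measurable_funM; first exact: measurable_powR.
  apply: measurableT_comp; first exact: measurable_expR.
  by apply: measurable_funN; exact: measurable_funM.
- by move=> x _; rewrite lee_fin mulr_ge0 ?powR_ge0 ?expR_ge0.
rewrite (gamma_kernel_integral a0 bs0) -EFinM; congr EFin.
by rewrite /C; field; rewrite !gt_eqF// powR_gt0.
Qed.

Lemma gamma_prob_setT : gamma_prob a b setT = 1%E.
Proof.
have := integral_expRN_gamma_pdf (lexx 0).
rewrite addr0 divff ?gt_eqF ?powR_gt0// => <-.
by apply: eq_integral => x _; rewrite mul0r oppr0 expR0 mul1r.
Qed.

Definition gamma_probability : probability R R :=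
  HB.pack (gamma_prob a b) (Measure_isProbability.Build _ _ _ (gamma_prob a b) gamma_prob_setT).

Lemma integrable_gamma_pdf : mu.-integrable setT (EFin \o gamma_pdf a b).
Proof.
apply/integrableP; split; first by apply/measurable_EFinP; exact: measurable_gamma_pdf.
apply: (@le_lt_trans _ _ (gamma_prob a b setT)); last by rewrite gamma_prob_setT ltry.
rewrite le_eqVlt; apply/orP; left; apply/eqP; apply: eq_integral => x _.
by rewrite gee0_abs// lee_fin gamma_pdf_ge0.
Qed.

(* lebesgue_measure lives on measurableTypeR R, which has the same measurable  *)
(* sets as R but another display: the law is transported along the identity.  *)
Let mid : measurable_fun [set: R] (idfun : R -> measurableTypeR R).
Proof. by move=> _ A mA; rewrite setTI. Qed.

Let idRV : {RV gamma_probability >-> measurableTypeR R} :=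
  HB.pack (idfun : R -> measurableTypeR R) (isMeasurableFun.Build _ _ _ _ _ mid).

Lemma integral_gamma_prob (f : R -> R) (K : R) : measurable_fun setT f ->
  (forall x, `|f x| <= K) ->
  (\int[gamma_probability]_x (f x)%:E = \int[mu]_x (f x * gamma_pdf a b x)%:E)%E.
Proof.
move=> mf fK.
have mf' : measurable_fun [set: measurableTypeR R] f by exact: mf.
have mE : measurable_fun [set: measurableTypeR R] (EFin \o f) by exact/measurable_EFinP.
have I1 := bounded_integrable gamma_probability mf fK.
rewrite -(integral_distribution (X := idRV) mE I1).
rewrite (integral_density integrable_gamma_pdf)//.
exact: (bounded_integrable (distribution gamma_probability idRV) mf' fK).
Qed.

Lemma gamma_laplace (s : R) : 0 <= s ->
  \int[gamma_probability]_x expR (- (s * `|x|)) = b `^ a / (b + s) `^ a.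
Proof.
move=> s0; rewrite /Rintegral (integral_gamma_prob (K := 1)).
- by rewrite integral_expRN_gamma_pdf.
- by apply: measurable_expRN; exact: normr_measurable.
- by move=> x; rewrite ger0_norm ?expR_ge0// expRN_le1// mulr_ge0.
Qed.

(** The density vanishes outside ]0, +oo[. Passing to |x| provides a variable that is nonnegative
    everywhere, as [laplace_continuity] demands. *)
Lemma integral_gamma_norm (f : R -> R) (K : R) : measurable_fun setT f ->
  (forall x, `|f x| <= K) ->
  (\int[gamma_prob a b]_x (f x)%:E = (\int[gamma_probability]_x f `|x|)%:E)%E.
Proof.
move=> mf fK.
have mfn : measurable_fun [set: R] (fun x : R => f `|x|).
  by apply: measurableT_comp => //; exact: normr_measurable.
have fnK (x : R) : `|f `|x| | <= K by exact: fK.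
have I2 := bounded_integrable gamma_probability mfn fnK.
rewrite /Rintegral fineK; last exact: integrable_fin_num.
rewrite -[LHS]/(\int[gamma_probability]_x (f x)%:E)%E.
rewrite (integral_gamma_prob mf fK) (integral_gamma_prob mfn fnK).
apply: eq_integral => x _; congr EFin.
rewrite /gamma_pdf /patch; case: ifPn => [|_]; last by rewrite !mulr0.
by rewrite inE/= in_itv/= andbT => x0; rewrite gtr0_norm.
Qed.

End gamma_law.
Lemma expR_taylor1 (R : realType) (z : R) : 0 <= z ->
  0 <= expR z - 1 - z <= z ^+ 2 * expR z.
Proof.
move=> z0; apply/andP; split; first by have := expR_ge1Dx z; lra.
have /andP[_ b] := expR_sub1_bounds z0.
have := ler_wpM2l z0 b; rewrite mulrBr mulr1 mulrA -expr2; lra.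
Qed.

(** * The heavy-traffic limit *)

Section laplace_derivative.
Context {R : realType} {d : measure_display} {T : measurableType d}.
Variables (P : probability T R) (X : T -> R).
Hypotheses (mX : measurable_fun setT X) (X0 : forall w, 0 <= X w).

Local Notation phi := (fun s : R => \int[P]_w expR (- (s * X w))).
Local Notation psi := (fun s : R => \int[P]_w (X w * expR (- (s * X w)))).

(** The Taylor remainder is at most (h x)^2 e^(-q x) with q >= s/2 for either sign of h, and (s x /
    2)^2 e^(-s x / 2) <= 4 gives 16 / s^2. Uniformity in x lets the bound be integrated, which
    replaces differentiation under the integral. *)
Lemma expRN_increment (s h x : R) : 0 < s -> `|h| <= s / 2 -> 0 <= x ->
  `|expR (- ((s + h) * x)) - (expR (- (s * x)) - h * (x * expR (- (s * x))))|
  <= 16 / s ^+ 2 * h ^+ 2.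
Proof.
move=> s0 hs x0.
have key (q : R) : s / 2 <= q -> (h * x) ^+ 2 * expR (- (q * x)) <= 16 / s ^+ 2 * h ^+ 2.
  move=> q2; have := @sqr_expRN_le4 R (s / 2 * x).
  rewrite mulr_ge0// ?divr_ge0 ?(ltW s0)// => /(_ isT) h4.
  apply: (@le_trans _ _ ((h * x) ^+ 2 * expR (- (s / 2 * x)))).
    by rewrite ler_wpM2l ?sqr_ge0// ler_expR lerN2 ler_wpM2r.
  have -> : (h * x) ^+ 2 * expR (- (s / 2 * x)) =
      4 / s ^+ 2 * h ^+ 2 * ((s / 2 * x) ^+ 2 * expR (- (s / 2 * x))).
    by field; rewrite gt_eqF.
  have -> : 16 / s ^+ 2 * h ^+ 2 = 4 / s ^+ 2 * h ^+ 2 * 4 by field; rewrite gt_eqF.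
  by rewrite ler_wpM2l// mulr_ge0 ?sqr_ge0// divr_ge0 ?sqr_ge0.
have -> : expR (- ((s + h) * x)) = expR (- (s * x)) * expR (- (h * x)).
  by rewrite -expRD; congr expR; ring.
have e0 := expR_gt0 (- (s * x)).
have [h0|h0] := leP 0 h.
  have /andP[a b] := expRN_taylor1 (mulr_ge0 h0 x0).
  rewrite (_ : _ - _ = expR (- (s * x)) * (expR (- (h * x)) - 1 + h * x)); last by ring.
  rewrite ger0_norm; last by rewrite mulr_ge0// ltW.
  rewrite mulrC; apply: le_trans (key s _); last by rewrite ler_pdivrMr// ler_pMr// ler1n.
  by rewrite ler_wpM2r// ltW.
have z0 : 0 <= - (h * x) by rewrite -mulNr mulr_ge0// oppr_ge0 ltW.
have /andP[a c] := expR_taylor1 z0; rewrite sqrrN in c.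
rewrite (_ : _ - _ = expR (- (s * x)) * (expR (- (h * x)) - 1 - - (h * x))); last by ring.
rewrite ger0_norm; last by rewrite mulr_ge0// ltW.
apply: (@le_trans _ _ ((h * x) ^+ 2 * expR (- ((s + h) * x)))).
  have -> : expR (- ((s + h) * x)) = expR (- (s * x)) * expR (- (h * x)).
    by rewrite -expRD; congr expR; ring.
  by rewrite mulrCA ler_pM2l.
apply: key; move: hs; rewrite ltr0_norm// lerNl => hs.
by rewrite [X in _ <= X + _](splitr s) -lerBlDl opprD addrA addrN add0r.
Qed.

Lemma integrable_X_expRN (s : R) : 0 < s ->
  P.-integrable setT (EFin \o (fun w => X w * expR (- (s * X w)))).
Proof.
move=> s0; apply: (@bounded_integrable _ _ _ _ _ s^-1).
  by apply: measurable_funM => //; exact: measurable_expRN.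
move=> w; rewrite ger0_norm; last by rewrite mulr_ge0// expR_ge0.
rewrite -(ler_pM2l s0) divff ?gt_eqF// mulrA; exact: mul_expRN_le1.
Qed.

Lemma laplace_increment (s h : R) : 0 < s -> `|h| <= s / 2 ->
  `|phi (s + h) - (phi s - h * psi s)| <= 16 / s ^+ 2 * h ^+ 2.
Proof.
move=> s0 hs.
have sh0 : 0 <= s + h.
  move: hs; rewrite ler_norml => /andP[h1 _].
  by rewrite -lerBlDl sub0r (le_trans _ h1)// lerN2 ler_pdivrMr// ler_pMr// ler1n.
have I1 := integrable_expRN P mX X0 (ltW s0).
have I2 := integrable_X_expRN s0.
rewrite /= -RintegralZl// -RintegralB//; last exact: integrable_mulr.
rewrite -(Rintegral_cst1 P (16 / s ^+ 2 * h ^+ 2)).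
apply: Rintegral_sub_le.
- exact: integrable_expRN.
- by apply: integrable_subr => //; exact: integrable_mulr.
- exact: integrable_cst1.
- by move=> w; exact: expRN_increment.
Qed.

Lemma is_derive_laplace (s : R) : 0 < s -> is_derive s 1 phi (- psi s).
Proof.
move=> s0; pose C : R := 16 / s ^+ 2; have C0 : 0 < C by rewrite divr_gt0// exprn_gt0.
have cvgphi : h^-1 *: (phi (h *: 1 + s) - phi s) @[h --> 0^'] --> - psi s.
  apply/cvgrPdist_le => e e0.
  have s2 : 0 < s / 2 by rewrite divr_gt0.
  near=> h.
  have h0 : h != 0 by near: h; exact: nbhs_dnbhs_neq.
  have hs : `|h| <= s / 2.
    by apply/ltW; near: h; apply: dnbhs0_lt.
  have he : `|h| <= e / C.
    by apply/ltW; near: h; apply: dnbhs0_lt; rewrite divr_gt0.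
  have := laplace_increment s0 hs.
  rewrite /GRing.scale/= mulr1 (addrC h s) => H.
  rewrite (_ : - psi s - _ = - (h^-1 * (phi (s + h) - (phi s - h * psi s)))); last first.
    by field.
  rewrite normrN normrM normfV mulrC ler_pdivrMr ?normr_gt0//.
  apply: (le_trans H); rewrite -[h ^+ 2]real_normK ?num_real// expr2 mulrA.
  by rewrite ler_wpM2r// mulrC -ler_pdivlMr.
split; first by apply/cvg_ex; exists (- psi s).
exact: (cvg_lim (@Rhausdorff R) cvgphi).
Unshelve. all: by end_near. Qed.

(** The endpoint 0 is handled separately: [X] may have no mean, so differentiability is available
    only for s > 0. *)
Lemma laplace_continuous (S : R) : 0 < S -> {within `[0, S], continuous phi}.
Proof.
move=> S0; have dphi (s : R) : 0 < s -> {for s, continuous phi}.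
  move=> s0; apply: differentiable_continuous; apply/derivable1_diffP.
  by have [] := is_derive_laplace s0.
apply/(continuous_within_itvP _ S0); split.
- by move=> s; rewrite in_itv/= => /andP[s0 _]; exact: dphi.
- have -> : phi 0 = 1.
    rewrite -[RHS](Rintegral_cst1 P 1); apply: eq_Rintegral => w _.
    by rewrite mul0r oppr0 expR0.
  apply/cvgrPdist_le => e e0; have [c c0 hc] := laplace_near0 P mX X0 e0.
  near=> s; have s0 : 0 < s by near: s; exact: nbhs_right_gt.
  have sc : s <= c by near: s; exact: nbhs_right_le.
  have /andP[_ s1] := laplace_itv P mX X0 (ltW s0).
  rewrite ger0_norm ?subr_ge0// (le_trans _ hc)// lerD2l lerN2.
  apply: le_Rintegral => //; [exact: integrable_expRN (ltW c0)|exact: integrable_expRN (ltW s0)|].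
  by move=> w _; rewrite ler_expR lerN2 ler_wpM2r.
- by apply: cvg_at_left_filter; exact: dphi.
Unshelve. all: by end_near. Qed.

End laplace_derivative.
(* (b + s) `^ a * phi s is constant when (b + s) phi' = - a phi.               *)
Lemma gamma_ode_bound (R : realType) (phi psi : R -> R) (a b S e : R) :
  0 < S -> 0 <= a -> 0 < b -> 0 <= e -> phi 0 = 1 ->
  {within `[0, S], continuous phi} ->
  (forall s : R, 0 < s -> is_derive s 1 phi (- psi s)) ->
  (forall s : R, 0 < s < S -> `|a * phi s - (b + s) * psi s| <= e) ->
  `|phi S * (b + S) `^ a - b `^ a| <= S * ((b + S) `^ a / b) * e.
Proof.
move=> S0 a0 b0 e0 phi0 cphi dphi ode.
pose p (s : R) := (b + s) `^ a.
have dp (s : R) : 0 <= s -> is_derive s 1 p (a * (b + s) `^ (a - 1)).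
  move=> s0; have bs : 0 < b + s by rewrite ltr_wpDr.
  have h1 : is_derive s 1 (fun y : R => b + y) 1.
    have := is_deriveD (is_derive_cst b s 1) (is_derive_id s (1 : R)).
    by rewrite add0r.
  have := @is_derive1_comp _ (fun y => y `^ a) (fun y => b + y) s _ _
    (is_derive1_powR a bs) h1.
  by rewrite mulr1.
have cp (s : R) : 0 <= s -> {for s, continuous p}.
  move=> s0; apply: differentiable_continuous; apply/derivable1_diffP.
  by have [] := dp s s0.
pose W (s : R) := phi s * p s.
pose dW (s : R) := (b + s) `^ (a - 1) * (a * phi s - (b + s) * psi s).
have dWE (s : R) : s \in `]0, S[ -> is_derive s 1 W (dW s).
  rewrite in_itv/= => /andP[s0 _].
  have := is_deriveM (dphi s s0) (dp s (ltW s0)).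
  rewrite (_ : _ + _ = dW s)// /dW /GRing.scale/= /p.
  have bs : 0 < b + s by rewrite ltr_wpDr// ltW.
  have -> : (b + s) `^ a = (b + s) * (b + s) `^ (a - 1).
    by rewrite mulrC -[X in _ * X]powRr1 ?ltW// -powRD ?subrK// (gt_eqF bs) implybT.
  ring.
have cW : {within `[0, S], continuous W}.
  have [c1 c2 c3] := (continuous_within_itvP _ S0).1 cphi.
  apply/(continuous_within_itvP _ S0); split.
  - move=> s sS; apply: cvgM; first exact: c1.
    by apply: cp; move: sS; rewrite in_itv/= => /andP[/ltW].
  - by apply: cvgM => //; apply: cvg_at_right_filter; exact: cp.
  - by apply: cvgM => //; apply: cvg_at_left_filter; apply: cp; exact: ltW.
have [c] := MVT S0 dWE cW.
rewrite in_itv/= => /andP[c0 cS].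
rewrite {1 2}/W /p phi0 mul1r addr0 subr0 => ->.
have bc : 0 < b + c by rewrite ltr_wpDr// ltW.
rewrite normrM (ger0_norm (ltW S0)) mulrC -mulrA ler_pM2l// /dW normrM.
rewrite ger0_norm ?powR_ge0//.
apply: ler_pM => //; rewrite ?powR_ge0//; last by apply: ode; rewrite c0.
(* Writing (b + c)^(a - 1) as (b + c)^a / (b + c) bounds it by (b + S)^a / b whatever the sign of a
   - 1. *)
rewrite powRB; last by rewrite (gt_eqF bc) implybT.
rewrite powRr1 ?(ltW bc)//; apply: ler_pM; rewrite ?powR_ge0 ?invr_ge0 ?(ltW bc)//.
  apply: ge0_ler_powR => //; rewrite ?nnegrE ?(ltW bc)// ?lerD2l ?(ltW cS)//.
  by rewrite addr_ge0// ltW.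
by rewrite lef_pV2 ?posrE// lerDl ltW.
Qed.

(** By the mean value theorem, since the middle term has derivative e^(-y) - 1 + y <= y^2. The cubic
    order makes bounded marks negligible against u^2. *)
Lemma expRN_taylor2 (R : realType) (x : R) : 0 <= x ->
  0 <= x ^+ 2 / 2 - (expR (- x) - 1 + x) <= x ^+ 3.
Proof.
rewrite le_eqVlt => /predU1P[<-|x0].
  by rewrite oppr0 expR0 !expr0n/= mul0r subrr addr0 subrr lexx.
pose g (y : R) := y ^+ 2 / 2 - (expR (- y) - 1 + y).
have dg (y : R) : is_derive y 1 g (y - (1 - expR (- y))).
  have d1 : is_derive y 1 (fun z : R => expR (- z)) (- expR (- y)).
    have := @is_derive1_comp _ expR (fun z => - z) y _ _ (is_derive_expR (- y))
      (is_deriveN (is_derive_id y (1 : R))).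
    by rewrite mulrN1.
  rewrite /g; apply: is_derive_eq.
  by rewrite /GRing.scale/=; field.
have cg : {within `[0, x], continuous g}.
  apply: continuous_subspaceT => y; apply: differentiable_continuous.
  by apply/derivable1_diffP; have [] := dg y.
have [c] := MVT x0 (fun y _ => dg y) cg.
rewrite in_itv/= => /andP[c0 cx].
have g0 : g 0 = 0 by rewrite /g oppr0 expR0 expr0n/= mul0r subrr addr0 subrr.
rewrite g0 subr0 subr0 -/(g x) => ->.
have /andP[h1 h2] := expRN_taylor1 (ltW c0).
have E : c - (1 - expR (- c)) = expR (- c) - 1 + c by ring.
rewrite E mulr_ge0 ?(ltW x0)//= exprSr ler_pM2r//.
by rewrite (le_trans h2)// lerXn2r// ?nnegrE ltW.
Qed.

(** * Second-order expansion of the transform of the mark *)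

Section mark_expansion.
Context {R : realType} {d : measure_display} {T : measurableType d}.
Variables (P : probability T R) (B : {RV P >-> R}) (b1 b2 : R).
Hypotheses (B0 : {ae P, forall w, 0 <= B w}) (EB : ('E_P[B] = b1%:E)%E).
Hypothesis EB2 : ('E_P[(fun w => (B w ^+ 2)%R)] = b2%:E)%E.

Let mB : measurable_fun setT B. Proof. exact: measurable_funPT. Qed.
Let mA : measurable_fun setT (fun w => `|B w|).
Proof. by apply: measurableT_comp => //; exact: normr_measurable. Qed.
Let mA2 : measurable_fun setT (fun w => `|B w| ^+ 2).
Proof. exact: measurable_funX. Qed.

Let I2E : (\int[P]_w (`|B w| ^+ 2)%:E = b2%:E)%E.
Proof.
rewrite -EB2 unlock; apply: eq_integral => w _.
by rewrite /= real_normK// num_real.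
Qed.

Let I2 : P.-integrable setT (EFin \o (fun w => `|B w| ^+ 2)).
Proof.
apply/integrableP; split; first exact/measurable_EFinP.
rewrite (eq_integral (fun w => (`|B w| ^+ 2)%:E)); first by rewrite I2E ltry.
by move=> w _; rewrite /= ger0_norm// sqr_ge0.
Qed.

Let I1 : P.-integrable setT (EFin \o (fun w => `|B w|)).
Proof.
apply: (@le_integrable _ _ _ P _ measurableT _ (EFin \o (fun w => 1 + `|B w| ^+ 2))).
- exact/measurable_EFinP.
- move=> w _ /=; rewrite lee_fin normr_id (@ger0_norm _ (1 + _)) ?addr_ge0 ?sqr_ge0//.
  move: (normr_ge0 (B w)); move: `|B w| => y y0.
  have [y1|y1] := leP y 1; first by rewrite (le_trans y1)// lerDl sqr_ge0.
  by rewrite (@le_trans _ _ (y ^+ 2)) ?lerDr// expr2 ler_peMr// ltW.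
- by apply: integrable_addr => //; exact: integrable_cst1.
Qed.

Let E1 : \int[P]_w `|B w| = b1.
Proof.
rewrite /Rintegral -[RHS]/(fine b1%:E) -EB unlock; congr fine.
apply: ae_eq_integral => //; [exact/measurable_EFinP|exact/measurable_EFinP|].
by apply: filterS B0 => w w0 _ /=; rewrite ger0_norm.
Qed.

Let E2 : \int[P]_w (`|B w| ^+ 2) = b2.
Proof. by rewrite /Rintegral I2E. Qed.

Lemma mark_second_moment_ge : b1 ^+ 2 <= b2.
Proof.
have h : 0 <= \int[P]_w (`|B w| ^+ 2 - 2 * b1 * `|B w| + b1 ^+ 2).
  apply: Rintegral_ge0 => w _.
  by rewrite (_ : _ + _ = (`|B w| - b1) ^+ 2) ?sqr_ge0//; ring.
have Ia := integrable_mulr (2 * b1) I1.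
move: h; rewrite RintegralD//; last 2 first.
- exact: integrable_subr.
- exact: integrable_cst1.
rewrite RintegralB// RintegralZl// E1 E2 Rintegral_cst1.
have -> : b2 - 2 * b1 * b1 + b1 ^+ 2 = b2 - b1 ^+ 2 by ring.
by rewrite subr_ge0.
Qed.

Lemma mark_transform_expansion (u : R) : 0 < u -> exists eta : R,
  [/\ mark_transform B u = 1 - u * b1 + u ^+ 2 * (b2 / 2 - eta),
      0 <= eta <= b2 / 2 &
      forall K e : R, 0 <= K ->
        (\int[P]_(w in [set w | (K < B w)%R]) ((B w ^+ 2)%R)%:E <= e%:E)%E ->
        eta <= u * K * b2 + e].
Proof.
move=> u0.
pose th w := (u * `|B w|) ^+ 2 / 2 - (expR (- (u * `|B w|)) - 1 + u * `|B w|).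
have x0 w : 0 <= u * `|B w| by rewrite mulr_ge0// ltW.
have mE := measurable_expRN mA u.
have IE := integrable_expRN P mA (fun w => normr_ge0 (B w)) (ltW u0).
have th0 w : 0 <= th w by have /andP[] := expRN_taylor2 (x0 w).
have th2 w : th w <= (u * `|B w|) ^+ 2 / 2.
  by have /andP[h _] := expRN_taylor1 (x0 w); rewrite /th gerBl.
have th3 w : th w <= (u * `|B w|) ^+ 3 by have /andP[] := expRN_taylor2 (x0 w).
have thE : th = fun w => u ^+ 2 / 2 * `|B w| ^+ 2 -
    (expR (- (u * `|B w|)) - 1 + u * `|B w|).
  by apply/funext => w; rewrite /th; ring.
have J1 := integrable_mulr u I1.
have J2 := integrable_mulr (u ^+ 2 / 2) I2.
have J3 := integrable_subr IE (integrable_cst1 P 1).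
have J4 := integrable_addr J3 J1.
have Ith : P.-integrable setT (EFin \o th).
  by rewrite thE; exact: integrable_subr.
have ThE : \int[P]_w th w = u ^+ 2 / 2 * b2 - (mark_transform B u - 1 + u * b1).
  rewrite thE RintegralB// RintegralZl// RintegralD// RintegralB//; last first.
    exact: integrable_cst1.
  by rewrite RintegralZl// E1 E2 Rintegral_cst1.
have u2 : 0 < u ^+ 2 by rewrite exprn_gt0.
exists ((\int[P]_w th w) / u ^+ 2); split.
- by rewrite ThE; field; rewrite gt_eqF.
- apply/andP; split; first by rewrite divr_ge0 ?(ltW u2)// Rintegral_ge0.
  rewrite ler_pdivrMr// -E2 mulrAC -mulrA mulrC -RintegralZl//.
  by apply: le_Rintegral => // w _; rewrite (le_trans (th2 w))// exprMn mulrAC.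
move=> K e K0 he.
pose D := [set w | K < `|B w|].
have mD : measurable D.
  have -> : D = (fun w => `|B w|) @^-1` `]K, +oo[%classic.
    by apply/seteqP; split => w /=; rewrite in_itv/= andbT.
  by rewrite -[_ @^-1` _]setTI; exact: mA.
have mD' : measurable [set w | K < B w].
  have -> : [set w | K < B w] = B @^-1` `]K, +oo[%classic.
    by apply/seteqP; split => w /=; rewrite in_itv/= andbT.
  exact: measurable_funPTI.
have It : P.-integrable setT (EFin \o (fun w => `|B w| ^+ 2 * \1_D w)).
  apply: (@integrable_mul_bounded _ _ _ _ _ _ 1) => //.
  by move=> w; rewrite indicE; case: (_ \in _); rewrite ?normr1// normr0.
have te : \int[P]_w (`|B w| ^+ 2 * \1_D w) <= e.
  rewrite -lee_fin; apply: le_trans he; rewrite /Rintegral fineK; last first.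
    exact: integrable_fin_num.
  rewrite [X in (_ <= X)%E]integral_mkcond le_eqVlt; apply/orP; left; apply/eqP.
  apply: ae_eq_integral => //.
  - exact: (measurable_int P It).
  - rewrite -measurable_restrictT//; apply: measurable_funTS; apply/measurable_EFinP.
    exact: measurable_funX.
  - apply: filterS B0 => w w0 _; rewrite /patch indicE /D.
    have -> : (w \in [set w | K < `|B w|]) = (w \in [set w | K < B w]).
      by apply/idP/idP; rewrite !inE/= ger0_norm.
    by case: ifPn => _; rewrite ?mulr1 ?mulr0// ger0_norm.
rewrite ler_pdivrMr//.
apply: (@le_trans _ _ (\int[P]_w (u ^+ 2 * (u * K) * `|B w| ^+ 2 +
    u ^+ 2 * (`|B w| ^+ 2 * \1_D w)))).
  apply: le_Rintegral => //.
    by apply: integrable_addr; exact: integrable_mulr.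
  move=> w _; rewrite indicE; have [Kw|Kw] := ltP K `|B w|.
    rewrite mem_set// mulr1 ler_wpDl//.
      by rewrite mulr_ge0 ?sqr_ge0// mulr_ge0 ?(ltW u2)// mulr_ge0// ltW.
    rewrite (le_trans (th2 w))// exprMn ler_pdivrMr// ler_peMr ?ler1n//.
    by rewrite mulr_ge0 ?sqr_ge0.
  rewrite memNset/=; last by rewrite /D/= ltNge Kw.
  rewrite !mulr0 addr0 (le_trans (th3 w))//.
  have -> : (u * `|B w|) ^+ 3 = u ^+ 2 * u * `|B w| ^+ 2 * `|B w| by ring.
  have -> : u ^+ 2 * (u * K) * `|B w| ^+ 2 = u ^+ 2 * u * `|B w| ^+ 2 * K by ring.
  by rewrite ler_wpM2l// !mulr_ge0 ?sqr_ge0// ltW.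
rewrite RintegralD//; [|exact: integrable_mulr..].
rewrite !RintegralZl// E2 mulrDl.
have -> : u ^+ 2 * (u * K) * b2 = u * K * b2 * u ^+ 2 by ring.
by rewrite lerD2l mulrC ler_pM2r.
Qed.

End mark_expansion.

Lemma hawkes_load_exp (R : realType) (b1 r rho : R) : 0 < r ->
  hawkes_load b1 (exp_excitation r) = rho -> b1 = rho * r.
Proof.
move=> r0; rewrite /hawkes_load => <-.
suff -> : \int[lebesgue_measure]_(u in `[0, +oo[) exp_excitation r u = r^-1.
  by rewrite mulfVK// gt_eqF.
have h := integral_exponential_pdf r0.
have E : (\int[lebesgue_measure]_(x in `[0%R, +oo[) (r * exp_excitation r x)%:E = 1)%E.
  rewrite -h integral_mkcond; apply: eq_integral => x _.
  by rewrite /exponential_pdf /patch; case: ifPn.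
rewrite /Rintegral -[RHS]/(fine (r^-1)%:E); congr fine.
have Er : (\int[lebesgue_measure]_(x in `[0%R, +oo[) (r * exp_excitation r x)%:E =
    r%:E * \int[lebesgue_measure]_(x in `[0%R, +oo[) (exp_excitation r x)%:E)%E.
  under eq_integral do rewrite EFinM.
  rewrite ge0_integralZl//; last 3 first.
  - apply: measurable_funTS; apply/measurable_EFinP.
    by apply: measurableT_comp; [exact: measurable_expR|exact: mulrl_measurable].
  - by move=> x _; rewrite lee_fin expR_ge0.
  - by rewrite lee_fin ltW.
have : (r^-1%:E * (r%:E * \int[lebesgue_measure]_(x in `[0%R, +oo[)
  (exp_excitation r x)%:E) = r^-1%:E)%E by rewrite -Er E mule1.
by rewrite muleA -EFinM mulVf ?gt_eqF// mul1e.
Qed.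
(** Subtracting the exact identity from the limiting equation leaves only parameter differences.
    With |(b2l - b2) / 2 + eta| <= 3 delta, the [phi] term costs lambda delta and the [psi] term
    lambda (1 + 3 S) delta, whence 2 + 3 S. *)
Lemma ode_error (R : realType)
    (rl r b2l b2 eta lambda phi psi s S delta e : R) :
  0 < b2l -> 0 <= lambda -> `|rl - r| <= delta -> `|b2l - b2| <= delta ->
  0 <= eta <= 2 * delta -> 0 <= phi <= 1 -> 0 <= psi <= lambda -> 0 <= s <= S ->
  (r + s * (b2 / 2 - eta)) * psi = r * lambda * phi ->
  lambda * (2 + 3 * S) * delta <= e * (b2l / 2) ->
  `|2 * rl * lambda / b2l * phi - (2 * rl / b2l + s) * psi| <= e.
Proof.
move=> b0 l0 hr hb /andP[n0 n1] /andP[f0 f1] /andP[p0 p1] /andP[s0 sS] eq he.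
have -> : 2 * rl * lambda / b2l * phi - (2 * rl / b2l + s) * psi =
    ((rl - r) * lambda * phi - ((rl - r) + s * ((b2l - b2) / 2 + eta)) * psi) / (b2l / 2).
  have -> : (rl - r) * lambda * phi - ((rl - r) + s * ((b2l - b2) / 2 + eta)) * psi =
      rl * lambda * phi - (rl + s * b2l / 2) * psi +
      ((r + s * (b2 / 2 - eta)) * psi - r * lambda * phi) by field.
  by rewrite eq subrr addr0; field; rewrite gt_eqF.
have b20 : 0 < b2l / 2 by rewrite divr_gt0.
rewrite normrM normfV (gtr0_norm b20) ler_pdivrMr// (le_trans _ he)//.
have d0 : 0 <= delta by rewrite (le_trans _ hr).
have h1 : `|(rl - r) * lambda * phi| <= delta * lambda.
  rewrite !normrM (ger0_norm l0) (ger0_norm f0) -[leRHS]mulr1.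
  by apply: ler_pM => //; [rewrite mulr_ge0|rewrite ler_wpM2r].
have h2 : `|(b2l - b2) / 2 + eta| <= 3 * delta.
  rewrite (le_trans (ler_normD _ _))// normrM (ger0_norm n0) normfV (ger0_norm (ler0n _ 2)).
  have : `|b2l - b2| / 2 <= delta by rewrite ler_pdivrMr// (le_trans hb)// ler_peMr// ler1n.
  by move: (_ / 2) => y; lra.
have h3 : `|rl - r + s * ((b2l - b2) / 2 + eta)| <= delta + S * (3 * delta).
  rewrite (le_trans (ler_normD _ _))// lerD// normrM (ger0_norm s0).
  by apply: ler_pM.
have h4 : `|(rl - r + s * ((b2l - b2) / 2 + eta)) * psi| <= (delta + S * (3 * delta)) * lambda.
  by rewrite normrM (ger0_norm p0); apply: ler_pM.
rewrite (le_trans (ler_normB _ _))// (le_trans (lerD h1 h4))// le_eqVlt.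
by apply/orP; left; apply/eqP; ring.
Qed.

(** At u = (1 - rho) s and with b1 = rho r, the coefficient u r - (1 - beta(u)) becomes u (1 - rho)
    (r + s (b2/2 - eta)). Drift and variance terms thus have the same order, which is why 1 - rho is
    the right scale; u cancels and the remaining 1 - rho goes into X. *)
Lemma scaled_stationary_identity (R : realType) (d d' : measure_display)
    (T : measurableType d) (T' : measurableType d')
    (P : probability T R) (P' : probability T' R)
    (lambda r rho b1 b2 : R) (B : {RV P >-> R}) (M : R -> T -> nat)
    (tau Bs : nat -> {RV P >-> R}) (Lambda : {RV P' >-> R}) :
  0 < lambda -> 0 < r -> 0 < rho < 1 ->
  ('E_P[B] = b1%:E)%E -> ('E_P[(fun w => (B w ^+ 2)%R)] = b2%:E)%E ->
  hawkes_load b1 (exp_excitation r) = rho ->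
  hawkes lambda (exp_excitation r) B M tau Bs ->
  stationary_intensity P lambda (exp_excitation r) M tau Bs Lambda ->
  forall s : R, 0 < s -> exists eta : R,
  [/\ (r + s * (b2 / 2 - eta)) *
        (\int[P']_w ((1 - rho) * `|Lambda w| * expR (- (s * ((1 - rho) * `|Lambda w|))))) =
      r * lambda * \int[P']_w expR (- (s * ((1 - rho) * `|Lambda w|))),
      0 <= eta <= b2 / 2 &
      forall K e : R, 0 <= K ->
        (\int[P]_(w in [set w | (K < B w)%R]) ((B w ^+ 2)%R)%:E <= e%:E)%E ->
        eta <= (1 - rho) * s * K * b2 + e].
Proof.
move=> lambda0 r0 /andP[rho0 rho1] EB EB2 load hw hstat s s0.
have b1E := hawkes_load_exp r0 load.
have k0 : 0 < 1 - rho by rewrite subr_gt0.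
have u0 : 0 < (1 - rho) * s by rewrite mulr_gt0.
have [eta [betaE eta0 etaK]] := mark_transform_expansion (hawkes_mark_ge0 hw) EB EB2 u0.
exists eta; split => //.
have id := stationary_identity hw lambda0 r0 hstat u0.
have mL : measurable_fun setT (fun w => `|Lambda w|).
  by apply: measurableT_comp => //; exact: normr_measurable.
have IL := integrable_X_expRN P' mL (fun w => normr_ge0 (Lambda w)) u0.
have sE w : s * ((1 - rho) * `|Lambda w|) = (1 - rho) * s * `|Lambda w| by ring.
have psiE : \int[P']_w ((1 - rho) * `|Lambda w| * expR (- (s * ((1 - rho) * `|Lambda w|)))) =
    (1 - rho) * \int[P']_w (`|Lambda w| * expR (- ((1 - rho) * s * `|Lambda w|))).
  by rewrite -RintegralZl//; apply: eq_Rintegral => w _; rewrite sE mulrA.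
have phiE : \int[P']_w expR (- (s * ((1 - rho) * `|Lambda w|))) =
    \int[P']_w expR (- ((1 - rho) * s * `|Lambda w|)).
  by apply: eq_Rintegral => w _; rewrite sE.
rewrite psiE phiE; move: id; rewrite betaE b1E.
move: (\int[P']_w _) (\int[P']_w _) => phi psi id.
have ks : (1 - rho) * s != 0 by rewrite gt_eqF.
apply: (mulfI ks) => /=; rewrite (_ : _ * (r * lambda * phi) = (1 - rho) * s * r * lambda * phi).
  by rewrite -id; ring.
by ring.
Qed.

Lemma laplace_gamma_bound (R : realType) (d' : measure_display) (T' : measurableType d')
    (P' : probability T' R) (X : T' -> R) (a b S e : R) :
  measurable_fun setT X -> (forall w, 0 <= X w) ->
  0 < S -> 0 <= a -> 0 < b -> 0 <= e ->
  (forall s, 0 < s < S -> `|a * \int[P']_w expR (- (s * X w)) -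
     (b + s) * \int[P']_w (X w * expR (- (s * X w)))| <= e) ->
  `|b `^ a / (b + S) `^ a - \int[P']_w expR (- (S * X w))| <= S / b * e.
Proof.
move=> mX X0 S0 a0 b0 e0 ode.
have phi0 : \int[P']_w expR (- (0 * X w)) = 1.
  rewrite -[RHS](Rintegral_cst1 P' 1); apply: eq_Rintegral => w _.
  by rewrite mul0r oppr0 expR0.
have := gamma_ode_bound S0 a0 b0 e0 phi0 (@laplace_continuous _ _ _ P' X mX X0 S S0)
  (@is_derive_laplace _ _ _ P' X mX X0) ode.
have p0 : 0 < (b + S) `^ a by rewrite powR_gt0// addr_gt0.
rewrite distrC; move: (\int[P']_w _) => phi h.
rewrite -(ler_pM2r p0) -[X in _ * X <= _](gtr0_norm p0) -normrM mulrBl divfK ?gt_eqF//.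
by apply: (le_trans h); rewrite le_eqVlt; apply/orP; left; apply/eqP; ring.
Qed.
Lemma mark_remainder_le (R : realType) (delta s S K q b2l b2 rho : R) :
  0 <= delta -> delta <= 1 -> 0 <= s -> s <= S -> 0 <= K -> 0 <= q ->
  q = S * K * (b2l + 1) -> 0 <= b2l -> `|b2l - b2| <= delta ->
  1 - rho <= delta / (q + 1) -> rho <= 1 ->
  (1 - rho) * s * K * b2 + delta <= 2 * delta.
Proof.
move=> d0 d1 s0 sS K0 q0 qE b0 db rq r1.
suff h : (1 - rho) * s * K * b2 <= delta by lra.
have k0 : 0 <= 1 - rho by rewrite subr_ge0.
have b2b : b2 <= b2l + 1 by move: db; rewrite ler_norml => /andP[]; lra.
apply: (@le_trans _ _ ((1 - rho) * q)).
  rewrite qE -!mulrA ler_wpM2l// (le_trans (y := s * (K * (b2l + 1))))//.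
    by rewrite ler_wpM2l// ler_wpM2l.
  by rewrite ler_wpM2r// mulr_ge0// addr_ge0.
apply: (@le_trans _ _ (delta / (q + 1) * q)); first by rewrite ler_wpM2r.
have q1 : 0 < q + 1 by rewrite ltr_wpDl.
by rewrite mulrAC ler_pdivrMr// ler_wpM2l// lerDl.
Qed.

(* The Hawkes process is indexed by its load rho in ]0, 1[; the parameters    *)
(* r and b_2 in the limit are the limits, as rho increases to 1, of those of  *)
(* the processes.  This covers a fixed mark B with r decreasing to b_1, as    *)
(* well as a fixed r with marks rho *: B.  The uniform integrability of the   *)
(* squared marks is automatic when B is fixed.                                *)
Theorem theorem6p4 (R : realType) (lambda : R)
    (r b1 b2 : R -> R) (r_lim b2_lim : R)
    (d : R -> measure_display) (T : forall rho, measurableType (d rho))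
    (P : forall rho, probability (T rho) R)
    (B : forall rho, {RV (P rho) >-> R})
    (M : forall rho, R -> T rho -> nat)
    (tau : forall rho, nat -> {RV (P rho) >-> R})
    (Bs : forall rho, nat -> {RV (P rho) >-> R})
    (d' : R -> measure_display) (T' : forall rho, measurableType (d' rho))
    (P' : forall rho, probability (T' rho) R)
    (Lambda : forall rho, {RV (P' rho) >-> R})
    (lambda_gt0 : 0 < lambda)
    (r_gt0 : forall rho : R, 0 < rho < 1 -> 0 < r rho)
    (B_moment1 : forall rho : R, 0 < rho < 1 ->
      ('E_(P rho)[B rho] = (b1 rho)%:E)%E)
    (B_moment2 : forall rho : R, 0 < rho < 1 ->
      ('E_(P rho)[(fun w => (B rho w ^+ 2)%R)] = (b2 rho)%:E)%E)
    (load : forall rho : R, 0 < rho < 1 ->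
      hawkes_load (b1 rho) (exp_excitation (r rho)) = rho)
    (is_hawkes : forall rho : R, 0 < rho < 1 ->
      hawkes lambda (exp_excitation (r rho)) (B rho)
        (M rho) (tau rho) (Bs rho))
    (is_stationary : forall rho : R, 0 < rho < 1 ->
      stationary_intensity (P rho) lambda (exp_excitation (r rho))
        (M rho) (tau rho) (Bs rho) (Lambda rho))
    (r_lim_gt0 : 0 < r_lim)
    (r_cvg : r rho @[rho --> 1^'-] --> r_lim)
    (b2_cvg : b2 rho @[rho --> 1^'-] --> b2_lim)
    (B_unif_integrable : forall e : R, 0 < e -> exists K : R,
      \forall rho \near 1^'-,
        (\int[P rho]_(w in [set w | (K < B rho w)%R])
           ((B rho w ^+ 2)%R)%:E <= e%:E)%E) :
  cvg_in_law 1^'- P' (fun rho w => (1 - rho) * Lambda rho w)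
    (gamma_prob (2 * r_lim * lambda / b2_lim) (2 * r_lim / b2_lim)).

Proof.
have near01 : \forall rho \near (1 : R)^'-, 0 < rho < 1.
  near=> rho; apply/andP; split; near: rho; first exact: nbhs_left_gt.
  exact: nbhs_left_lt.
have b1E rho : 0 < rho < 1 -> b1 rho = rho * r rho.
  by move=> rho01; apply: hawkes_load_exp (load rho rho01); exact: r_gt0.
have b2_ge rho : 0 < rho < 1 -> (rho * r rho) ^+ 2 <= b2 rho.
  move=> rho01; rewrite -b1E//.
  exact: (mark_second_moment_ge (hawkes_mark_ge0 (is_hawkes rho rho01))
    (B_moment1 rho rho01) (B_moment2 rho rho01)).
have b2_gt0 : 0 < b2_lim.
  apply: (@lt_le_trans _ _ ((1 * r_lim) ^+ 2)); first by rewrite mul1r exprn_gt0.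
  have cvg2 : (rho * r rho) ^+ 2 @[rho --> (1 : R)^'-] --> (1 * r_lim) ^+ 2.
    rewrite expr2; under eq_cvg do rewrite expr2.
    have h : rho * r rho @[rho --> (1 : R)^'-] --> 1 * r_lim.
      by apply: cvgM => //; apply: cvg_at_left_filter; exact: cvg_id.
    exact: (cvgM h h).
  by apply: ler_cvg_to cvg2 b2_cvg _; near=> rho; apply: b2_ge; near: rho.
set a := 2 * r_lim * lambda / b2_lim; set b := 2 * r_lim / b2_lim.
have b_gt0 : 0 < b by rewrite divr_gt0// mulr_gt0.
have a_gt0 : 0 < a by rewrite divr_gt0// !mulr_gt0.
pose X rho (w : T' rho) : R := (1 - rho) * `|Lambda rho w|.
have mX rho : measurable_fun setT (X rho).
  by apply: measurable_funM => //; exact: measurableT_comp.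
have X0 : \forall rho \near (1 : R)^'-, forall w, 0 <= X rho w.
  apply: filterS near01 => rho /andP[_ rho1] w.
  by rewrite mulr_ge0// subr_ge0 ltW.
have lap (S : R) : 0 < S -> \int[P' rho]_w expR (- (S * X rho w)) @[rho --> 1^'-] -->
    \int[gamma_probability a_gt0 b_gt0]_x expR (- (S * `|x|)).
  move=> S0; rewrite gamma_laplace ?(ltW S0)//.
  apply/cvgrPdist_le => e0 e0_gt0.
  pose e : R := e0 * b / S.
  have e_gt0 : 0 < e by rewrite divr_gt0// mulr_gt0.
  (* The second term is the smallness asked by [ode_error]; the cap at 1 keeps b2 below [b2_lim + 1]
     in [mark_remainder_le]. *)
  pose delta : R := Num.min 1 (e * (b2_lim / 2) / (lambda * (2 + 3 * S))).
  have lS : 0 < lambda * (2 + 3 * S) by rewrite mulr_gt0// addr_gt0// mulr_gt0.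
  have delta_gt0 : 0 < delta.
    by rewrite lt_min ltr01 divr_gt0// mulr_gt0// divr_gt0.
  have delta1 : delta <= 1 by rewrite ge_min lexx.
  have deltaE : lambda * (2 + 3 * S) * delta <= e * (b2_lim / 2).
    by rewrite mulrC -ler_pdivlMr// ge_min lexx orbT.
  have [K0 tail] := B_unif_integrable delta delta_gt0.
  (* The expansion needs a nonnegative truncation level, and raising the level only shrinks the
     tail. *)
  pose K := Num.max K0 0; have K_ge0 : 0 <= K by rewrite le_max lexx orbT.
  pose q := S * K * (b2_lim + 1).
  have q0 : 0 <= q by rewrite !mulr_ge0// ?(ltW S0)// addr_ge0// ltW.
  have /cvgrPdist_le/(_ _ delta_gt0) near_r := r_cvg.
  have /cvgrPdist_le/(_ _ delta_gt0) near_b2 := b2_cvg.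
  near=> rho.
  have rho01 : 0 < rho < 1 by near: rho.
  have /andP[rho_gt0 rho_lt1] := rho01.
  have dr : `|r_lim - r rho| <= delta by near: rho.
  have db : `|b2_lim - b2 rho| <= delta by near: rho.
  have tailK0 : (\int[P rho]_(w in [set w | (K0 < B rho w)%R])
      ((B rho w ^+ 2)%R)%:E <= delta%:E)%E by near: rho.
  have tailK : (\int[P rho]_(w in [set w | (K < B rho w)%R])
      ((B rho w ^+ 2)%R)%:E <= delta%:E)%E.
    apply: le_trans tailK0; apply: ge0_subset_integral => //.
    - have -> : [set w | K < B rho w] = B rho @^-1` `]K, +oo[%classic.
        by apply/seteqP; split => w /=; rewrite in_itv/= andbT.
      exact: measurable_funPTI.
    - have -> : [set w | K0 < B rho w] = B rho @^-1` `]K0, +oo[%classic.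
        by apply/seteqP; split => w /=; rewrite in_itv/= andbT.
      exact: measurable_funPTI.
    - apply: measurable_funTS; apply/measurable_EFinP; apply: measurable_funX.
      exact: measurable_funPT.
    - by move=> w _; rewrite lee_fin sqr_ge0.
    - by move=> w /=; apply: le_lt_trans; rewrite le_max lexx.
  have rhoq : 1 - rho <= delta / (q + 1).
    rewrite lerBlDr -lerBlDl; near: rho; apply: nbhs_left_ge.
    by rewrite gtrBl divr_gt0// ltr_wpDl.
  have Xr0 w : 0 <= X rho w by rewrite mulr_ge0// subr_ge0 ltW.
  have -> : e0 = S / b * e by rewrite /e; field; rewrite !gt_eqF.
  apply: laplace_gamma_bound => //; [exact: ltW|exact: ltW|].
  move=> s /andP[s_gt0 sS].
  have [eta [eq /andP[eta0 eta1] etaK]] :=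
    scaled_stationary_identity lambda_gt0 (r_gt0 rho rho01) rho01
      (B_moment1 rho rho01) (B_moment2 rho rho01) (load rho rho01)
      (is_hawkes rho rho01) (is_stationary rho rho01) s_gt0.
  have phi01 := laplace_itv (P' rho) (mX rho) Xr0 (ltW s_gt0).
  have /andP[phi0 phi1] := phi01.
  have psi0 : 0 <= \int[P' rho]_w (X rho w * expR (- (s * X rho w))).
    by apply: Rintegral_ge0 => w _; rewrite mulr_ge0// expR_ge0.
  (* Since eta <= b2/2, the identity gives r psi <= r lambda phi <= r lambda: a bound uniform in rho
     and s, obtained without a first moment of X. *)
  have psi1 : \int[P' rho]_w (X rho w * expR (- (s * X rho w))) <= lambda.
    have rr := r_gt0 rho rho01.
    rewrite -(ler_pM2l rr).
    apply: (@le_trans _ _ (r rho * lambda *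
        \int[P' rho]_w expR (- (s * X rho w)))).
      rewrite -eq ler_wpM2r// lerDl mulr_ge0 ?(ltW s_gt0)// subr_ge0//.
    by rewrite ler_piMr// mulr_ge0 ?(ltW rr)// ltW.
  have eta2 : eta <= 2 * delta.
    rewrite (le_trans (etaK K delta K_ge0 tailK))//.
    exact: (mark_remainder_le (ltW delta_gt0) delta1 (ltW s_gt0) (ltW sS) K_ge0 q0 erefl
      (ltW b2_gt0) db rhoq (ltW rho_lt1)).
  apply: (ode_error (r := r rho) (b2 := b2 rho) (eta := eta) (S := S) (delta := delta)
    (lambda := lambda)) => //.
  - exact: ltW.
  - by rewrite eta0 eta2.
  - by rewrite psi0 psi1.
  - by rewrite !ltW.
move=> f cf [K fK].
have mf := continuous_measurable_fun cf.
rewrite (integral_gamma_norm a_gt0 b_gt0 mf fK).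
have lim := laplace_continuity mX X0 (@normr_measurable R setT) (@normr_ge0 _ R) lap cf fK.
have limE : (\int[P' rho]_w f (X rho w))%:E @[rho --> 1^'-] -->
    (\int[gamma_probability a_gt0 b_gt0]_x f `|x|)%:E.
  by apply: cvg_EFin; [exact: nearW|exact: lim].
apply: cvg_trans limE; apply: near_eq_cvg; near=> rho.
have rho01 : 0 < rho < 1 by near: rho.
have IfX (Y : T' rho -> R) : measurable_fun setT Y ->
    (P' rho).-integrable setT (EFin \o (fun w => f (Y w))).
  move=> mY; apply: (@bounded_integrable _ _ _ _ _ K); first exact: measurableT_comp.
  by move=> w; exact: fK.
have IX := IfX _ (mX rho).
have mL : measurable_fun setT (fun w => (1 - rho) * Lambda rho w).
  by apply: measurable_funM => //; exact: measurable_funPT.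
rewrite /Rintegral /= fineK; last exact: integrable_fin_num.
rewrite unlock; apply: ae_eq_integral => //.
- exact: (measurable_int (P' rho) IX).
- exact: (measurable_int (P' rho) (IfX _ mL)).
- have := stationary_ge0 (is_hawkes rho rho01) lambda_gt0 (is_stationary rho rho01).
  by apply: filterS => w w0 _ /=; rewrite /X ger0_norm.
Unshelve. all: by end_near. Qed.
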